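(* Let $G$ be a compact Lie group. Suppose that a set $K$ of cofibrant objects in $\mathrm{Top}^G$ is closed under the operations $-\wedge S^1$ and $-\wedge(G/H)_+$ for all closed subgroups $H<G$. Then $(\mathrm{Top}^G,K)$ satisfies condition \$.
   Context: $\mathrm{Top}^G$ is the category of pointed $G$-equivariant compactly generated spaces, closed symmetric monoidal under $\wedge$ with internal hom $\mathrm{Map}(X,Y)$ the space of all continuous pointed maps with conjugation action; $\mathrm{Map}_G(X,Y)=\mathrm{Map}(X,Y)^G$ is the space of equivariant maps. Weak equivalences (resp. fibrations) are the maps $f$ such that $f^H$ is a weak homotopy equivalence (resp. Serre fibration) for all closed subgroups $H<G$; the generating (trivial) cofibrations are the maps $i\wedge(G/H)_+$ with $H<G$ closed and $i$ a generating (trivial) cofibration of pointed spaces ($S^{n-1}_+\to D^n_+$, resp. $D^n_+\to(D^n\times[0,1])_+$, $n\ge0$). $J$ denotes the set of generating trivial cofibrations. A map $f$ is a $K$-colocal equivalence if the map of homotopy function complexes $\mathrm{map}(A,f)$ is a weak equivalence for every $A\in K$; since $\mathrm{Top}^G$ is a topological model category with all objects fibrant, this may be tested with $\mathrm{Map}_G(A,f)$. Put $\Lambda(K)=\{A\wedge S^{n-1}_+\to A\wedge D^n_+ : A\in K,\ n\ge0\}$. Condition \$: for every domain or codomain $A$ of a map in $\Lambda(K)\cup J$, the functor $\mathrm{Map}(A,-):\mathrm{Top}^G\to\mathrm{Top}^G$ takes $K$-colocal equivalences between fibrant objects to $K$-colocal equivalences. *)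

(* Defs.v *)
From HB Require Import structures.
From mathcomp Require Import all_boot all_order all_algebra.
From mathcomp Require Import generic_quotient finmap.
From mathcomp Require Import all_classical.
From mathcomp Require Import reals topology normedtype derive.

Set Implicit Arguments.
Unset Strict Implicit.
Unset Printing Implicit Defensive.

Import Order.TTheory GRing.Theory Num.Theory.
Import numFieldTopology.Exports numFieldNormedType.Exports.
Local Open Scope classical_set_scope.
Local Open Scope ring_scope.

Section continuity_facts.

Lemma comp_continuous (X Y Z : topologicalType) (f : X -> Y) (g : Y -> Z) :
  continuous f -> continuous g -> continuous (fun x => g (f x)).
Proof. by move=> cf cg x; apply: continuous_comp; [exact: cf|exact: cg]. Qed.

Lemma pair_continuous (X Y Z : topologicalType) (f : X -> Y) (g : X -> Z) :
  continuous f -> continuous g -> continuous (fun x => (f x, g x)).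
Proof. by move=> cf cg x; exact: cvg_pair (cf x) (cg x). Qed.

Lemma fst_continuous (X Y : topologicalType) : continuous (@fst X Y).
Proof. by move=> ?; exact: cvg_fst. Qed.

Lemma snd_continuous (X Y : topologicalType) : continuous (@snd X Y).
Proof. by move=> ?; exact: cvg_snd. Qed.

Lemma id_continuous (X : topologicalType) : continuous (fun x : X => x).
Proof. by move=> ?; exact: cvg_id. Qed.

Lemma set_val_continuous (X : topologicalType) (A : set X) :
  continuous (set_val : set_type A -> X).
Proof. exact: initial_continuous. Qed.

End continuity_facts.

Definition compact_hausdorff (C : topologicalType) : Prop :=
  compact [set: C] /\ hausdorff_space C.

Section compact_hausdorff_facts.

Lemma compact_hausdorff_prod (C D : topologicalType) :
  compact_hausdorff C -> compact_hausdorff D -> compact_hausdorff (C * D)%type.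
Proof.
move=> [cC hC] [cD hD]; split; first by rewrite -setXTT; exact: compact_setX.
move=> [c d] [c' d'] cl; congr pair.
- apply: hC => A B cA dB.
  have [[x y] [/= [Ax _] [Bx _]]] : (A `*` [set: D]) `&` (B `*` [set: D]) !=set0.
    by apply: cl; [exists (A, setT)|exists (B, setT)] => //=; split=> //;
      exact: filterT.
  by exists x.
- apply: hD => A B cA dB.
  have [[x y] [/= [_ Ay] [_ By]]] : ([set: C] `*` A) `&` ([set: C] `*` B) !=set0.
    by apply: cl; [exists (setT, A)|exists (setT, B)] => //=; split=> //;
      exact: filterT.
  by exists y.
Qed.

Lemma compact_set_type_hausdorff (C : topologicalType) (A : set C) :
  hausdorff_space C -> compact A -> compact_hausdorff (set_type A).
Proof.
move=> hC cA; split.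
- move=> F FF _.
  have [] := cA (set_val @ F).
    by rewrite /= /fmap /=; apply: filterS filterT => x _; exact: set_valP.
  move=> p [Ap clp]; exists (exist _ p (mem_set Ap)); split=> // B U FB.
  move=> [_ [[V oV <-] /= Vp VU]].
  have [] := clp (set_val @` B) V.
  + have sB : B `<=` set_val @^-1` (set_val @` B) by move=> x Bx; exists x.
    exact: filterS sB FB.
  + by apply: open_nbhs_nbhs; split => //; move: Vp; rewrite set_valE.
  by move=> _ [[x Bx <-] Vx]; exists x; split => //; exact: VU.
- move=> p q cl; apply: val_inj; apply: hC => U V pU qV.
  have [] := cl (set_val @^-1` U) (set_val @^-1` V).
  + exact: (@initial_continuous _ _ set_val p).
  + exact: (@initial_continuous _ _ set_val q).
  by move=> x [Ux Vx]; exists (set_val x).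
Qed.

Lemma compact_hausdorff_set_type (C : topologicalType) (A : set C) :
  compact_hausdorff C -> closed A -> compact_hausdorff (set_type A).
Proof.
move=> [cC hC] clA; apply: compact_set_type_hausdorff => //.
exact: subclosed_compact clA cC (@subsetT _ _).
Qed.

Lemma compact_hausdorff_regular (C : topologicalType) (c : C) (U : set C) :
  compact_hausdorff C -> nbhs c U -> exists N, [/\ closed N, nbhs c N & N `<=` U].
Proof.
move=> [cC hC] cU.
have [A cA AU] := compact_regular hC cC filterT cU.
exists (closure A); split => //; first exact: closed_closure.
by apply: filterS cA; exact: subset_closure.
Qed.

Lemma open_tube (C D : topologicalType) (U : set (C * D)) :
  compact [set: C] -> open U -> open [set d | forall c, U (c, d)].
Proof.
rewrite compact_near_coveringP => cC oU; rewrite openE => d Ud.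
have h : \forall d' \near d, [set: C] `<=` (fun c => U (c, d')).
  apply: (cC D (nbhs d) (fun d' c => U (c, d'))) => c _.
  have nU : nbhs (c, d) U by apply: open_nbhs_nbhs; split; [|exact: Ud].
  by apply: (filterS _ nU) => -[].
by apply: (filterS _ h) => d' h' c; exact: h'.
Qed.

End compact_hausdorff_facts.

(* A subset is [kopen] if its preimage under every continuous map from a compact
   Hausdorff space is open; X is a k-space if its kopen subsets are open.
   Compactly generated spaces are the weak Hausdorff k-spaces, and products and
   mapping spaces are formed by applying k-ification [kify]. *)
Definition kopen (X : topologicalType) (U : set X) : Prop :=
  forall (C : topologicalType) (u : C -> X),
    compact_hausdorff C -> continuous u -> open (u @^-1` U).

Definition k_space (X : topologicalType) : Prop :=
  forall U : set X, kopen U -> open U.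

Definition weak_hausdorff (X : topologicalType) : Prop :=
  forall (C : topologicalType) (u : C -> X),
    compact_hausdorff C -> continuous u -> closed (range u).

Definition compactly_generated (X : topologicalType) : Prop :=
  k_space X /\ weak_hausdorff X.

Definition kify (X : Type) : Type := X.

Section kify_topology.
Context {X : topologicalType}.

HB.instance Definition _ := Choice.on (kify X).

Let kopenT : @kopen X setT.
Proof. by move=> C u _ _; rewrite preimage_setT; exact: openT. Qed.

Let kopenI : setI_closed (@kopen X).
Proof.
by move=> A B kA kB C u hC cu; rewrite preimage_setI; apply: openI;
  [exact: kA|exact: kB].
Qed.

Let kopen_bigU (I : Type) (f : I -> set X) :
  (forall i, kopen (f i)) -> kopen (\bigcup_i f i).
Proof.
move=> kf C u hC cu; rewrite preimage_bigcup; apply: bigcup_open => i _.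
exact: kf.
Qed.

HB.instance Definition _ :=
  isOpenTopological.Build (kify X) kopenT kopenI kopen_bigU.

Lemma kify_openE (U : set (kify X)) : open U = @kopen X U.
Proof. by []. Qed.

End kify_topology.

Section k_space_facts.

Lemma kify_id_continuous (X : topologicalType) :
  continuous (fun x : kify X => x : X).
Proof.
apply/continuousP => U oU; rewrite kify_openE => C u hC cu.
by move/continuousP : cu; apply.
Qed.

Lemma kify_test_continuous (X C : topologicalType) (u : C -> X) :
  compact_hausdorff C -> continuous u -> continuous (u : C -> kify X).
Proof.
by move=> hC cu; apply/continuousP => U; rewrite kify_openE => kU; exact: kU.
Qed.

Lemma kify_test_continuousN (X C : topologicalType) (u : C -> kify X) :
  continuous u -> continuous (u : C -> X).
Proof.
by move=> cu; exact: (comp_continuous cu (@kify_id_continuous X)).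
Qed.

Lemma kify_k_space (X : topologicalType) : k_space (kify X).
Proof.
move=> U kU; rewrite kify_openE => C u hC cu.
exact: (kU C u hC (kify_test_continuous hC cu)).
Qed.

Lemma k_space_continuous (X Y : topologicalType) (f : X -> Y) : k_space X ->
  (forall (C : topologicalType) (u : C -> X),
     compact_hausdorff C -> continuous u -> continuous (f \o u)) ->
  continuous f.
Proof.
move=> kX fC; apply/continuousP => U oU; apply: kX => C u hC cu.
by have /continuousP := fC C u hC cu; exact.
Qed.

(* For k-spaces this is equivalent to weak Hausdorffness (the diagonal is
   closed in the k-product). *)
Definition k_diagonal (X : topologicalType) : Prop :=
  forall (C : topologicalType) (u v : C -> X),
    compact_hausdorff C -> continuous u -> continuous v ->
    closed [set c | u c = v c].

Lemma weak_hausdorff_diagonal (X : topologicalType) :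
  weak_hausdorff X -> k_diagonal X.
Proof.
move=> wX C u v hC cu cv; rewrite -openC openE => c0 /= uv.
have cl1 (x : X) (c : C) : closed [set x].
  have -> : [set x] = range (fun _ : C => x).
    by apply/seteqP; split=> [_ ->|_ [_ _ <-]] //; exists c.
  by apply: wX => //; exact: cst_continuous.
have nU : nbhs c0 (u @^-1` ~` [set v c0]).
  apply: open_nbhs_nbhs; split => //.
  by move/continuousP : cu; apply; rewrite openC; exact: cl1.
have [N [clN cN NU]] := compact_hausdorff_regular hC nU.
have hN := compact_hausdorff_set_type hC clN.
have clR : closed (range (u \o (set_val : set_type N -> C))).
  by apply: wX => //; exact: (comp_continuous (@set_val_continuous _ N) cu).
have nV : nbhs c0 (v @^-1` ~` range (u \o (set_val : set_type N -> C))).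
  apply: open_nbhs_nbhs; split.
    by move/continuousP : cv; apply; rewrite openC.
  move=> -[x _ /= ux]; exact: (NU _ (set_valP x) ux).
rewrite /interior; near=> c.
move=> /= uvc.
have : (v @^-1` ~` range (u \o (set_val : set_type N -> C))) c by near: c.
apply; have Nc : N c by near: c.
by exists (exist _ c (mem_set Nc)).
Unshelve. all: by end_near. Qed.

Lemma k_diagonal_weak_hausdorff (X : topologicalType) :
  k_space X -> k_diagonal X -> weak_hausdorff X.
Proof.
move=> kX dX C u hC cu; rewrite -openC; apply: kX => D v hD cv.
have : closed [set cd : C * D | u cd.1 = v cd.2].
  apply: dX; first exact: compact_hausdorff_prod.
  - exact: (comp_continuous (@fst_continuous C D) cu).
  - exact: (comp_continuous (@snd_continuous C D) cv).
rewrite -openC => /(open_tube hC.1); congr open.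
apply/seteqP; split=> [d /= h [c _ ucd]|d /= h c ucd]; first exact: (h c).
by apply: h; exists c.
Qed.

Lemma k_diagonal_kify (X : topologicalType) : k_diagonal X -> k_diagonal (kify X).
Proof.
move=> dX C u v hC cu cv.
exact: (dX C u v hC (kify_test_continuousN cu) (kify_test_continuousN cv)).
Qed.

Lemma k_diagonal_prod (X Y : topologicalType) :
  k_diagonal X -> k_diagonal Y -> k_diagonal (X * Y)%type.
Proof.
move=> dX dY C u v hC cu cv.
have -> : [set c | u c = v c] =
    [set c | (u c).1 = (v c).1] `&` [set c | (u c).2 = (v c).2].
  apply/seteqP; split=> [c /= ->|c /= [h1 h2]] //.
  by rewrite (surjective_pairing (u c)) h1 h2 -surjective_pairing.
apply: closedI.
- apply: (dX C (fun c => (u c).1) (fun c => (v c).1)) => //;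
  exact: (comp_continuous _ (@fst_continuous X Y)).
- apply: (dY C (fun c => (u c).2) (fun c => (v c).2)) => //;
  exact: (comp_continuous _ (@snd_continuous X Y)).
Qed.

Lemma compactly_generated_kify (X : topologicalType) :
  k_diagonal X -> compactly_generated (kify X).
Proof.
move=> dX; split; first exact: kify_k_space.
by apply: k_diagonal_weak_hausdorff; [exact: kify_k_space|exact: k_diagonal_kify].
Qed.

Lemma compact_hausdorff_compactly_generated (X : topologicalType) :
  compact_hausdorff X -> compactly_generated X.
Proof.
move=> hX; split=> [U kU|C u hC cu].
  exact: (kU X id hX (@id_continuous X)).
apply: compact_closed; first exact: hX.2.
by apply: continuous_compact; [exact: continuous_subspaceT|exact: hC.1].
Qed.

Lemma compactly_generated_closed1 (X : topologicalType) (x : X) :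
  compactly_generated X -> closed [set x].
Proof.
move=> [_ wX].
have -> : [set x] = range (fun _ : bool => x).
  by apply/seteqP; split=> [_ ->|_ [_ _ <-]] //; exists true.
apply: wX; last exact: cst_continuous.
split; last exact: discrete_hausdorff.
by apply: finite_compact; exact: finite_finset.
Qed.

(* The product of a compact Hausdorff space and a k-space, with the ordinary
   product topology, is a k-space. *)
Lemma k_space_prod_compact (C X : topologicalType) :
  compact_hausdorff C -> k_space X -> k_space (C * X)%type.
Proof.
move=> hC kX O kO; rewrite openE => -[c0 x0] Ocx.
have oS : open [set c | O (c, x0)].
  apply: (kO C (fun c => (c, x0)) hC); apply: pair_continuous.
    exact: id_continuous.
  exact: cst_continuous.
have [N [clN cN NU]] :=
  compact_hausdorff_regular hC (open_nbhs_nbhs (conj oS Ocx)).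
have hN := compact_hausdorff_set_type hC clN.
pose W := [set x | forall c : set_type N, O (set_val c, x)].
have oW : open W.
  apply: kX => D u hD cu.
  have := @open_tube (set_type N) D [set cd | O (set_val cd.1, u cd.2)] hN.1.
  apply; apply: (kO _ (fun cd => (set_val cd.1, u cd.2))).
    exact: compact_hausdorff_prod.
  apply: pair_continuous.
  - exact: (comp_continuous (@fst_continuous _ _) (@set_val_continuous _ N)).
  - exact: (comp_continuous (@snd_continuous _ _) cu).
exists (N, W); first split => //=.
- apply: open_nbhs_nbhs; split => // c; exact: (NU _ (set_valP c)).
- by move=> [c x] /= [Nc Wx]; exact: (Wx (exist _ c (mem_set Nc))).
Qed.

End k_space_facts.

HB.mixin Record isCompactGroup G & Group G & Topological G := {
  mulg_continuous : continuous (fun xy : G * G => (xy.1 * xy.2)%g);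
  invg_continuous : continuous (fun x : G => (x^-1)%g);
  group_compact : compact [set: G];
  group_hausdorff : hausdorff_space G
}.

#[short(type="compactGroupType")]
HB.structure Definition CompactGroup :=
  {G of Group G & Topological G & isCompactGroup G}.

Section lie_group.
Context (R : realType).

(* [Ck k U f] is meant for open U: f is of class C^k on U. *)
Fixpoint Ck (n m k : nat) (U : set 'rV[R]_n) (f : 'rV[R]_n -> 'rV[R]_m) : Prop :=
  if k is k'.+1 then
    [/\ forall x, U x -> {for x, continuous f},
        forall (i : 'I_n) x, U x -> derivable f x (delta_mx 0 i)
      & forall i : 'I_n, Ck k' U (fun x => 'D_(delta_mx 0 i) f x)]
  else forall x, U x -> {for x, continuous f}.

Definition smooth_on (n m : nat) (U : set 'rV[R]_n) (f : 'rV[R]_n -> 'rV[R]_m) :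
  Prop := forall k, Ck k U f.

Record chart (X : topologicalType) (n : nat) := Chart {
  chart_dom : set X;
  chart_img : set 'rV[R]_n;
  chart_fun : X -> 'rV[R]_n;
  chart_inv : 'rV[R]_n -> X;
  chart_dom_open : open chart_dom;
  chart_img_open : open chart_img;
  chart_funP : forall x, chart_dom x ->
    chart_img (chart_fun x) /\ chart_inv (chart_fun x) = x;
  chart_invP : forall v, chart_img v ->
    chart_dom (chart_inv v) /\ chart_fun (chart_inv v) = v;
  chart_fun_continuous : forall x, chart_dom x -> {for x, continuous chart_fun};
  chart_inv_continuous : forall v, chart_img v -> {for v, continuous chart_inv}
}.

(* Second countability is automatic for a compact manifold. *)
Definition is_lie_group (G : compactGroupType) : Prop :=
  exists (n : nat) (atlas : set (chart G n)),
  [/\ forall x : G, exists2 c, atlas c & chart_dom c x,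
      forall c d, atlas c -> atlas d ->
        smooth_on [set v | chart_img c v /\ chart_dom d (chart_inv c v)]
                  (fun v => chart_fun d (chart_inv c v)),
      forall c d, atlas c -> atlas d ->
        smooth_on [set v | chart_img c v /\ chart_dom d (chart_inv c v)^-1%g]
                  (fun v => chart_fun d (chart_inv c v)^-1%g)
    & forall a b c, atlas a -> atlas b -> atlas c ->
        smooth_on
          [set v : 'rV[R]_(n + n) |
             [/\ chart_img a (lsubmx v), chart_img b (rsubmx v)
               & chart_dom c (chart_inv a (lsubmx v) * chart_inv b (rsubmx v))%g]]
          (fun v : 'rV[R]_(n + n) =>
             chart_fun c (chart_inv a (lsubmx v) * chart_inv b (rsubmx v))%g)].

End lie_group.

Record closed_subgroup (G : compactGroupType) := ClosedSubgroup {
  csg_set : set G;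
  csg_closed : closed csg_set;
  csg1 : csg_set 1%g;
  csgM : forall x y, csg_set x -> csg_set y -> csg_set (x * y)%g;
  csgV : forall x, csg_set x -> csg_set x^-1%g
}.

(* The objects of Top^G.  As G is compact Hausdorff, the product G * X already is
   a k-space, so there is no need to k-ify it. *)
Record gspace (G : compactGroupType) := GSpace {
  gs_car :> topologicalType;
  gs_cg : compactly_generated gs_car;
  gs_pt : gs_car;
  gs_act : G -> gs_car -> gs_car;
  gs_act_continuous : continuous (fun gx : G * gs_car => gs_act gx.1 gx.2);
  gs_act1 : forall x, gs_act 1%g x = x;
  gs_actM : forall g h x, gs_act (g * h)%g x = gs_act g (gs_act h x);
  gs_act_pt : forall g, gs_act g gs_pt = gs_pt
}.

Record gmap (G : compactGroupType) (X Y : gspace G) := GMap {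
  gm_fun :> X -> Y;
  gm_continuous : continuous gm_fun;
  gm_pt : gm_fun (gs_pt X) = gs_pt Y;
  gm_act : forall g x, gm_fun (gs_act g x) = gs_act g (gm_fun x)
}.

Definition gspace_iso (G : compactGroupType) (X Y : gspace G) : Prop :=
  exists (f : gmap X Y) (h : gmap Y X), cancel f h /\ cancel h f.

Section group_facts.
Context (G : compactGroupType).

Lemma group_compact_hausdorff : compact_hausdorff G.
Proof. by split; [exact: group_compact|exact: group_hausdorff]. Qed.

Lemma act_continuous (X Y : topologicalType) (a : G -> X -> Y) :
  k_space X ->
  (forall (C : topologicalType) (g : C -> G) (u : C -> X), compact_hausdorff C ->
     continuous g -> continuous u -> continuous (fun c => a (g c) (u c))) ->
  continuous (fun gx : G * X => a gx.1 gx.2).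
Proof.
move=> kX h; apply: k_space_continuous => [|C u hC cu].
  exact: k_space_prod_compact group_compact_hausdorff kX.
apply: (h C (fun c => (u c).1) (fun c => (u c).2)) => //.
- exact: (comp_continuous cu (@fst_continuous _ _)).
- exact: (comp_continuous cu (@snd_continuous _ _)).
Qed.

Lemma act_test_continuous (X : gspace G) (C : topologicalType) (g : C -> G)
    (u : C -> X) :
  continuous g -> continuous u -> continuous (fun c => gs_act (g c) (u c)).
Proof.
move=> cg cu.
exact: (comp_continuous (pair_continuous cg cu) (@gs_act_continuous G X)).
Qed.

Lemma act1_continuous (X : gspace G) (g : G) : continuous (@gs_act G X g).
Proof.
apply: act_test_continuous; [exact: cst_continuous|exact: id_continuous].
Qed.

Lemma gs_k_diagonal (X : gspace G) : k_diagonal X.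
Proof. exact: weak_hausdorff_diagonal (gs_cg X).2. Qed.

End group_facts.

(* The smash product with the diagonal action: the quotient of the k-product by
   the wedge. *)
Section smash.
Context (G : compactGroupType) (X Y : gspace G).
Local Open Scope quotient_scope.

Definition kprod : Type := kify (X * Y)%type.
HB.instance Definition _ := Topological.on kprod.

Definition in_wedge (p : kprod) : Prop := p.1 = gs_pt X \/ p.2 = gs_pt Y.

Definition smash_rel (p q : kprod) : bool :=
  `[< p = q \/ (in_wedge p /\ in_wedge q) >].

Let smash_rel_refl : reflexive smash_rel.
Proof. by move=> p; apply/asboolP; left. Qed.

Let smash_rel_sym : symmetric smash_rel.
Proof.
by move=> p q; apply/asboolP/asboolP => -[->|[? ?]]; [left|right|left|right].
Qed.

Let smash_rel_trans : transitive smash_rel.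
Proof.
move=> q p r /asboolP[->|[wp wq]] /asboolP => [[->|[? ?]]|[<-|[? ?]]];
  by apply/asboolP; (try by left); right.
Qed.

Canonical smash_equiv :=
  EquivRel smash_rel smash_rel_refl smash_rel_sym smash_rel_trans.

Definition smash_car : Type := quotient_topology {eq_quot smash_equiv}.
HB.instance Definition _ := Topological.on smash_car.
HB.instance Definition _ := Quotient.on smash_car.

Definition smash_pi (p : kprod) : smash_car := \pi_smash_car p.

Lemma smash_piP (p q : kprod) :
  smash_pi p = smash_pi q <-> p = q \/ (in_wedge p /\ in_wedge q).
Proof.
split=> [/eqmodP/asboolP //|h]; apply/eqmodP; exact/asboolP.
Qed.

End smash.

(* Continuity of an action on a quotient space, the acting space being compact. *)
Lemma quotient_act_continuous (G : compactGroupType) (Z S : topologicalType)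
    (q : Z -> S) (aZ : G -> Z -> Z) (aS : G -> S -> S) :
  (forall U : set S, open (q @^-1` U) -> open U) -> continuous q ->
  (forall s, exists z, q z = s) ->
  continuous (fun gz : G * Z => aZ gz.1 gz.2) ->
  (forall g z, q (aZ g z) = aS g (q z)) ->
  continuous (fun gs : G * S => aS gs.1 gs.2).
Proof.
move=> qo cq qs ca qa; apply/continuousP => O oO; rewrite openE => -[g0 s0] /= Ogs.
have [z0 zs0] := qs s0.
have oO' : open (q @^-1` O) by move/continuousP : cq; apply.
have oA : open [set gz : G * Z | O (aS gz.1 (q gz.2))].
  have -> : [set gz : G * Z | O (aS gz.1 (q gz.2))] =
      (fun gz : G * Z => aZ gz.1 gz.2) @^-1` (q @^-1` O).
    by apply/seteqP; split=> gz /=; rewrite qa.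
  by move/continuousP : ca; apply.
have oS : open [set g | O (aS g s0)].
  have c : continuous (fun g : G => (g, z0)).
    by apply: pair_continuous; [exact: id_continuous|exact: cst_continuous].
  move/continuousP : c => /(_ _ oA); congr open.
  by apply/seteqP; split=> g /=; rewrite zs0.
have [N [clN cN NO]] := compact_hausdorff_regular
  (group_compact_hausdorff G) (open_nbhs_nbhs (conj oS Ogs)).
have hN := compact_hausdorff_set_type (group_compact_hausdorff G) clN.
pose W := [set s | forall g : set_type N, O (aS (set_val g) s)].
have oW : open W.
  apply: qo.
  have c : continuous (fun gz : set_type N * Z => (set_val gz.1, gz.2)).
    apply: pair_continuous; last exact: snd_continuous.
    exact: (comp_continuous (@fst_continuous _ _) (@set_val_continuous _ N)).
  by move/continuousP : c => /(_ _ oA) /(open_tube hN.1).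
exists (N, W); first split => //=.
- by apply: open_nbhs_nbhs; split => // g; exact: (NO _ (set_valP g)).
- by move=> [g s] /= [Ng Ws]; exact: (Ws (exist _ g (mem_set Ng))).
Qed.

Section kprod_facts.
Context (G : compactGroupType) (X Y : gspace G).

Lemma kprod_fst_continuous : continuous (fun p : kprod X Y => p.1).
Proof. exact: (comp_continuous (@kify_id_continuous _) (@fst_continuous X Y)). Qed.

Lemma kprod_snd_continuous : continuous (fun p : kprod X Y => p.2).
Proof. exact: (comp_continuous (@kify_id_continuous _) (@snd_continuous X Y)). Qed.

Lemma kprod_pair_continuous (C : topologicalType) (u : C -> X) (v : C -> Y) :
  compact_hausdorff C -> continuous u -> continuous v ->
  continuous (fun c => (u c, v c) : kprod X Y).
Proof.
move=> hC cu cv; apply: kify_test_continuous => //; exact: pair_continuous.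
Qed.

Lemma kprod_compactly_generated : compactly_generated (kprod X Y).
Proof.
by apply: compactly_generated_kify; apply: k_diagonal_prod; exact: gs_k_diagonal.
Qed.

Definition kprod_act (g : G) (p : kprod X Y) : kprod X Y :=
  (gs_act g p.1, gs_act g p.2).

Lemma kprod_act_continuous :
  continuous (fun gp : G * kprod X Y => kprod_act gp.1 gp.2).
Proof.
apply: act_continuous; first exact: kprod_compactly_generated.1.
move=> C g u hC cg cu; apply: kprod_pair_continuous => //.
- exact: act_test_continuous cg (comp_continuous cu kprod_fst_continuous).
- exact: act_test_continuous cg (comp_continuous cu kprod_snd_continuous).
Qed.

Lemma in_wedge_act (g : G) (p : kprod X Y) :
  in_wedge p -> in_wedge (kprod_act g p).
Proof. by move=> [] h; [left|right] => /=; rewrite h gs_act_pt. Qed.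

Lemma closed_wedge : closed (@in_wedge G X Y).
Proof.
have -> : @in_wedge G X Y =
    (fun p : kprod X Y => p.1) @^-1` [set gs_pt X] `|`
    (fun p : kprod X Y => p.2) @^-1` [set gs_pt Y] by [].
apply: closedU.
- move/continuous_closedP : kprod_fst_continuous; apply.
  exact: compactly_generated_closed1 (gs_cg X).
- move/continuous_closedP : kprod_snd_continuous; apply.
  exact: compactly_generated_closed1 (gs_cg Y).
Qed.

End kprod_facts.

Section smash_facts.
Context (G : compactGroupType) (X Y : gspace G).
Local Open Scope quotient_scope.

Lemma smash_pi_continuous : continuous (@smash_pi G X Y).
Proof. exact: pi_continuous. Qed.

Lemma smash_open (U : set (smash_car X Y)) :
  open (@smash_pi G X Y @^-1` U) -> open U.
Proof. by []. Qed.

Lemma smash_reprK (s : smash_car X Y) : smash_pi (repr s) = s.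
Proof. exact: reprK. Qed.

Definition smash_pt : smash_car X Y := smash_pi (gs_pt X, gs_pt Y).

Lemma smash_pi_pt (p : kprod X Y) : smash_pi p = smash_pt <-> in_wedge p.
Proof.
split=> [/smash_piP[->|[]]//|wp]; first by left.
by apply/smash_piP; right; split => //; left.
Qed.

Lemma smash_k_space : k_space (smash_car X Y).
Proof.
move=> U kU; apply: smash_open; apply: (kprod_compactly_generated X Y).1.
move=> C u hC cu.
exact: (kU C _ hC (comp_continuous cu smash_pi_continuous)).
Qed.

Lemma smash_closed1 (s : smash_car X Y) : closed [set s].
Proof.
rewrite -openC; apply: smash_open; rewrite -preimage_setC openC.
rewrite -(smash_reprK s); have [w|w] := pselect (in_wedge (repr s)).
  rewrite (_ : _ @^-1` _ = @in_wedge G X Y); first exact: closed_wedge.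
  apply/seteqP; split=> p /=.
    by move=> /smash_piP[->|[]].
  by move=> wp; apply/smash_piP; right.
rewrite (_ : _ @^-1` _ = [set repr s]).
  exact: compactly_generated_closed1 (kprod_compactly_generated X Y).
by apply/seteqP; split=> p /= => [/smash_piP[//|[_ /w]]|->].
Qed.

(* Off the base point, X ∧ Y is an open subspace of the k-product. *)
Lemma smash_lift_continuous (C : topologicalType) (u : C -> smash_car X Y) :
  continuous u -> (forall c, u c <> smash_pt) ->
  continuous (fun c => repr (u c) : kprod X Y).
Proof.
move=> cu up; apply/continuousP => O oO.
pose O' := O `&` ~` @in_wedge G X Y.
have oO' : open O' by apply: openI => //; rewrite openC; exact: closed_wedge.
have e : @smash_pi G X Y @^-1` (@smash_pi G X Y @` O') = O'.
  apply/seteqP; split=> [p [p' Op'] /smash_piP[<- //|[wp' _]]|p Op].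
    by case: Op'.
  by exists p.
have oS : open (@smash_pi G X Y @` O') by apply: smash_open; rewrite e.
move/continuousP : cu => /(_ _ oS); congr open; apply/seteqP; split=> c /=.
  move=> Oc; have : (@smash_pi G X Y @^-1` (@smash_pi G X Y @` O')) (repr (u c)).
    by rewrite /= smash_reprK.
  by rewrite e => -[].
move=> Oc; exists (repr (u c)); last exact: smash_reprK.
by split => // /smash_pi_pt; rewrite smash_reprK; exact: up.
Qed.

Let smash_separate (C : topologicalType) (u v : C -> smash_car X Y) (c0 : C) :
  compact_hausdorff C -> continuous u -> continuous v ->
  u c0 <> v c0 -> u c0 <> smash_pt -> nbhs c0 [set c | u c <> v c].
Proof.
move=> hC cu cv uv up.
have nU : nbhs c0 (u @^-1` ~` ([set v c0] `|` [set smash_pt])).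
  apply: open_nbhs_nbhs; split; last by case.
  move/continuousP : cu; apply; rewrite openC; apply: closedU;
    exact: smash_closed1.
have [N [clN cN NU]] := compact_hausdorff_regular hC nU.
have hN := compact_hausdorff_set_type hC clN.
pose w (c : set_type N) : kprod X Y := repr (u (set_val c)).
have cw : continuous w.
  apply: smash_lift_continuous; first exact: comp_continuous (@set_val_continuous _ N) cu.
  by move=> c uc; apply: (NU _ (set_valP c)); right.
have clw : closed (range w) := (kprod_compactly_generated X Y).2 _ _ hN cw.
have wW c : ~ in_wedge (w c).
  by move=> /smash_pi_pt; rewrite smash_reprK => uc;
    apply: (NU _ (set_valP c)); right.
have oR : open (~` (@smash_pi G X Y @` range w)).
  apply: smash_open; rewrite -preimage_setC openC.
  rewrite (_ : _ @^-1` _ = range w) //; apply/seteqP; split=> [p|p rp]; last by exists p.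
  by move=> [_ [c _ <-] /smash_piP[<-|[/wW]//]]; exists c.
have nV : nbhs c0 (v @^-1` ~` (@smash_pi G X Y @` range w)).
  apply: open_nbhs_nbhs; split; first by move/continuousP : cv; apply.
  move=> [_ [c _ <-]]; rewrite smash_reprK => uc.
  by apply: (NU _ (set_valP c)); left.
apply: filterS2 cN nV => c Nc /= vc uvc; apply: vc.
exists (w (exist _ c (mem_set Nc))); first by exists (exist _ c (mem_set Nc)).
by rewrite smash_reprK.
Qed.

Lemma smash_k_diagonal : k_diagonal (smash_car X Y).
Proof.
move=> C u v hC cu cv; rewrite -openC openE => c0 /= uv.
have [up|up] := pselect (u c0 = smash_pt); last exact: smash_separate.
have vp : v c0 <> smash_pt by rewrite -up; exact: nesym.
have := smash_separate hC cv cu (nesym uv) vp.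
by apply: filterS => c /= h /esym.
Qed.

Lemma smash_compactly_generated : compactly_generated (smash_car X Y).
Proof.
split; first exact: smash_k_space.
exact: k_diagonal_weak_hausdorff smash_k_space smash_k_diagonal.
Qed.

Definition smash_act (g : G) (s : smash_car X Y) : smash_car X Y :=
  smash_pi (kprod_act g (repr s)).

Lemma smash_act_pi (g : G) (p : kprod X Y) :
  smash_act g (smash_pi p) = smash_pi (kprod_act g p).
Proof.
apply/smash_piP; have /smash_piP[->|[w w']] := smash_reprK (smash_pi p).
  by left.
by right; split; exact: in_wedge_act.
Qed.

Lemma smash_act_continuous :
  continuous (fun gs : G * smash_car X Y => smash_act gs.1 gs.2).
Proof.
apply: (quotient_act_continuous smash_open smash_pi_continuous).
- by move=> s; exists (repr s); exact: smash_reprK.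
- exact: kprod_act_continuous.
- by move=> g p; rewrite smash_act_pi.
Qed.

Lemma smash_act1 (s : smash_car X Y) : smash_act 1%g s = s.
Proof.
rewrite /smash_act /kprod_act !gs_act1 -[RHS]smash_reprK.
by rewrite -surjective_pairing.
Qed.

Lemma smash_actM (g h : G) (s : smash_car X Y) :
  smash_act (g * h)%g s = smash_act g (smash_act h s).
Proof.
by rewrite [smash_act h s]/smash_act smash_act_pi /smash_act /kprod_act !gs_actM.
Qed.

Lemma smash_act_pt (g : G) : smash_act g smash_pt = smash_pt.
Proof. by rewrite smash_act_pi /kprod_act !gs_act_pt. Qed.

Definition smash : gspace G :=
  GSpace smash_compactly_generated smash_act_continuous smash_act1 smash_actM
    smash_act_pt.

End smash_facts.

Section smash_functor.
Context (G : compactGroupType) (X Y X' Y' : gspace G).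
Context (f : gmap X X') (h : gmap Y Y').
Local Open Scope quotient_scope.

Definition smash_map_fun (s : smash X Y) : smash X' Y' :=
  smash_pi (f (repr s).1, h (repr s).2).

Lemma smash_map_pi (p : kprod X Y) :
  smash_map_fun (smash_pi p) = smash_pi (f p.1, h p.2).
Proof.
apply/smash_piP; have /smash_piP[->|[w w']] := smash_reprK (smash_pi p).
  by left.
by right; split; [case: w|case: w'] => e; [left|right|left|right];
  rewrite /= e gm_pt.
Qed.

Lemma smash_map_continuous : continuous smash_map_fun.
Proof.
apply/quotient_continuous.
have -> : smash_map_fun \o \pi_(smash_car X Y) =
    fun p => smash_pi ((f p.1, h p.2) : kprod X' Y').
  by apply/funext => p; exact: smash_map_pi.
apply: comp_continuous (@smash_pi_continuous _ _ _).
apply: k_space_continuous; first exact: (kprod_compactly_generated X Y).1.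
move=> C u hC cu; apply: kprod_pair_continuous => //.
- apply: comp_continuous (@gm_continuous _ _ _ f).
  exact: comp_continuous cu (@kprod_fst_continuous _ _ _).
- apply: comp_continuous (@gm_continuous _ _ _ h).
  exact: comp_continuous cu (@kprod_snd_continuous _ _ _).
Qed.

Lemma smash_map_pt : smash_map_fun (gs_pt (smash X Y)) = gs_pt (smash X' Y').
Proof. by rewrite /= /smash_pt smash_map_pi !gm_pt. Qed.

Lemma smash_map_act (g : G) (s : smash X Y) :
  smash_map_fun (gs_act g s) = gs_act g (smash_map_fun s).
Proof.
rewrite -(smash_reprK s) /= smash_act_pi !smash_map_pi smash_act_pi.
by rewrite /kprod_act /= !gm_act.
Qed.

Definition smash_map : gmap (smash X Y) (smash X' Y') :=
  GMap smash_map_continuous smash_map_pt smash_map_act.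

End smash_functor.

Section gmap_id.
Context (G : compactGroupType) (X : gspace G).

Definition gmap_id : gmap X X :=
  @GMap G X X id (@id_continuous X) erefl (fun _ _ => erefl).

End gmap_id.

Record pmap (G : compactGroupType) (X Y : gspace G) := PMap {
  pm_fun :> X -> Y;
  pm_continuous : continuous pm_fun;
  pm_pt : pm_fun (gs_pt X) = gs_pt Y
}.

Lemma pmap_eq (G : compactGroupType) (X Y : gspace G) (f h : pmap X Y) :
  (forall x, f x = h x) -> f = h.
Proof.
case: f h => f cf pf [h ch ph] /= /funext fh; subst h.
by rewrite (Prop_irrelevance cf ch) (Prop_irrelevance pf ph).
Qed.

(* The compact-open topology for compactly generated spaces: the sets of maps
   carrying the image of a compact Hausdorff space into an open set form a
   subbase.  Quasi-compact subsets, as in the library's compact-open topology,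
   would not do: they need not be such images. *)
Definition pmap_co (G : compactGroupType) (X Y : gspace G) : Type := pmap X Y.

Section pmap_topology.
Context (G : compactGroupType) (X Y : gspace G).

HB.instance Definition _ := gen_eqMixin (pmap_co X Y).
HB.instance Definition _ := gen_choiceMixin (pmap_co X Y).

Definition co_subbase : set (set (pmap_co X Y)) :=
  [set W | exists (C : topologicalType) (u : C -> X) (U : set Y),
     [/\ compact_hausdorff C, continuous u, open U
       & W = [set f : pmap_co X Y | forall c, U (f (u c))]]].

HB.instance Definition _ := isSubBaseTopological.Build (pmap_co X Y)
  co_subbase id.

Definition map_car : Type := kify (pmap_co X Y).
HB.instance Definition _ := Topological.on map_car.

Lemma co_subbase_open (W : set (pmap_co X Y)) : co_subbase W -> open W.
Proof.
move=> sW; exists [set W]; last by rewrite bigcup_set1.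
move=> _ ->; exists [fset W]%fset.
  by move=> V /=; rewrite in_fset1 => /eqP ->; rewrite inE.
by rewrite set_fset1 bigcap_set1.
Qed.

Lemma co_continuous (T : topologicalType) (u : T -> pmap_co X Y) :
  (forall W, co_subbase W -> open (u @^-1` W)) -> continuous u.
Proof.
move=> h; apply/continuousP => _ [E sE <-].
rewrite preimage_bigcup; apply: bigcup_open => B EB.
have [D sD <-] := sE _ EB; rewrite openE => t /= Dt.
apply: (@filter_bigI _ _ D (fun W => u @^-1` W)) => W WD.
apply: open_nbhs_nbhs; split; last exact: Dt.
by apply: h; have := sD _ WD; rewrite inE.
Qed.

Lemma map_car_test_continuous (C : topologicalType) (u : C -> map_car) :
  compact_hausdorff C ->
  (forall (D : topologicalType) (w : D -> X),
     compact_hausdorff D -> continuous w ->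
     continuous (fun cd : C * D => u cd.1 (w cd.2))) ->
  continuous u.
Proof.
move=> hC h; apply: kify_test_continuous => //; apply: co_continuous.
move=> _ [D [w [U [hD cw oU ->]]]].
have c : continuous (fun dc : D * C => u dc.2 (w dc.1)).
  apply: (comp_continuous (f := fun dc : D * C => (dc.2, dc.1)) _ (h D w hD cw)).
  by apply: pair_continuous; [exact: snd_continuous|exact: fst_continuous].
by move/continuousP : c => /(_ _ oU) /(open_tube hD.1).
Qed.

Lemma map_car_eval_continuous (C D : topologicalType) (u : C -> map_car)
    (w : D -> X) :
  compact_hausdorff C -> compact_hausdorff D -> continuous u -> continuous w ->
  continuous (fun cd : C * D => u cd.1 (w cd.2)).
Proof.
move=> hC hD cu cw; apply/continuousP => U oU; rewrite openE => -[c0 d0] /= U0.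
have cuw : continuous (fun d => u c0 (w d)).
  exact: comp_continuous cw (@pm_continuous _ _ _ (u c0)).
have oS : open [set d | U (u c0 (w d))] by move/continuousP : cuw; apply.
have [N [clN cN NU]] :=
  compact_hausdorff_regular hD (open_nbhs_nbhs (conj oS U0)).
have hN := compact_hausdorff_set_type hD clN.
pose W := [set f : pmap_co X Y | forall d : set_type N, U (f (w (set_val d)))].
have oW : @open map_car W.
  have /continuousP/(_ W) := @kify_id_continuous (pmap_co X Y); apply.
  apply: co_subbase_open.
  exists (set_type N), (fun d => w (set_val d)), U; split => //.
  exact: comp_continuous (@set_val_continuous _ N) cw.
have oV : open (u @^-1` W) by move/continuousP : cu; apply.
exists (u @^-1` W, N); first split => //=.
- by apply: open_nbhs_nbhs; split => // d; exact: (NU _ (set_valP d)).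
- by move=> [c d] /= [Wc Nd]; exact: (Wc (exist _ d (mem_set Nd))).
Qed.

Lemma map_car_k_diagonal : k_diagonal map_car.
Proof.
move=> C u v hC cu cv.
have -> : [set c | u c = v c] = \bigcap_x [set c | u c x = v c x].
  apply/seteqP; split=> [c /= uv x _ /=|c uv]; first by rewrite uv.
  by apply: pmap_eq => x; exact: uv.
apply: closed_bigI => x _; apply: (@gs_k_diagonal G Y) => //.
- have := map_car_eval_continuous hC (group_compact_hausdorff G) cu
    (@cst_continuous _ _ x).
  move=> h; apply: (comp_continuous (f := fun c => (c, 1%g : G)) _ h).
  by apply: pair_continuous; [exact: id_continuous|exact: cst_continuous].
- have := map_car_eval_continuous hC (group_compact_hausdorff G) cv
    (@cst_continuous _ _ x).
  move=> h; apply: (comp_continuous (f := fun c => (c, 1%g : G)) _ h).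
  by apply: pair_continuous; [exact: id_continuous|exact: cst_continuous].
Qed.

Lemma map_car_compactly_generated : compactly_generated map_car.
Proof.
split; first exact: kify_k_space.
by apply: k_diagonal_weak_hausdorff; [exact: kify_k_space|exact: map_car_k_diagonal].
Qed.

End pmap_topology.

Section internal_hom.
Context (G : compactGroupType) (X Y : gspace G).

Lemma map_conj_continuous (g : G) (f : pmap X Y) :
  continuous (fun x => gs_act g (f (gs_act g^-1%g x))).
Proof.
apply: (comp_continuous _ (@act1_continuous G Y g)).
exact: comp_continuous (@act1_continuous G X g^-1%g) (@pm_continuous _ _ _ f).
Qed.

Lemma map_conj_pt (g : G) (f : pmap X Y) :
  gs_act g (f (gs_act g^-1%g (gs_pt X))) = gs_pt Y.
Proof. by rewrite gs_act_pt pm_pt gs_act_pt. Qed.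

Definition map_act (g : G) (f : map_car X Y) : map_car X Y :=
  PMap (@map_conj_continuous g f) (@map_conj_pt g f).

Lemma map_act_continuous :
  continuous (fun gf : G * map_car X Y => map_act gf.1 gf.2).
Proof.
apply: act_continuous; first exact: (map_car_compactly_generated X Y).1.
move=> C g u hC cg cu; apply: map_car_test_continuous => // D w hD cw /=.
have cg1 : continuous (fun cd : C * D => g cd.1).
  exact: comp_continuous (@fst_continuous _ _) cg.
apply: act_test_continuous => //.
have hCD := compact_hausdorff_prod hC hD.
have cz : continuous (fun cd : C * D => gs_act (g cd.1)^-1%g (w cd.2)).
  apply: act_test_continuous.
    exact: comp_continuous cg1 (@invg_continuous G).
  exact: comp_continuous (@snd_continuous _ _) cw.
have cu1 : continuous (fun cd : C * D => u cd.1).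
  exact: comp_continuous (@fst_continuous _ _) cu.
apply: (comp_continuous (f := fun cd : C * D => (cd, cd)) _
  (map_car_eval_continuous hCD hCD cu1 cz)).
by apply: pair_continuous; exact: id_continuous.
Qed.

Lemma map_act1 (f : map_car X Y) : map_act 1%g f = f.
Proof. by apply: pmap_eq => x /=; rewrite gs_act1 invg1 gs_act1. Qed.

Lemma map_actM (g h : G) (f : map_car X Y) :
  map_act (g * h)%g f = map_act g (map_act h f).
Proof. by apply: pmap_eq => x /=; rewrite invgM !gs_actM. Qed.

Definition map_pt : map_car X Y :=
  @PMap G X Y (fun _ => gs_pt Y) (@cst_continuous X Y (gs_pt Y)) erefl.

Lemma map_act_pt (g : G) : map_act g map_pt = map_pt.
Proof. by apply: pmap_eq => x /=; rewrite gs_act_pt. Qed.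

Definition Map : gspace G :=
  GSpace (map_car_compactly_generated X Y) map_act_continuous map_act1 map_actM
    map_act_pt.

End internal_hom.

Section internal_hom_functor.
Context (G : compactGroupType) (A X Y : gspace G) (f : gmap X Y).

Lemma Map_map_fun_continuous (a : pmap A X) : continuous (fun x => f (a x)).
Proof. exact: comp_continuous (@pm_continuous _ _ _ a) (@gm_continuous _ _ _ f). Qed.

Lemma Map_map_fun_pt (a : pmap A X) : f (a (gs_pt A)) = gs_pt Y.
Proof. by rewrite pm_pt gm_pt. Qed.

Definition Map_map_fun (a : Map A X) : Map A Y :=
  PMap (@Map_map_fun_continuous a) (@Map_map_fun_pt a).

Lemma Map_map_continuous : continuous Map_map_fun.
Proof.
apply: k_space_continuous; first exact: (gs_cg (Map A X)).1.
move=> C u hC cu; apply: map_car_test_continuous => // D w hD cw /=.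
apply: comp_continuous (@gm_continuous _ _ _ f).
exact: map_car_eval_continuous.
Qed.

Lemma Map_map_pt : Map_map_fun (gs_pt (Map A X)) = gs_pt (Map A Y).
Proof. by apply: pmap_eq => x /=; exact: gm_pt. Qed.

Lemma Map_map_act (g : G) (a : Map A X) :
  Map_map_fun (gs_act g a) = gs_act g (Map_map_fun a).
Proof. by apply: pmap_eq => x /=; rewrite gm_act. Qed.

Definition Map_map : gmap (Map A X) (Map A Y) :=
  GMap Map_map_continuous Map_map_pt Map_map_act.

End internal_hom_functor.

(* Compact Hausdorff unpointed G-spaces, to which base points will be added. *)
Record ugspace (G : compactGroupType) := UGSpace {
  ug_car :> topologicalType;
  ug_compact_hausdorff : compact_hausdorff ug_car;
  ug_act : G -> ug_car -> ug_car;
  ug_act_continuous : continuous (fun gx : G * ug_car => ug_act gx.1 gx.2);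
  ug_act1 : forall x, ug_act 1%g x = x;
  ug_actM : forall g h x, ug_act (g * h)%g x = ug_act g (ug_act h x)
}.

Definition triv (G : compactGroupType) (X : topologicalType)
    (hX : compact_hausdorff X) : ugspace G :=
  @UGSpace G X hX (fun _ x => x) (@snd_continuous G X) (fun _ => erefl)
    (fun _ _ _ => erefl).

(* X with a disjoint base point [None]. *)
Definition add_pt (X : Type) : Type := option X.

Section add_pt_topology.
Context {X : topologicalType}.

HB.instance Definition _ := Choice.on (add_pt X).

Definition add_pt_open : set (set (add_pt X)) :=
  [set U | open (Some @^-1` U)].

Let add_pt_openT : add_pt_open setT.
Proof. by rewrite /add_pt_open /= preimage_setT; exact: openT. Qed.

Let add_pt_openI : setI_closed add_pt_open.
Proof. by move=> A B oA oB; exact: openI. Qed.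

Let add_pt_open_bigU (I : Type) (f : I -> set (add_pt X)) :
  (forall i, add_pt_open (f i)) -> add_pt_open (\bigcup_i f i).
Proof.
move=> fo; rewrite /add_pt_open /= preimage_bigcup; apply: bigcup_open => i _.
exact: fo.
Qed.

HB.instance Definition _ :=
  isOpenTopological.Build (add_pt X) add_pt_openT add_pt_openI add_pt_open_bigU.

Lemma add_pt_openE (U : set (add_pt X)) : open U = open (Some @^-1` U).
Proof. by []. Qed.

Lemma add_pt_Some_continuous : continuous (Some : X -> add_pt X).
Proof. by apply/continuousP => U; rewrite add_pt_openE. Qed.

Lemma add_pt_continuous (Y : topologicalType) (f : add_pt X -> Y) :
  continuous (fun x : X => f (Some x)) -> continuous f.
Proof.
move=> /continuousP cf; apply/continuousP => U oU; rewrite add_pt_openE.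
exact: (cf U oU).
Qed.

Lemma add_pt_open_Some (U : set X) : open U -> @open (add_pt X) (Some @` U).
Proof.
move=> oU; rewrite add_pt_openE (_ : _ @^-1` _ = U) //.
by apply/seteqP; split=> [x [y Uy [<-]]//|x Ux]; exists x.
Qed.

Lemma add_pt_open_None : @open (add_pt X) [set None].
Proof.
rewrite add_pt_openE (_ : _ @^-1` _ = set0); first exact: open0.
by apply/seteqP; split.
Qed.

Lemma add_pt_compact_hausdorff :
  compact_hausdorff X -> compact_hausdorff (add_pt X).
Proof.
move=> [cX hX]; split.
  have -> : [set: add_pt X] = (Some : X -> add_pt X) @` setT `|` [set None].
    by apply/seteqP; split=> // -[x|] _; [left; exists x|right].
  apply: compactU; last exact: compact_set1.
  apply: continuous_compact cX; apply: continuous_subspaceT.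
  exact: add_pt_Some_continuous.
have oT := add_pt_open_Some (@openT X).
have oN := add_pt_open_None.
move: hX; rewrite !open_hausdorff => hX [x|] [y|] xy //.
- have [[A B] /= [xA yB] [oA oB AB]] : exists2 AB : set X * set X,
      x \in AB.1 /\ y \in AB.2 &
      [/\ open AB.1, open AB.2 & AB.1 `&` AB.2 == set0].
    by apply: hX; apply: contra xy => /eqP ->.
  exists (Some @` A, Some @` B); rewrite /= ?inE.
    by split; [exists x => //|exists y => //]; apply/set_mem.
  split; [exact: add_pt_open_Some|exact: add_pt_open_Some|].
  apply/seteqP; split=> // _ [[a Aa <-] [b Bb [ba]]].
  by move/eqP/seteqP : AB => [/(_ a) AB _]; apply: AB; split; [|rewrite -ba].
- exists (Some @` setT, [set None]); rewrite /= ?inE.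
    by split=> //; exists x.
  by split => //; apply/seteqP; split=> // _ [[a _ <-]].
- exists ([set None], Some @` setT); rewrite /= ?inE.
    by split=> //; exists y.
  by split => //; apply/seteqP; split=> // _ [-> [a _]].
Qed.

End add_pt_topology.

Section add_base.
Context (G : compactGroupType) (X : ugspace G).

Definition plus_act (g : G) (x : add_pt X) : add_pt X := omap (ug_act g) x.

Lemma plus_act_continuous :
  continuous (fun gx : G * add_pt X => plus_act gx.1 gx.2).
Proof.
apply/continuousP => U oU; rewrite openE => -[g0 [x0|]] /= U0.
- have oA : @open (G * X)%type [set gx | U (Some (ug_act gx.1 gx.2))].
    have /continuousP/(_ _ oU) :=
      comp_continuous (@ug_act_continuous G X) add_pt_Some_continuous.
    by [].
  have [[A B] /= [gA xB] AB] :
      nbhs (g0, x0) [set gx | U (Some (ug_act gx.1 gx.2))].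
    exact: open_nbhs_nbhs.
  exists (A, Some @` B); first split => //=.
    move: xB; rewrite nbhsE => -[B' [oB' B'x] B'B].
    have : nbhs (Some x0 : add_pt X) (Some @` B').
      by apply: open_nbhs_nbhs; split; [exact: add_pt_open_Some|exists x0].
    by apply: filterS; exact: image_subset.
  by move=> [g _] /= [Ag [x Bx <-]]; exact: (AB (g, x)).
- exists (setT, [set None]); first split => //=.
  + exact: filterT.
  + by apply: open_nbhs_nbhs; split => //; exact: add_pt_open_None.
  by move=> [g _] /= [_ ->].
Qed.

Lemma plus_act1 (x : add_pt X) : plus_act 1%g x = x.
Proof. by case: x => //= x; rewrite ug_act1. Qed.

Lemma plus_actM (g h : G) (x : add_pt X) :
  plus_act (g * h)%g x = plus_act g (plus_act h x).
Proof. by case: x => //= x; rewrite ug_actM. Qed.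

Definition add_base : gspace G :=
  @GSpace G (add_pt X)
    (compact_hausdorff_compactly_generated
       (add_pt_compact_hausdorff (ug_compact_hausdorff X)))
    None plus_act plus_act_continuous plus_act1 plus_actM (fun _ => erefl).

End add_base.

Section plus_functor.
Context (G : compactGroupType) (X Y : ugspace G) (f : X -> Y).
Context (cf : continuous f) (af : forall g x, f (ug_act g x) = ug_act g (f x)).

Definition plus_map_fun (x : add_base X) : add_base Y := omap f x.

Lemma plus_map_continuous : continuous plus_map_fun.
Proof.
apply: add_pt_continuous.
exact: comp_continuous cf (@add_pt_Some_continuous Y).
Qed.

Lemma plus_map_act g x : plus_map_fun (gs_act g x) = gs_act g (plus_map_fun x).
Proof. by case: x => //= x; rewrite af. Qed.

Definition plus_map : gmap (add_base X) (add_base Y) :=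
  GMap plus_map_continuous (erefl : plus_map_fun None = None) plus_map_act.

End plus_functor.

(* G/H, the space of left cosets xH. *)
Section orbit_space.
Context (G : compactGroupType) (H : closed_subgroup G).
Local Open Scope quotient_scope.

Definition coset_rel (x y : G) : bool := `[< csg_set H (x^-1 * y)%g >].

Let coset_rel_refl : reflexive coset_rel.
Proof. by move=> x; apply/asboolP; rewrite mulVg; exact: csg1. Qed.

Let coset_rel_sym : symmetric coset_rel.
Proof.
have sym x y : csg_set H (x^-1 * y)%g -> csg_set H (y^-1 * x)%g.
  by move=> /csgV; rewrite invgM invgK.
by move=> x y; apply/asboolP/asboolP; exact: sym.
Qed.

Let coset_rel_trans : transitive coset_rel.
Proof.
move=> y x z /asboolP xy /asboolP yz; apply/asboolP.
by have := csgM xy yz; rewrite mulgA mulgK.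
Qed.

Canonical coset_equiv :=
  EquivRel coset_rel coset_rel_refl coset_rel_sym coset_rel_trans.

Definition coset_car : Type := quotient_topology {eq_quot coset_equiv}.
HB.instance Definition _ := Topological.on coset_car.
HB.instance Definition _ := Quotient.on coset_car.

Definition coset_pi (x : G) : coset_car := \pi_coset_car x.

Lemma coset_piP (x y : G) : coset_pi x = coset_pi y <-> csg_set H (x^-1 * y)%g.
Proof. by split=> [/eqmodP/asboolP //|h]; apply/eqmodP; exact/asboolP. Qed.

Lemma coset_pi_continuous : continuous coset_pi.
Proof. exact: pi_continuous. Qed.

Lemma coset_open (U : set coset_car) : open (coset_pi @^-1` U) -> open U.
Proof. by []. Qed.

Lemma coset_reprK (s : coset_car) : coset_pi (repr s) = s.
Proof. exact: reprK. Qed.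

Lemma mulg_test_continuous (T : topologicalType) (u v : T -> G) :
  continuous u -> continuous v -> continuous (fun t => u t * v t)%g.
Proof.
move=> cu cv.
exact: (comp_continuous (pair_continuous cu cv) (@mulg_continuous G)).
Qed.

Lemma coset_pi_open (U : set G) : open U -> open (coset_pi @` U).
Proof.
move=> oU; apply: coset_open.
have -> : coset_pi @^-1` (coset_pi @` U) =
    \bigcup_(h in csg_set H) ((fun x => x * h)%g @^-1` U).
  apply/seteqP; split=> [x [y Uy /esym/coset_piP xy]|x [h Hh Uxh]].
    by exists (x^-1 * y)%g => //=; rewrite mulgA mulgV mul1g.
  by exists (x * h)%g => //; apply/esym/coset_piP; rewrite mulgA mulVg mul1g.
apply: bigcup_open => h _.
have /continuousP := mulg_test_continuous (@id_continuous G) (@cst_continuous _ _ h).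
exact.
Qed.

Lemma coset_compact_hausdorff : compact_hausdorff coset_car.
Proof.
split.
  have -> : [set: coset_car] = coset_pi @` setT.
    by apply/seteqP; split=> // s _; exists (repr s) => //; exact: coset_reprK.
  apply: continuous_compact (@group_compact G); apply: continuous_subspaceT.
  exact: coset_pi_continuous.
rewrite open_hausdorff => s t st.
have oN : open [set xy : G * G | ~ csg_set H (xy.1^-1 * xy.2)%g].
  have c : continuous (fun xy : G * G => (xy.1^-1 * xy.2)%g).
    apply: mulg_test_continuous; last exact: snd_continuous.
    exact: (comp_continuous (@fst_continuous _ _) (@invg_continuous G)).
  move/continuousP : c => /(_ (~` csg_set H)); apply.
  by rewrite openC; exact: csg_closed.
have Nst : ~ csg_set H ((repr s)^-1 * repr t)%g.
  by move=> /coset_piP; rewrite !coset_reprK => /eqP; apply/negP.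
have [[A B] /= [sA tB] AB] :
    nbhs (repr s, repr t) [set xy : G * G | ~ csg_set H (xy.1^-1 * xy.2)%g].
  by apply: open_nbhs_nbhs.
move: sA tB; rewrite !nbhsE => -[A' [oA' A's] A'A] [B' [oB' B't] B'B].
exists (coset_pi @` A', coset_pi @` B') => /=.
  by rewrite !inE; split; [exists (repr s)|exists (repr t)];
    rewrite ?coset_reprK.
split; [exact: coset_pi_open|exact: coset_pi_open|].
apply/eqP/seteqP; split=> // _ [[a A'a <-] [b B'b /esym/coset_piP]].
by apply: (AB (a, b)); split; [exact: A'A|exact: B'B].
Qed.

Definition coset_act (g : G) (s : coset_car) : coset_car :=
  coset_pi (g * repr s)%g.

Lemma coset_act_pi (g x : G) : coset_act g (coset_pi x) = coset_pi (g * x)%g.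
Proof.
apply/coset_piP; rewrite invgM -mulgA (mulgA g^-1%g) mulVg mul1g.
by apply/coset_piP; exact: coset_reprK.
Qed.

Lemma coset_act_continuous :
  continuous (fun gs : G * coset_car => coset_act gs.1 gs.2).
Proof.
apply: (@quotient_act_continuous G G coset_car coset_pi (fun g x => g * x)%g).
- exact: coset_open.
- exact: coset_pi_continuous.
- by move=> s; exists (repr s); exact: coset_reprK.
- exact: mulg_continuous.
- by move=> g x; rewrite coset_act_pi.
Qed.

Lemma coset_act1 (s : coset_car) : coset_act 1%g s = s.
Proof. by rewrite /coset_act mul1g coset_reprK. Qed.

Lemma coset_actM (g h : G) (s : coset_car) :
  coset_act (g * h)%g s = coset_act g (coset_act h s).
Proof. by rewrite [coset_act h s]/coset_act coset_act_pi mulgA. Qed.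

Definition orbit_space : ugspace G :=
  UGSpace coset_compact_hausdorff coset_act_continuous coset_act1 coset_actM.

End orbit_space.

Section euclidean_spaces.
Context (R : realType).

Definition unit_interval : set R := [set t | 0 <= t <= 1].
Arguments unit_interval : clear implicits.
Definition disk (n : nat) : set 'rV[R]_n := [set v | \sum_i v 0 i ^+ 2 <= 1].
(* [sphere n] is the sphere of dimension n - 1; [sphere 0] is empty. *)
Definition sphere (n : nat) : set 'rV[R]_n := [set v | \sum_i v 0 i ^+ 2 = 1].
Definition cube (n : nat) : set 'rV[R]_n := [set v | forall i, 0 <= v 0 i <= 1].
Arguments disk n : clear implicits.
Arguments sphere n : clear implicits.
Arguments cube n : clear implicits.

Definition cube_boundary (n : nat) : set (cube n) :=
  [set v | exists i, (set_val v : 'rV[R]_n) 0 i = 0 \/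
                     (set_val v : 'rV[R]_n) 0 i = 1].

Lemma unit_interval0 : unit_interval 0.
Proof. by rewrite /unit_interval /= lexx ler01. Qed.

Lemma unit_interval1 : unit_interval 1.
Proof. by rewrite /unit_interval /= lexx ler01. Qed.

Definition ui0 : unit_interval := exist _ 0 (mem_set unit_interval0).
Definition ui1 : unit_interval := exist _ 1 (mem_set unit_interval1).

Lemma sum_sqr_continuous (n : nat) :
  continuous (fun v : 'rV[R]_n => \sum_i v 0 i ^+ 2).
Proof.
apply: (@continuous_big _ _ +%R 0 xpredT).
  by move=> x; exact: add_continuous.
move=> i _ v; have cv := @coord_continuous R 1 n 0 i v.
exact: (continuousM cv cv).
Qed.

Lemma closed_disk (n : nat) : closed (disk n).
Proof.
have /continuous_closedP := @sum_sqr_continuous n.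
by move=> /(_ _ (@closed_le R 1)).
Qed.

Lemma closed_sphere (n : nat) : closed (sphere n).
Proof.
have /continuous_closedP := @sum_sqr_continuous n.
by move=> /(_ _ (@closed_eq R 1)).
Qed.

Lemma sphere_disk (n : nat) : sphere n `<=` disk n.
Proof. by move=> v; rewrite /disk /= => ->. Qed.

Lemma compact_disk (n : nat) : compact (disk n).
Proof.
apply: (@subclosed_compact _ _
  [set v : 'rV[R]_n | forall i, `[(-1 : R), 1]%classic (v ord0 i)]).
- exact: closed_disk.
- by apply: (@rV_compact R n (fun=> `[-1, 1]%classic)) => _; exact: segment_compact.
move=> v dv i; rewrite /= in_itv /= -ler_norml.
rewrite -(@expr_le1 _ 2) // real_normK ?num_real //.
apply: le_trans dv; rewrite (bigD1 i) //= lerDl.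
by apply: sumr_ge0 => j _; exact: sqr_ge0.
Qed.

Lemma disk_compact_hausdorff (n : nat) : compact_hausdorff (disk n).
Proof.
by apply: compact_set_type_hausdorff; [exact: norm_hausdorff|exact: compact_disk].
Qed.

Lemma sphere_compact_hausdorff (n : nat) : compact_hausdorff (sphere n).
Proof.
apply: compact_set_type_hausdorff; first exact: norm_hausdorff.
exact: subclosed_compact (@closed_sphere n) (@compact_disk n) (@sphere_disk n).
Qed.

Lemma unit_interval_compact_hausdorff : compact_hausdorff unit_interval.
Proof.
apply: compact_set_type_hausdorff; first exact: norm_hausdorff.
have -> : unit_interval = `[0, 1]%classic.
  by apply/seteqP; split=> x /=; rewrite in_itv.
exact: segment_compact.
Qed.

Definition sphere_to_disk (n : nat) (v : sphere n) : disk n :=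
  exist _ (set_val v) (mem_set (sphere_disk (set_valP v))).

Lemma sphere_to_disk_continuous (n : nat) : continuous (@sphere_to_disk n).
Proof.
apply: (@continuous_comp_initial _ _ _ (set_val : disk n -> 'rV[R]_n)).
exact: set_val_continuous.
Qed.

Definition disk_to_cylinder (n : nat) (v : disk n) : (disk n * unit_interval)%type :=
  (v, ui0).

Lemma disk_to_cylinder_continuous (n : nat) : continuous (@disk_to_cylinder n).
Proof. by apply: pair_continuous; [exact: id_continuous|exact: cst_continuous]. Qed.

Lemma sphere_base_subproof : sphere 2 (delta_mx 0 0).
Proof. by rewrite /sphere /= !big_ord_recl big_ord0 !mxE /= expr1n expr0n !addr0. Qed.

Definition sphere_base : sphere 2 :=
  exist _ (delta_mx 0 0) (mem_set sphere_base_subproof).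

End euclidean_spaces.
Arguments disk R n : clear implicits.
Arguments sphere R n : clear implicits.
Arguments cube R n : clear implicits.
Arguments unit_interval R : clear implicits.

Section homotopy.
Context (R : realType).

Definition homotopic_rel (X Y : topologicalType) (A : set X) (f g : X -> Y) : Prop :=
  exists h : X * unit_interval R -> Y,
    [/\ continuous h, forall x, h (x, ui0 R) = f x, forall x, h (x, ui1 R) = g x
      & forall a t, A a -> h (a, t) = f a].

Definition joined (X : topologicalType) (x y : X) : Prop :=
  exists p : unit_interval R -> X,
    [/\ continuous p, p (ui0 R) = x & p (ui1 R) = y].

(* The maps (I^n, boundary) -> (X, x) representing the elements of pi_n(X, x). *)
Definition spheroid (n : nat) (X : topologicalType) (x : X) : set (cube R n -> X) :=
  [set a | continuous a /\ forall v, cube_boundary v -> a v = x].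

(* f induces bijections on path components and on all homotopy groups. *)
Definition weak_homotopy_equivalence (X Y : topologicalType) (f : X -> Y) : Prop :=
  [/\ continuous f,
      (forall x x', joined (f x) (f x') -> joined x x') /\
      (forall y, exists x, joined (f x) y)
    & forall (n : nat) (x : X), (0 < n)%N ->
      (forall a b, spheroid x a -> spheroid x b ->
         homotopic_rel (@cube_boundary R n) (f \o a) (f \o b) ->
         homotopic_rel (@cube_boundary R n) a b) /\
      (forall b, spheroid (f x) b -> exists a, spheroid x a /\
         homotopic_rel (@cube_boundary R n) (f \o a) b)].

Definition serre_fibration (X Y : topologicalType) (p : X -> Y) : Prop :=
  continuous p /\
  forall (n : nat) (a : disk R n -> X) (b : disk R n * unit_interval R -> Y),
    continuous a -> continuous b ->
    (forall v, p (a v) = b (disk_to_cylinder v)) ->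
    exists l : disk R n * unit_interval R -> X,
      [/\ continuous l, forall v, l (disk_to_cylinder v) = a v
        & forall w, p (l w) = b w].

End homotopy.

Section fixed_points.
Context (G : compactGroupType) (H : set G).

Definition fixed_points (X : gspace G) : set X :=
  [set x | forall h, H h -> gs_act h x = x].
Arguments fixed_points X : clear implicits.

Lemma fixed_points_map (X Y : gspace G) (f : gmap X Y) (x : X) :
  fixed_points X x -> fixed_points Y (f x).
Proof. by move=> fx h Hh; rewrite -gm_act fx. Qed.

Definition fixed_map (X Y : gspace G) (f : gmap X Y) (x : fixed_points X) :
    fixed_points Y :=
  exist _ (f (set_val x)) (mem_set (fixed_points_map f (set_valP x))).

End fixed_points.
Arguments fixed_points {G} H X.
Arguments fixed_map {G} H {X Y} f x.

Section model_structure.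
Context (R : realType) (G : compactGroupType).

Definition weak_equivalence (X Y : gspace G) (f : gmap X Y) : Prop :=
  forall H : closed_subgroup G, weak_homotopy_equivalence R (fixed_map (csg_set H) f).

Definition fibration (X Y : gspace G) (f : gmap X Y) : Prop :=
  forall H : closed_subgroup G, serre_fibration R (fixed_map (csg_set H) f).

Definition left_lifting (A B X Y : gspace G) (i : gmap A B) (p : gmap X Y) : Prop :=
  forall (a : gmap A X) (b : gmap B Y), (forall x, p (a x) = b (i x)) ->
    exists l : gmap B X, (forall x, l (i x) = a x) /\ (forall x, p (l x) = b x).

Definition cofibration (A B : gspace G) (i : gmap A B) : Prop :=
  forall (X Y : gspace G) (p : gmap X Y),
    fibration p -> weak_equivalence p -> left_lifting i p.

Lemma point_compact_hausdorff : compact_hausdorff (discrete_topology unit).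
Proof.
split; last exact: discrete_hausdorff.
by apply: finite_compact; exact: finite_finset.
Qed.

Definition point_gspace : gspace G :=
  @GSpace G (discrete_topology unit)
    (compact_hausdorff_compactly_generated point_compact_hausdorff) tt
    (fun _ x => x) (@snd_continuous _ _) (fun _ => erefl) (fun _ _ _ => erefl)
    (fun _ => erefl).

Definition to_point (X : gspace G) : gmap X point_gspace :=
  @GMap G X point_gspace (fun _ => tt) (@cst_continuous _ _ _) erefl
    (fun _ _ => erefl).

Lemma from_point_act (X : gspace G) (g : G) (x : point_gspace) :
  gs_pt X = gs_act g (gs_pt X).
Proof. by rewrite gs_act_pt. Qed.

Definition from_point (X : gspace G) : gmap point_gspace X :=
  @GMap G point_gspace X (fun _ => gs_pt X) (@cst_continuous _ _ _) erefl
    (@from_point_act X).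

(* [point_gspace] is the zero object. *)
Definition fibrant (X : gspace G) : Prop := fibration (to_point X).
Definition cofibrant (X : gspace G) : Prop := cofibration (from_point X).

Definition circle : gspace G :=
  @GSpace G (sphere R 2)
    (compact_hausdorff_compactly_generated (sphere_compact_hausdorff R 2))
    (sphere_base R) (fun _ x => x) (@snd_continuous _ _) (fun _ => erefl)
    (fun _ _ _ => erefl) (fun _ => erefl).

Definition sphere_plus (n : nat) : gspace G :=
  add_base (triv G (sphere_compact_hausdorff R n)).

Definition disk_plus (n : nat) : gspace G :=
  add_base (triv G (disk_compact_hausdorff R n)).

Definition cylinder_plus (n : nat) : gspace G :=
  add_base (triv G (compact_hausdorff_prod (disk_compact_hausdorff R n)
                                       (unit_interval_compact_hausdorff R))).

Definition orbit_plus (H : closed_subgroup G) : gspace G := add_base (orbit_space H).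

Definition sphere_disk_plus (n : nat) : gmap (sphere_plus n) (disk_plus n) :=
  @plus_map G (triv G _) (triv G _) _ (@sphere_to_disk_continuous R n)
    (fun _ _ => erefl).

Definition disk_cylinder_plus (n : nat) : gmap (disk_plus n) (cylinder_plus n) :=
  @plus_map G (triv G _) (triv G _) _ (@disk_to_cylinder_continuous R n)
    (fun _ _ => erefl).

Record arrow := Arrow {
  arrow_dom : gspace G;
  arrow_cod : gspace G;
  arrow_map : gmap arrow_dom arrow_cod
}.

(* The set J. *)
Definition gen_trivial_cofibrations (a : arrow) : Prop :=
  exists (n : nat) (H : closed_subgroup G),
    a = Arrow (smash_map (disk_cylinder_plus n) (gmap_id (orbit_plus H))).

(* The space Map_G(A, X) of equivariant maps and the functor Map_G(A, -). *)
Definition Map_G (A X : gspace G) : topologicalType :=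
  fixed_points [set: G] (Map A X).

Definition Map_G_map (A X Y : gspace G) (f : gmap X Y) : Map_G A X -> Map_G A Y :=
  fixed_map [set: G] (Map_map A f).

Section colocalization.
Context (I : Type) (K : I -> gspace G).

Definition Lambda (a : arrow) : Prop :=
  exists (i : I) (n : nat),
    a = Arrow (smash_map (gmap_id (K i)) (sphere_disk_plus n)).

(* As Top^G is a topological model category, all its objects are fibrant and the
   K i are to be cofibrant, Map_G computes the homotopy function complexes. *)
Definition colocal_equivalence (X Y : gspace G) (f : gmap X Y) : Prop :=
  forall i : I, weak_homotopy_equivalence R (@Map_G_map (K i) X Y f).

Definition condition_dollar : Prop :=
  forall (a : arrow), Lambda a \/ gen_trivial_cofibrations a ->
  forall A : gspace G, A = arrow_dom a \/ A = arrow_cod a ->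
  forall (X Y : gspace G) (f : gmap X Y), fibrant X -> fibrant Y ->
    colocal_equivalence f -> colocal_equivalence (Map_map A f).

End colocalization.

End model_structure.

(* Main.v *)
Require Import Defs.
From HB Require Import structures.
From mathcomp Require Import all_boot all_order all_algebra.
From mathcomp Require Import ring lra.
From mathcomp Require Import all_classical.
From mathcomp Require Import reals topology normedtype realfun.

Set Implicit Arguments.
Unset Strict Implicit.
Unset Printing Implicit Defensive.

Import Order.TTheory GRing.Theory Num.Theory.
Import numFieldTopology.Exports numFieldNormedType.Exports.
Local Open Scope classical_set_scope.
Local Open Scope ring_scope.

(** Let [f : X -> Y] be a [K]-colocal equivalence.

    Suppose first that [A] is [K l] smashed with a sphere or a disk.  The [H]-fixed points
    of [Map (K l) X] are the equivariant maps out of [K l] smashed with [G/H]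
    ([induce_exponential]), and by hypothesis this smash product is isomorphic to a member
    of [K].  So [Map (K l) f] is not merely a colocal equivalence but a weak equivalence of
    [G]-spaces ([Map_colocal_weak_equivalence]), and it stays one when [K l] is smashed
    with a sphere or a disk, because the space of maps from these to a space preserves weak
    homotopy equivalences.  Since [K i] is cofibrant and all objects are fibrant,
    equivariant maps out of [K i] turn weak equivalences into weak homotopy equivalences
    ([cofibrant_weak_equivalence]).

    Suppose next that [A] is the smash product of a disk, or a cylinder over a disk, with
    [G/H].  By adjunction the maps from [K i] to [Map A X] form the space of maps from the
    disk or cylinder to the space of equivariant maps out of [K i] smashed with [G/H]
    ([untwist_exponential]); the latter is again isomorphic to a member of [K], so [f]
    induces a weak homotopy equivalence.

    These steps rest on the characterization of weak homotopy equivalences by cells: a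
    continuous map is one if and only if every map of a cube to the target, with a lift of
    its boundary to the source, can be lifted up to a homotopy relative to the boundary
    ([compression_weak_equivalence], [weak_equivalence_lifts]).  The lifting is phrased
    strictly, through the mapping path fibration [path_end]: up to deformation the partial
    lift is constant on all faces but one, and on that face it is a null-homotopic element
    of a homotopy group, by injectivity; so it may be taken constant altogether, and
    surjectivity one dimension up supplies the lift.  A sphere is glued from two cubes and
    a disk is contractible, hence families of cells over them lift as well
    ([sphere_family_lifts], [disk_family_lifts]).

    For a cofibrant [B] and a weak equivalence [g], the compression criterion for
    [Map_G B X -> Map_G B Y] is a single lifting problem for [B].  Its target
    [bordered_space] parametrizes cells of [Y] with a lift of the boundary to [X], its
    source [compressed_space] the compressions of such cells.  The map between them is a
    trivial fibration: a cell of [compressed_space] is a cell on a product of two cubes,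
    so lifting against it is lifting cells in [X] up to homotopy in [Y], on the fixed points
    of each subgroup. *)

(** * Continuity on subsets and continuity of formulas *)

Section within_facts.
Variables (X Y Z : topologicalType).
Implicit Types (A B : set X) (f : X -> Y).

Lemma within_comp A f (u : Z -> X) : {within A, continuous f} ->
  continuous u -> (forall z, A (u z)) -> continuous (fun z => f (u z)).
Proof.
move=> /subspace_continuousP cf cu Au z.
have := cf _ (Au z); apply: cvg_trans => W /= nW.
have := cu z _ nW; rewrite /nbhs /= /fmap /=; apply: filterS => t; exact.
Qed.

Lemma within_setval A f : continuous (fun x : set_type A => f (set_val x)) ->
  {within A, continuous f}.
Proof.
move=> cf; apply/subspace_continuousP => x Ax W nW.
have := cf (exist _ x (mem_set Ax)) W nW.
rewrite /nbhs /= /fmap /= => -[U [[V oV <-] /= Vx VU]].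
apply: (filterS _ (open_nbhs_nbhs (conj oV Vx))) => y Vy Ay.
exact: (VU (exist _ y (mem_set Ay))).
Qed.

Lemma within_eq A f g : (forall x, A x -> f x = g x) ->
  {within A, continuous f} -> {within A, continuous g}.
Proof.
move=> fg; apply: subspace_eq_continuous => x /set_mem; exact: fg.
Qed.

Lemma within_sub A B f : B `<=` A -> {within A, continuous f} ->
  {within B, continuous f}.
Proof. exact: continuous_subspaceW. Qed.

Lemma continuous_within A f : continuous f -> {within A, continuous f}.
Proof. exact: continuous_subspaceT. Qed.

Lemma within_setT f : {within setT, continuous f} -> continuous f.
Proof. by move=> cf; apply/continuous_subspace_setT. Qed.

End within_facts.

Section within_facts2.
Variables (X Y Z : topologicalType).
Implicit Types (A B : set X) (f : X -> Y).

Lemma comp_within A (g : Y -> Z) f : {within A, continuous f} -> continuous g ->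
  {within A, continuous (fun x => g (f x))}.
Proof.
by move=> cf cg; apply: within_setval;
  exact: comp_continuous (within_comp cf (@set_val_continuous _ A) set_valP) cg.
Qed.

Lemma within_pair A f (g : X -> Z) : {within A, continuous f} ->
  {within A, continuous g} -> {within A, continuous (fun x => (f x, g x))}.
Proof.
move=> cf cg; apply: within_setval; apply: pair_continuous.
- exact: within_comp cf (@set_val_continuous _ A) set_valP.
- exact: within_comp cg (@set_val_continuous _ A) set_valP.
Qed.

End within_facts2.

Lemma within_precomp (X Y Z : topologicalType) (A : set X) (B : set Z) (f : X -> Y)
    (u : Z -> X) : {within A, continuous f} -> {within B, continuous u} ->
  (forall z, B z -> A (u z)) -> {within B, continuous (fun z => f (u z))}.
Proof.
move=> cf cu Au; apply: within_setval; apply: (within_comp cf).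
- exact: within_comp cu (@set_val_continuous _ B) set_valP.
- by move=> z; apply: Au; exact: set_valP.
Qed.

Lemma continuous_into_set (X T : topologicalType) (A : set X) (u : T -> set_type A) :
  continuous (fun t => set_val (u t)) -> continuous u.
Proof. by move=> cu; apply: (@continuous_comp_initial _ _ _ (set_val : set_type A -> X)). Qed.

Definition set_point (T : Type) (A : set T) (x : T) (Ax : A x) : set_type A :=
  exist _ x (mem_set Ax).

Section real_continuity.
Variables (R : realType) (T : topologicalType).
Implicit Types (f g : T -> R).

Lemma addR_continuous f g : continuous f -> continuous g ->
  continuous (fun t => f t + g t).
Proof. by move=> cf cg t; exact: continuousD (cf t) (cg t). Qed.

Lemma oppR_continuous f : continuous f -> continuous (fun t => - f t).
Proof. by move=> cf t; exact: continuousN (cf t). Qed.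

Lemma mulR_continuous f g : continuous f -> continuous g ->
  continuous (fun t => f t * g t).
Proof. by move=> cf cg t; exact: continuousM (cf t) (cg t). Qed.

Lemma invR_continuous f : continuous f -> (forall t, f t != 0) ->
  continuous (fun t => (f t)^-1).
Proof. by move=> cf f0 t; exact: continuousV (f0 t) (cf t). Qed.

Lemma maxR_continuous f g : continuous f -> continuous g ->
  continuous (fun t => Num.max (f t) (g t)).
Proof. by move=> cf cg t; exact: continuous_max (cf t) (cg t). Qed.

Lemma minR_continuous f g : continuous f -> continuous g ->
  continuous (fun t => Num.min (f t) (g t)).
Proof. by move=> cf cg t; exact: continuous_min (cf t) (cg t). Qed.

Lemma absR_continuous f : continuous f -> continuous (fun t => `|f t|).
Proof. by move=> cf; exact: comp_continuous cf (@norm_continuous _ R). Qed.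

Lemma rV_continuous n (u : T -> 'rV[R]_n) :
  (forall i, continuous (fun t => u t 0 i)) -> continuous u.
Proof.
move=> cu t A [P Pn PA]; rewrite /= /fmap /=.
have h : \forall t' \near t, forall i, P 0 i (u t' 0 i).
  apply: filter_forall => i; exact: (cu i t _ (Pn 0 i)).
apply: filterS h => t' h; apply: PA => i j; rewrite (ord1 i); exact: h.
Qed.

End real_continuity.

Section unit_interval_facts.
Variable R : realType.
Local Notation I := (unit_interval R).

Definition ival (t : I) : R := set_val t.

Lemma ivalP (t : I) : 0 <= ival t <= 1.
Proof. exact: (set_valP t). Qed.

Lemma ival_ge0 (t : I) : 0 <= ival t. Proof. by case/andP: (ivalP t). Qed.

Lemma ival_inj : injective ival.
Proof. exact: val_inj. Qed.

Lemma ival_continuous : continuous ival.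
Proof. exact: set_val_continuous. Qed.

Lemma ival_comp_continuous (T : topologicalType) (u : T -> I) : continuous u ->
  continuous (fun t => ival (u t)).
Proof. by move=> cu; exact: comp_continuous cu ival_continuous. Qed.

Lemma clampI_subproof (x : R) : unit_interval R (Num.max 0 (Num.min 1 x)).
Proof. by rewrite /unit_interval /= le_max lexx /= ge_max ler01 ge_min lexx. Qed.

(** Clamping makes every real formula a point of the interval, so that continuity never
    has to be argued together with bounds. *)
Definition clampI (x : R) : I :=
  exist _ (Num.max 0 (Num.min 1 x)) (mem_set (clampI_subproof x)).

Lemma ival_clampI (x : R) : 0 <= x <= 1 -> ival (clampI x) = x.
Proof.
by move=> /andP[x0 x1]; rewrite /ival set_valE /= (min_idPr x1) (max_idPr x0).
Qed.

Lemma clampI_le0 (x : R) : x <= 0 -> clampI x = ui0 R.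
Proof.
move=> x0; apply: val_inj; rewrite /= (min_idPr _) ?(max_idPl x0) //.
exact: le_trans x0 ler01.
Qed.

Lemma ival_clampIK (t : I) : clampI (ival t) = t.
Proof. by apply: ival_inj; rewrite ival_clampI // ivalP. Qed.

Lemma ival0 : ival (ui0 R) = 0. Proof. by []. Qed.
Lemma ival1 : ival (ui1 R) = 1. Proof. by []. Qed.

Lemma clampI_continuous (T : topologicalType) (u : T -> R) : continuous u ->
  continuous (fun t => clampI (u t)).
Proof.
move=> cu; apply: continuous_into_set.
apply: maxR_continuous; first exact: cst_continuous.
by apply: minR_continuous => //; exact: cst_continuous.
Qed.

Definition irev (t : I) : I := clampI (1 - ival t).

Lemma ival_irev t : ival (irev t) = 1 - ival t.
Proof. by rewrite ival_clampI //; have := ivalP t; lra. Qed.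

Lemma irev0 : irev (ui0 R) = ui1 R.
Proof. by apply: ival_inj; rewrite ival_irev ival0 subr0. Qed.

Lemma irev1 : irev (ui1 R) = ui0 R.
Proof. by apply: ival_inj; rewrite ival_irev ival1 subrr. Qed.

Lemma irev_continuous : continuous irev.
Proof.
apply: clampI_continuous; apply: addR_continuous; first exact: cst_continuous.
by apply: oppR_continuous; exact: ival_continuous.
Qed.

Lemma closed_ui (x : R) : closed [set t : I | ival t = x].
Proof.
have /continuous_closedP := ival_continuous.
by move=> /(_ _ (@closed_eq R x)).
Qed.

Lemma ui_eq0 (t : I) : (t = ui0 R) <-> ival t = 0.
Proof. by split=> [->|h]; [exact: ival0|apply: ival_inj]. Qed.

Lemma ui_eq1 (t : I) : (t = ui1 R) <-> ival t = 1.
Proof. by split=> [->|h]; [exact: ival1|apply: ival_inj]. Qed.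

Lemma ui01 : ui0 R <> ui1 R.
Proof. by move/ui_eq1; rewrite ival0 => /eqP; rewrite eq_sym oner_eq0. Qed.

Lemma closed_ui0 : closed [set ui0 R].
Proof.
rewrite (_ : [set _] = [set t | ival t = 0]); first exact: closed_ui.
by apply/seteqP; split=> t /ui_eq0.
Qed.

Lemma closed_ui1 : closed [set ui1 R].
Proof.
rewrite (_ : [set _] = [set t | ival t = 1]); first exact: closed_ui.
by apply/seteqP; split=> t /ui_eq1.
Qed.

End unit_interval_facts.

Lemma closed_preimage (X Y : topologicalType) (f : X -> Y) (A : set Y) :
  continuous f -> closed A -> closed (f @^-1` A).
Proof. by move=> /continuous_closedP; apply. Qed.

(** * Lifting against closed pairs *)

Section lifting.
Variable R : realType.
Local Notation I := (unit_interval R).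

(** The right lifting property of [q] against the inclusion of [A] in [D]. The
    function on [A] is given as a function on all of [D] of which only the
    restriction to [A] matters, which makes glueing painless. *)
Definition lifts (D : topologicalType) (A : set D) (P B : topologicalType)
    (q : P -> B) : Prop :=
  forall (c : D -> P) (b : D -> B), {within A, continuous c} -> continuous b ->
    (forall d, A d -> q (c d) = b d) ->
    exists c' : D -> P, [/\ continuous c', forall d, A d -> c' d = c d
      & forall d, q (c' d) = b d].

Lemma lifts_retract (D D' : topologicalType) (A : set D) (A' : set D')
    (s : D -> D') (r : D' -> D) (P B : topologicalType) (q : P -> B) :
  continuous s -> continuous r -> (forall d, r (s d) = d) ->
  (forall d, A d -> A' (s d)) -> (forall d, A' d -> A (r d)) ->
  lifts A' q -> lifts A q.
Proof.
move=> cs cr rs sA rA h c b cc cb cbE.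
have [c' [cc' c'A c'b]] : exists c' : D' -> P, [/\ continuous c',
    forall d, A' d -> c' d = c (r d) & forall d, q (c' d) = b (r d)].
  apply: h.
  - exact: within_precomp cc (continuous_within cr) rA.
  - exact: comp_continuous cr cb.
  - by move=> d /rA; exact: cbE.
exists (fun d => c' (s d)); split=> [|d Ad|d].
- exact: comp_continuous cs cc'.
- by rewrite c'A ?rs //; exact: sA.
- by rewrite c'b rs.
Qed.

(** Lifting over one more cell: first lift over [C], where the part of [C] that lands in
    [A] is already lifted, and then continue from the union.  The left inverse [psi],
    defined on all of [D], turns a function on [C] into one on the range of [phi]. *)
Lemma lifts_attach (D C : topologicalType) (A : set D) (phi : C -> D) (psi : D -> C)
    (P B : topologicalType) (q : P -> B) :
  closed A -> closed (range phi) -> continuous phi -> continuous psi ->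
  cancel phi psi -> lifts (phi @^-1` A) q -> lifts (A `|` range phi) q ->
  lifts A q.
Proof.
move=> clA clp cphi cpsi phiK hC hD c b cc cb cbE.
have [e [ce eA eb]] : exists e : C -> P, [/\ continuous e,
    forall x, A (phi x) -> e x = c (phi x) & forall x, q (e x) = b (phi x)].
  apply: hC.
  - exact: within_precomp cc (continuous_within cphi) _.
  - exact: comp_continuous cphi cb.
  - by move=> x; exact: cbE.
pose c1 d := if `[< range phi d >] then e (psi d) else c d.
have c1E x : c1 (phi x) = e x.
  by rewrite /c1 asboolT ?phiK //; exists x.
have c1A d : A d -> c1 d = c d.
  move=> Ad; rewrite /c1; case: asboolP => // -[x _ xd].
  by rewrite -xd phiK eA // xd.
have [c' [cc' c'A c'b]] : exists c' : D -> P, [/\ continuous c',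
    forall d, (A `|` range phi) d -> c' d = c1 d & forall d, q (c' d) = b d].
  apply: hD => //.
    apply: withinU_continuous => //.
      by apply: within_eq cc => d Ad; rewrite c1A.
    apply: (within_eq (f := fun d => e (psi d))).
      by move=> _ [x _ <-]; rewrite phiK c1E.
    by apply: continuous_within; exact: comp_continuous cpsi ce.
  move=> d [Ad|[x _ <-]]; first by rewrite c1A // cbE.
  by rewrite c1E eb.
exists c'; split => // d Ad; rewrite c'A ?c1A //; exact: or_introl.
Qed.

Lemma lifts_total (D : topologicalType) (P B : topologicalType) (q : P -> B) :
  lifts [set: D] q.
Proof.
by move=> c b cc cb cbE; exists c; split => // [|d]; [exact: within_setT|exact: cbE].
Qed.

(** The mapping cylinder of the inclusion of [A], as a subset of [D * I]. *)
Definition cylinder (D : topologicalType) (A : set D) : set (D * I) :=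
  [set w | w.2 = ui0 R \/ A w.1].

(** The boundary of [D * I] when [A] is the boundary of [D]. *)
Definition prism (D : topologicalType) (A : set D) : set (D * I) :=
  [set w | A w.1 \/ (w.2 = ui0 R \/ w.2 = ui1 R)].

(** The homotopy extension property.  The universal form, a retraction onto the mapping
    cylinder, is inherited by products with an arbitrary space. *)
Definition extends_homotopies (D : topologicalType) (A : set D) : Prop :=
  exists r : D * I -> D * I, [/\ continuous r, forall w, cylinder A (r w)
    & forall w, cylinder A w -> r w = w].

Lemma closed_cylinder (D : topologicalType) (A : set D) :
  closed A -> closed (cylinder A).
Proof.
move=> clA; apply: (@closedU _ [set w | w.2 = ui0 R] [set w | A w.1]).
- exact: closed_preimage (@snd_continuous D I) (@closed_ui0 R).
- exact: closed_preimage (@fst_continuous D I) clA.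
Qed.

Lemma closed_prism (D : topologicalType) (A : set D) : closed A -> closed (prism A).
Proof.
move=> clA.
apply: (@closedU _ [set w : D * I | A w.1] [set w | w.2 = ui0 R \/ w.2 = ui1 R]).
- exact: closed_preimage (@fst_continuous D I) clA.
- apply: (@closedU _ [set w : D * I | w.2 = ui0 R] [set w | w.2 = ui1 R]).
  + exact: closed_preimage (@snd_continuous D I) (@closed_ui0 R).
  + exact: closed_preimage (@snd_continuous D I) (@closed_ui1 R).
Qed.

Lemma extends_homotopies_retract (D D' : topologicalType) (A : set D) (A' : set D')
    (s : D -> D') (r : D' -> D) :
  continuous s -> continuous r -> (forall d, r (s d) = d) ->
  (forall d, A d -> A' (s d)) -> (forall d, A' d -> A (r d)) ->
  extends_homotopies A' -> extends_homotopies A.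
Proof.
move=> cs cr rs sA rA [e [ce eJ eid]].
exists (fun w => let w' := e (s w.1, w.2) in (r w'.1, w'.2)); split.
- have cw : continuous (fun w : D * I => e (s w.1, w.2)).
    apply: comp_continuous ce; apply: pair_continuous; last exact: snd_continuous.
    exact: comp_continuous (@fst_continuous _ _) cs.
  apply: pair_continuous; last exact: comp_continuous cw (@snd_continuous _ _).
  exact: comp_continuous cw (comp_continuous (@fst_continuous _ _) cr).
- move=> w; have [h|h] := eJ (s w.1, w.2); first by left.
  by right; exact: rA.
- move=> [d t] [/= t0|/= Ad]; rewrite eid /= ?rs //; [by left|].
  by right; exact: sA.
Qed.

Lemma extends_homotopies_setX (Z D : topologicalType) (A : set D) :
  extends_homotopies A -> extends_homotopies ([set: Z] `*` A).
Proof.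
move=> [r [cr rJ rid]].
exists (fun w => let w' := r (w.1.2, w.2) in ((w.1.1, w'.1), w'.2)); split.
- have c1 : continuous (fun w : (Z * D) * I => w.1).
    exact: fst_continuous.
  have cw : continuous (fun w : (Z * D) * I => r (w.1.2, w.2)).
    apply: comp_continuous cr; apply: pair_continuous; last exact: snd_continuous.
    exact: comp_continuous c1 (@snd_continuous _ _).
  apply: pair_continuous; last exact: comp_continuous cw (@snd_continuous _ _).
  apply: pair_continuous; first exact: comp_continuous c1 (@fst_continuous _ _).
  exact: comp_continuous cw (@fst_continuous _ _).
- move=> w; have [h|h] := rJ (w.1.2, w.2); first by left.
  by right.
- by move=> [[z d] t] [/= t0|[_ /= Ad]]; rewrite rid //=; [left|right].
Qed.

Lemma homotopy_extension (D Y : topologicalType) (A : set D) (k : D * I -> Y) :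
  closed A -> extends_homotopies A -> {within cylinder A, continuous k} ->
  exists2 k' : D * I -> Y, continuous k' & forall w, cylinder A w -> k' w = k w.
Proof.
move=> clA [r [cr rJ rid]] ck; exists (fun w => k (r w)).
  exact: within_comp ck cr rJ.
by move=> w /rid ->.
Qed.

End lifting.

(** * The mapping path fibration *)

Section mapping_path_space.
Variables (R : realType) (X Y : topologicalType) (f : X -> Y).
Local Notation I := (unit_interval R).

Definition mapping_path : set (X * {compact-open, I -> Y}) :=
  [set p | continuous (p.2 : I -> Y) /\ p.2 (ui0 R) = f p.1].

Definition path_space : Type := set_type mapping_path.
HB.instance Definition _ := Topological.on path_space.

Definition path_start (p : path_space) : X := (set_val p).1.
Definition path_fun (p : path_space) : I -> Y := (set_val p).2.
(** The fibration that replaces [f]: lifting against [path_end] is lifting against [f] up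
    to a homotopy in [Y] that is prescribed on the boundary. *)
Definition path_end (p : path_space) : Y := path_fun p (ui1 R).

Lemma path_fun_continuous p : continuous (path_fun p).
Proof. by have [] := set_valP p. Qed.

Lemma path_fun0 p : path_fun p (ui0 R) = f (path_start p).
Proof. by have [] := set_valP p. Qed.

Definition mk_path (x : X) (g : I -> Y) (cg : continuous g) (g0 : g (ui0 R) = f x) :
  path_space := exist _ (x, g) (mem_set (conj cg g0)).

Lemma path_space_eq (p p' : path_space) : path_start p = path_start p' ->
  (forall s, path_fun p s = path_fun p' s) -> p = p'.
Proof.
move=> h1 h2; apply: val_inj; rewrite [LHS]surjective_pairing [RHS]surjective_pairing.
by congr pair => //; apply/funext.
Qed.

Lemma path_start_continuous : continuous path_start.
Proof. exact: comp_continuous (@set_val_continuous _ _) (@fst_continuous _ _). Qed.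

Lemma path_fun_joint_continuous :
  continuous (fun w : path_space * I => path_fun w.1 w.2).
Proof.
have := @continuous_uncurry path_space I Y path_fun.
move=> h; have [cI hI] := unit_interval_compact_hausdorff R.
have : continuous (uncurry path_fun).
  apply: h => //.
  - move=> x _; exists setT; first exact: filterT.
    by split=> //; exact: closedT.
  - exact: comp_continuous (@set_val_continuous _ _) (@snd_continuous _ _).
  - exact: path_fun_continuous.
rewrite (_ : uncurry path_fun = fun w => path_fun w.1 w.2) //.
by apply/funext => -[].
Qed.

Lemma path_end_continuous : continuous path_end.
Proof.
apply: (comp_continuous (f := fun p => (p, ui1 R)) _ path_fun_joint_continuous).
by apply: pair_continuous; [exact: id_continuous|exact: cst_continuous].
Qed.

(** The exponential law: the interval is locally compact, so paths may be tested jointly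
    in the parameter and in time. *)
Lemma path_space_continuous (T : topologicalType) (u : T -> path_space) :
  continuous (fun t => path_start (u t)) ->
  continuous (fun w : T * I => path_fun (u w.1) w.2) -> continuous u.
Proof.
move=> c1 c2; apply: continuous_into_set.
rewrite (_ : (fun t => _) = fun t => (path_start (u t), path_fun (u t))); last first.
  by apply/funext => t; exact: surjective_pairing.
by apply: pair_continuous => //; exact: continuous_curry_fun c2.
Qed.

Lemma path_start_within (T : topologicalType) (A : set T) (u : T -> path_space) :
  {within A, continuous u} -> {within A, continuous (fun t => path_start (u t))}.
Proof. by move=> cu; exact: comp_within cu path_start_continuous. Qed.

Lemma path_fun_within (T S : topologicalType) (A : set S) (v : S -> T) (w : S -> I)
    (u : T -> path_space) (B : set T) :
  {within B, continuous u} -> {within A, continuous v} -> {within A, continuous w} ->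
  (forall s, A s -> B (v s)) ->
  {within A, continuous (fun s => path_fun (u (v s)) (w s))}.
Proof.
move=> cu cv cw AB.
apply: (comp_within (f := fun s => (u (v s), w s)) _ path_fun_joint_continuous).
by apply: within_pair => //; exact: within_precomp cu cv AB.
Qed.

(** The mapping path fibration has the homotopy lifting property relative to any
    pair with enough homotopy extensions: the starting points are extended by the
    first retraction, the paths by the second. *)
Lemma path_end_lifts_cylinder (D : topologicalType) (A : set D) :
  continuous f -> closed A -> extends_homotopies R A ->
  extends_homotopies R (@prism R D A) -> lifts (@cylinder R D A) path_end.
Proof.
move=> cf clA eA eP c b cc cb cbE.
have [cX ccX cXE] := homotopy_extension clA eA (path_start_within cc).
pose k0 (w : (D * I) * I) : Y :=
  if `[< w.1.2 = ui0 R >] then f (cX (w.1.1, w.2)) else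
  if `[< w.1.2 = ui1 R >] then b (w.1.1, w.2) else path_fun (c (w.1.1, w.2)) w.1.2.
have c1 : continuous (fun w : (D * I) * I => w.1) by exact: fst_continuous.
have c11 : continuous (fun w : (D * I) * I => w.1.1).
  exact: comp_continuous c1 (@fst_continuous _ _).
have c12 : continuous (fun w : (D * I) * I => w.1.2).
  exact: comp_continuous c1 (@snd_continuous _ _).
have c2 : continuous (fun w : (D * I) * I => w.2) by exact: snd_continuous.
have c112 : continuous (fun w : (D * I) * I => (w.1.1, w.2)) by exact: pair_continuous.
have k0J (w : (D * I) * I) : cylinder A (w.1.1, w.2) ->
    k0 w = path_fun (c (w.1.1, w.2)) w.1.2.
  move=> J; rewrite /k0; case: asboolP => [->|_]; first by rewrite path_fun0 cXE.
  by case: asboolP => [->|//]; rewrite -cbE.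
have ck0 : {within cylinder (prism A), continuous k0}.
  pose J1 := [set w : (D * I) * I | cylinder A (w.1.1, w.2)].
  pose J2 := [set w : (D * I) * I | w.1.2 = ui0 R].
  pose J3 := [set w : (D * I) * I | w.1.2 = ui1 R].
  apply: (within_sub (A := J1 `|` (J2 `|` J3))).
    move=> w [t0|[Aw|[s0|s1]]].
    - by left; left.
    - by left; right.
    - by right; left.
    - by right; right.
  have clJ2 : closed J2 by exact: closed_preimage c12 (@closed_ui0 R).
  have clJ3 : closed J3 by exact: closed_preimage c12 (@closed_ui1 R).
  apply: withinU_continuous; [|exact: closedU| |].
  - exact: closed_preimage c112 (closed_cylinder clA).
  - apply: (within_eq (f := fun w => path_fun (c (w.1.1, w.2)) w.1.2)).
      by move=> w /k0J.
    apply: (path_fun_within cc); [exact: continuous_within|exact: continuous_within|].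
    by [].
  apply: withinU_continuous => //.
  - apply: (within_eq (f := fun w => f (cX (w.1.1, w.2)))).
      by move=> w J; rewrite /k0 asboolT.
    by apply: continuous_within; exact: comp_continuous (comp_continuous c112 ccX) cf.
  - apply: (within_eq (f := fun w => b (w.1.1, w.2))).
      move=> w J; rewrite /k0 asboolF; first by rewrite asboolT.
      by rewrite J => /esym; exact: ui01.
    by apply: continuous_within; exact: comp_continuous c112 cb.
have [k ck kE] := homotopy_extension (closed_prism clA) eP ck0.
have ckw (w : D * I) : continuous (fun s => k ((w.1, s), w.2)).
  apply: comp_continuous ck; apply: pair_continuous; last exact: cst_continuous.
  by apply: pair_continuous; [exact: cst_continuous|exact: id_continuous].
have kw0 (w : D * I) : k ((w.1, ui0 R), w.2) = f (cX w).
  rewrite kE; last by right; right; left.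
  by rewrite /k0 /= asboolT // -surjective_pairing.
exists (fun w => mk_path (ckw w) (kw0 w)); split.
- apply: path_space_continuous => //=.
  apply: comp_continuous ck.
  have d1 : continuous (fun w : (D * I) * I => w.1) by exact: fst_continuous.
  apply: pair_continuous; last exact: comp_continuous d1 (@snd_continuous _ _).
  apply: pair_continuous; last exact: snd_continuous.
  exact: comp_continuous d1 (@fst_continuous _ _).
- move=> [d t] J; apply: path_space_eq => [|s] /=; first exact: cXE.
  rewrite /path_fun /= kE; last by case: J => /= h; [left|right; left].
  exact: k0J.
- move=> [d t]; rewrite /path_end /path_fun /= kE; last by right; right; right.
  by rewrite /k0 asboolF ?asboolT //=; apply/nesym; exact: ui01.
Qed.

End mapping_path_space.

(** * Cubes *)

Section sup_norm.
Variables (R : realType) (n : nat).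
Implicit Types u : 'rV[R]_n.

Lemma coord_le_norm u i : `|u 0 i| <= `|u|.
Proof.
rewrite {2}/Num.norm /= mx_normrE.
by apply: (le_bigmax _ (fun ij : 'I_1 * 'I_n => `|u ij.1 ij.2|) (0, i)).
Qed.

Lemma norm_le_coord u (e : R) : 0 <= e -> (forall i, `|u 0 i| <= e) -> `|u| <= e.
Proof.
move=> e0 h; rewrite /Num.norm /= mx_normrE; apply: bigmax_le => // -[j i] _ /=.
by rewrite (ord1 j); exact: h.
Qed.

Lemma norm_attained u : `|u| != 0 -> exists i, `|u| = `|u 0 i|.
Proof. by move=> /mx_norm_neq0[[j i] /= h]; exists i; rewrite -(ord1 j). Qed.

End sup_norm.

Section cube_facts.
Variables (R : realType).
Local Notation I := (unit_interval R).

Definition cval n (v : cube R n) : 'rV[R]_n := set_val v.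

Lemma cvalP n (v : cube R n) i : 0 <= cval v 0 i <= 1.
Proof. exact: (set_valP v). Qed.

Lemma cval_inj n : injective (@cval n).
Proof. exact: val_inj. Qed.

Lemma cval_continuous n : continuous (@cval n).
Proof. exact: set_val_continuous. Qed.

Lemma ccoord_continuous (T : topologicalType) n (u : T -> cube R n) i :
  continuous u -> continuous (fun t => cval (u t) 0 i).
Proof.
move=> cu.
exact: comp_continuous (comp_continuous cu (@cval_continuous n))
  (@coord_continuous R 1 n 0 i).
Qed.

Lemma clampC_subproof n (w : 'rV[R]_n) :
  cube R n (\row_i Num.max 0 (Num.min 1 (w 0 i))).
Proof. by move=> i; rewrite !mxE; exact: (clampI_subproof (w 0 i)). Qed.

Definition clampC n (w : 'rV[R]_n) : cube R n :=
  exist _ (\row_i Num.max 0 (Num.min 1 (w 0 i))) (mem_set (clampC_subproof w)).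

Lemma cval_clampC n (w : 'rV[R]_n) i : 0 <= w 0 i <= 1 ->
  cval (clampC w) 0 i = w 0 i.
Proof.
by move=> /andP[w0 w1]; rewrite /cval set_valE /= mxE (min_idPr w1) (max_idPr w0).
Qed.

Lemma clampC_continuous (T : topologicalType) n (u : T -> 'rV[R]_n) :
  (forall i, continuous (fun t => u t 0 i)) -> continuous (fun t => clampC (u t)).
Proof.
move=> cu; apply: continuous_into_set; apply: rV_continuous => i.
under eq_fun do rewrite mxE.
apply: maxR_continuous; first exact: cst_continuous.
by apply: minR_continuous; [exact: cst_continuous|exact: cu].
Qed.

Lemma cube_eq n (v w : cube R n) : (forall i, cval v 0 i = cval w 0 i) -> v = w.
Proof. by move=> h; apply: cval_inj; apply/rowP => i; exact: h. Qed.

Lemma cube_compact_hausdorff n : compact_hausdorff (cube R n).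
Proof.
apply: compact_set_type_hausdorff; first exact: norm_hausdorff.
have -> : cube R n = [set v : 'rV[R]_n | forall i, `[(0 : R), 1]%classic (v ord0 i)].
  by apply/seteqP; split=> v /= h i; have := h i; rewrite in_itv.
by apply: (@rV_compact R n (fun=> `[0, 1]%classic)) => _; exact: segment_compact.
Qed.

(** Coordinates centred at the midpoint, in which the cube is the unit ball of the
    supremum norm and its boundary is the unit sphere. *)
Definition centred n (v : cube R n) : 'rV[R]_n := \row_i (2 * cval v 0 i - 1).

Lemma centred_continuous n : continuous (@centred n).
Proof.
apply: rV_continuous => i; under eq_fun do rewrite mxE.
apply: addR_continuous; last exact: cst_continuous.
apply: mulR_continuous; first exact: cst_continuous.
by apply: ccoord_continuous; exact: id_continuous.
Qed.

Lemma norm_centred_le1 n (v : cube R n) : `|centred v| <= 1.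
Proof.
apply: norm_le_coord => // i; rewrite mxE ler_norml.
by have := cvalP v i; lra.
Qed.

Definition dcube n : set (cube R n) := @cube_boundary R n.

Lemma dcubeE n (v : cube R n) : dcube v <-> `|centred v| = 1.
Proof.
split=> [[i h]|h].
  apply/eqP; rewrite eq_le norm_centred_le1 /=; apply: le_trans (coord_le_norm _ i).
  rewrite mxE; case: h => h.
    by rewrite /cval h mulr0 sub0r normrN normr1.
  by rewrite /cval h mulr1 addrK normr1.
have [|i] := @norm_attained R n (centred v); first by rewrite h oner_eq0.
rewrite h mxE => hi; exists i; rewrite -/(cval v).
by have := hi; case: ger0P => _ ?; [right|left]; lra.
Qed.

Lemma closed_dcube n : closed (@dcube n).
Proof.
rewrite (_ : @dcube n = (fun v => `|centred v|) @^-1` [set 1]); last first.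
  by apply/seteqP; split=> v /dcubeE.
apply: closed_preimage (@closed_eq R 1).
exact: comp_continuous (@centred_continuous n) (@norm_continuous _ _).
Qed.

(** The retraction is the projection from the point above the middle of the lid at height
    2.  The maximum [m] of the two norms chooses between bottom and walls, so a single
    formula is continuous on the whole cylinder. *)
Lemma cube_extends_homotopies n : extends_homotopies R (@dcube n).
Proof.
pose m (w : cube R n * I) := Num.max `|centred w.1| ((2 - ival w.2) / 2).
pose v' (w : cube R n * I) := clampC (\row_i ((centred w.1 0 i / m w + 1) / 2)).
pose t' (w : cube R n * I) := clampI (2 - (2 - ival w.2) / m w).
have m12 w : 1 / 2 <= m w by rewrite /m le_max; have := ivalP w.2; lra.
have m0 w : 0 < m w by apply: lt_le_trans (m12 w); lra.
have mu w : `|centred w.1| <= m w by rewrite /m le_max lexx.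
have mt w : (2 - ival w.2) / 2 <= m w by rewrite /m le_max lexx orbT.
have m1 w : m w <= 1.
  by rewrite /m ge_max norm_centred_le1 /=; have := ivalP w.2; lra.
have uE w i : -1 <= centred w.1 0 i / m w <= 1.
  rewrite -ler_norml normrM normfV (gtr0_norm (m0 w)) ler_pdivrMr // mul1r.
  by apply: le_trans (mu w); exact: coord_le_norm.
have v'E w i : cval (v' w) 0 i = (centred w.1 0 i / m w + 1) / 2.
  by rewrite cval_clampC mxE //; have := uE w i; lra.
have cv'E w i : centred (v' w) 0 i = centred w.1 0 i / m w.
  by rewrite mxE v'E; lra.
have t'E w : ival (t' w) = 2 - (2 - ival w.2) / m w.
  rewrite ival_clampI //.
  have h1 : (2 - ival w.2) / m w <= 2.
    by rewrite ler_pdivrMr //; have := mt w; lra.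
  have h2 : 1 <= (2 - ival w.2) / m w.
    by rewrite ler_pdivlMr // mul1r; have := m1 w; have := ivalP w.2; lra.
  by rewrite subr_ge0 h1 /=; lra.
have cm : continuous m.
  apply: maxR_continuous.
    apply: comp_continuous (@norm_continuous _ _).
    exact: comp_continuous (@fst_continuous _ _) (@centred_continuous n).
  apply: mulR_continuous; last exact: cst_continuous.
  apply: addR_continuous; first exact: cst_continuous.
  by apply: oppR_continuous; apply: ival_comp_continuous; exact: snd_continuous.
have cmV : continuous (fun w => (m w)^-1).
  by apply: invR_continuous => // w; rewrite gt_eqF.
exists (fun w => (v' w, t' w)); split.
- apply: pair_continuous.
    apply: clampC_continuous => i; under eq_fun do rewrite mxE.
    apply: mulR_continuous; last exact: cst_continuous.
    apply: addR_continuous; last exact: cst_continuous.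
    apply: mulR_continuous => //.
    apply: comp_continuous (@coord_continuous _ _ _ 0 i).
    exact: comp_continuous (@fst_continuous _ _) (@centred_continuous n).
  apply: clampI_continuous; apply: addR_continuous; first exact: cst_continuous.
  apply: oppR_continuous; apply: mulR_continuous => //.
  apply: addR_continuous; first exact: cst_continuous.
  by apply: oppR_continuous; apply: ival_comp_continuous; exact: snd_continuous.
- move=> w; have [h|h] := leP `|centred w.1| ((2 - ival w.2) / 2).
    left; apply/ui_eq0; rewrite /= t'E.
    have -> : m w = (2 - ival w.2) / 2 by rewrite /m (max_idPr h).
    have : 2 - ival w.2 != 0 by have := ivalP w.2; lra.
    by move=> h0; field.
  right; apply/dcubeE.
  have mE : m w = `|centred w.1| by rewrite /m (max_idPl (ltW h)).
  have h0 : `|centred w.1| != 0 by rewrite -mE gt_eqF.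
  apply/eqP; rewrite eq_le norm_centred_le1 /=.
  have [i hi] := norm_attained h0.
  apply: le_trans (coord_le_norm _ i); rewrite cv'E normrM normfV mE normr_id -hi.
  by rewrite divff.
- move=> w J; have mE : m w = 1.
    apply/eqP; rewrite eq_le m1 /=; case: J => [/ui_eq0 h|/dcubeE h].
      by have := mt w; rewrite h; lra.
    by rewrite -h.
  rewrite [RHS]surjective_pairing; congr pair.
    by apply: cube_eq => i; rewrite v'E mE mxE; lra.
  by apply: ival_inj; rewrite t'E mE; lra.
Qed.

Definition cube_cat m n (w : cube R m * cube R n) : cube R (m + n) :=
  clampC (row_mx (cval w.1) (cval w.2)).
Definition cube_left m n (v : cube R (m + n)) : cube R m := clampC (lsubmx (cval v)).
Definition cube_right m n (v : cube R (m + n)) : cube R n := clampC (rsubmx (cval v)).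

Lemma cval_cat_l m n (w : cube R m * cube R n) i :
  cval (cube_cat w) 0 (lshift n i) = cval w.1 0 i.
Proof. by rewrite cval_clampC row_mxEl ?cvalP. Qed.

Lemma cval_cat_r m n (w : cube R m * cube R n) i :
  cval (cube_cat w) 0 (rshift m i) = cval w.2 0 i.
Proof. by rewrite cval_clampC row_mxEr ?cvalP. Qed.

Lemma cval_left m n (v : cube R (m + n)) i :
  cval (cube_left v) 0 i = cval v 0 (lshift n i).
Proof. by rewrite cval_clampC mxE ?cvalP. Qed.

Lemma cval_right m n (v : cube R (m + n)) i :
  cval (cube_right v) 0 i = cval v 0 (rshift m i).
Proof. by rewrite cval_clampC mxE ?cvalP. Qed.

Lemma cube_left_cat m n (w : cube R m * cube R n) : cube_left (cube_cat w) = w.1.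
Proof. by apply: cube_eq => i; rewrite cval_left cval_cat_l. Qed.

Lemma cube_right_cat m n (w : cube R m * cube R n) : cube_right (cube_cat w) = w.2.
Proof. by apply: cube_eq => i; rewrite cval_right cval_cat_r. Qed.

Lemma cube_splitK m n (v : cube R (m + n)) :
  cube_cat (cube_left v, cube_right v) = v.
Proof.
apply: cube_eq => i; case: (split_ordP i) => j ->.
  by rewrite cval_cat_l cval_left.
by rewrite cval_cat_r cval_right.
Qed.

Lemma cube_cat_continuous m n : continuous (@cube_cat m n).
Proof.
apply: clampC_continuous => i; case: (split_ordP i) => j ->.
  under eq_fun do rewrite row_mxEl.
  by apply: ccoord_continuous; exact: fst_continuous.
under eq_fun do rewrite row_mxEr.
by apply: ccoord_continuous; exact: snd_continuous.
Qed.

Lemma cube_left_continuous m n : continuous (@cube_left m n).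
Proof.
apply: clampC_continuous => i; under eq_fun do rewrite mxE.
by apply: ccoord_continuous; exact: id_continuous.
Qed.

Lemma cube_right_continuous m n : continuous (@cube_right m n).
Proof.
apply: clampC_continuous => i; under eq_fun do rewrite mxE.
by apply: ccoord_continuous; exact: id_continuous.
Qed.

Lemma dcube_cat m n (w : cube R m * cube R n) :
  dcube (cube_cat w) <-> dcube w.1 \/ dcube w.2.
Proof.
split=> [[k]|[] [i h]].
- rewrite -/(cval _); case: (split_ordP k) => i ->.
    by rewrite cval_cat_l => h; left; exists i.
  by rewrite cval_cat_r => h; right; exists i.
- by exists (lshift n i); rewrite -/(cval _) cval_cat_l.
- by exists (rshift m i); rewrite -/(cval _) cval_cat_r.
Qed.

Definition cube_of_I (t : I) : cube R 1 := clampC (\row_i ival t).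
Definition I_of_cube (v : cube R 1) : I := clampI (cval v 0 0).

Lemma cval_cube_of_I t i : cval (cube_of_I t) 0 i = ival t.
Proof. by rewrite cval_clampC mxE // ivalP. Qed.

Lemma ival_I_of_cube v : ival (I_of_cube v) = cval v 0 0.
Proof. by rewrite ival_clampI // cvalP. Qed.

Lemma cube_of_IK : cancel cube_of_I I_of_cube.
Proof. by move=> t; apply: ival_inj; rewrite ival_I_of_cube cval_cube_of_I. Qed.

Lemma I_of_cubeK : cancel I_of_cube cube_of_I.
Proof.
by move=> v; apply: cube_eq => i; rewrite cval_cube_of_I ival_I_of_cube (ord1 i).
Qed.

Lemma cube_of_I_continuous : continuous cube_of_I.
Proof.
apply: clampC_continuous => i; under eq_fun do rewrite mxE.
exact: ival_continuous.
Qed.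

Lemma I_of_cube_continuous : continuous I_of_cube.
Proof. by apply: clampI_continuous; apply: ccoord_continuous; exact: id_continuous. Qed.

Lemma dcube_cube_of_I t : dcube (cube_of_I t) <-> t = ui0 R \/ t = ui1 R.
Proof.
split=> [[i]|h].
  by rewrite -/(cval _) cval_cube_of_I => -[] h; [left; apply/ui_eq0|right; apply/ui_eq1].
exists 0; rewrite -/(cval _) cval_cube_of_I.
by case: h => [/ui_eq0|/ui_eq1]; [left|right].
Qed.

Definition prism_to_cube n (w : cube R n * I) : cube R (n + 1) :=
  cube_cat (w.1, cube_of_I w.2).
Definition cube_to_prism n (v : cube R (n + 1)) : cube R n * I :=
  (cube_left v, I_of_cube (cube_right v)).

Lemma prism_to_cubeK n : cancel (@prism_to_cube n) (@cube_to_prism n).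
Proof.
move=> [v t]; rewrite /cube_to_prism /prism_to_cube.
by rewrite cube_left_cat cube_right_cat cube_of_IK.
Qed.

Lemma cube_to_prismK n : cancel (@cube_to_prism n) (@prism_to_cube n).
Proof. by move=> v; rewrite /prism_to_cube /= I_of_cubeK cube_splitK. Qed.

Lemma prism_to_cube_continuous n : continuous (@prism_to_cube n).
Proof.
apply: comp_continuous (@cube_cat_continuous n 1).
apply: pair_continuous; first exact: fst_continuous.
exact: comp_continuous (@snd_continuous _ _) cube_of_I_continuous.
Qed.

Lemma cube_to_prism_continuous n : continuous (@cube_to_prism n).
Proof.
apply: pair_continuous; first exact: cube_left_continuous.
exact: comp_continuous (@cube_right_continuous _ _) I_of_cube_continuous.
Qed.

Lemma dcube_prism_to_cube n (w : cube R n * I) :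
  dcube (prism_to_cube w) <-> prism (@dcube n) w.
Proof.
split=> [/dcube_cat[h|/dcube_cube_of_I h]|[h|h]]; first by left.
- by right.
- by apply/dcube_cat; left.
- by apply/dcube_cat; right; apply/dcube_cube_of_I.
Qed.

Lemma prism_cube_to_prism n (v : cube R (n + 1)) :
  dcube v -> prism (@dcube n) (cube_to_prism v).
Proof. by move=> h; apply/dcube_prism_to_cube; rewrite cube_to_prismK. Qed.

Lemma prism_extends_homotopies n : extends_homotopies R (@prism R _ (@dcube n)).
Proof.
apply: (extends_homotopies_retract (@prism_to_cube_continuous n)
  (@cube_to_prism_continuous n) (@prism_to_cubeK n) _ _
  (cube_extends_homotopies (n + 1))).
- by move=> w h; apply/dcube_prism_to_cube.
- by move=> v; exact: prism_cube_to_prism.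
Qed.

Lemma closed_setX (Z D : topologicalType) (A : set D) : closed A ->
  closed ([set: Z] `*` A).
Proof.
move=> clA.
rewrite (_ : _ `*` _ = (fun w : Z * D => w.2) @^-1` A).
  exact: closed_preimage (@snd_continuous _ _) clA.
by apply/seteqP; split=> w /= => [[]|].
Qed.

Lemma setX_prism_extends_homotopies (Z : topologicalType) n :
  extends_homotopies R (@prism R _ ([set: Z] `*` @dcube n)).
Proof.
pose s (w : (Z * cube R n) * I) := (w.1.1, (w.1.2, w.2)).
pose r (w : Z * (cube R n * I)) := ((w.1, w.2.1), w.2.2).
have cs : continuous s.
  have c1 : continuous (fun w : (Z * cube R n) * I => w.1) by exact: fst_continuous.
  apply: pair_continuous; first exact: comp_continuous c1 (@fst_continuous _ _).
  apply: pair_continuous; last exact: snd_continuous.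
  exact: comp_continuous c1 (@snd_continuous _ _).
have cr : continuous r.
  have c2 : continuous (fun w : Z * (cube R n * I) => w.2) by exact: snd_continuous.
  apply: pair_continuous; last exact: comp_continuous c2 (@snd_continuous _ _).
  apply: pair_continuous; first exact: fst_continuous.
  exact: comp_continuous c2 (@fst_continuous _ _).
apply: (extends_homotopies_retract cs cr _ _ _
  (@extends_homotopies_setX R Z _ _ (prism_extends_homotopies n))).
- by move=> [[z v] t].
- by move=> [[z v] t] [[_ h]|h]; split=> //; [left|right].
- by move=> [z [v t]] [_ [h|h]]; [left|right].
Qed.

End cube_facts.

(** * Weak equivalences lift cells up to homotopy *)

Section cell_lifting.
Variables (R : realType).
Local Notation I := (unit_interval R).

Section moving.
Variables (X Y : topologicalType) (f : X -> Y) (cf : continuous f).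
Variables (D : topologicalType) (A : set D) (clA : closed A).

(** The lifting property for a single partial lift [c], which can be followed along
    homotopies of [c]. *)
Definition solvable (c : D -> path_space R f) : Prop :=
  forall b : D -> Y, continuous b -> (forall d, A d -> path_end (c d) = b d) ->
    exists c' : D -> path_space R f, [/\ continuous c', forall d, A d -> c' d = c d
      & forall d, path_end (c' d) = b d].

Lemma solvable_eq (c1 c2 : D -> path_space R f) :
  (forall d, A d -> c1 d = c2 d) -> solvable c1 -> solvable c2.
Proof.
move=> cE h b cb bE; have [d Ad|c' [cc' c'A c'b]] := h b cb; first by rewrite cE // bE.
by exists c'; split => // d Ad; rewrite c'A // cE.
Qed.

Lemma within_cylinder_glue (Z : topologicalType) (g : D -> Z) (k : D * I -> Z) :
  continuous g -> {within [set w | A w.1], continuous k} ->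
  (forall d, A d -> k (d, ui0 R) = g d) ->
  {within @cylinder R D A,
    continuous (fun w => if `[< w.2 = ui0 R >] then g w.1 else k w)}.
Proof.
move=> cg ck kg.
apply: (@withinU_continuous _ _ [set w : D * I | w.2 = ui0 R] [set w | A w.1]).
- exact: closed_preimage (@snd_continuous D I) (@closed_ui0 R).
- exact: closed_preimage (@fst_continuous D I) clA.
- apply: (within_eq (f := fun w => g w.1)).
    by move=> w h; rewrite asboolT.
  by apply: continuous_within; exact: comp_continuous (@fst_continuous _ _) cg.
- apply: within_eq ck => -[d t] /= Ad; case: asboolP => // ->; exact: kg.
Qed.

Hypothesis (eA : extends_homotopies R A) (eP : extends_homotopies R (@prism R D A)).

(** A solution at the end of a homotopy of lifting problems is carried back to its
    beginning by the relative homotopy lifting property. *)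
Lemma solution_transport (C : D * I -> path_space R f) (B : D * I -> Y) :
  {within [set w | A w.1], continuous C} -> continuous B ->
  (forall d t, A d -> path_end (C (d, t)) = B (d, t)) ->
  (exists c1 : D -> path_space R f, [/\ continuous c1,
     forall d, A d -> c1 d = C (d, ui1 R) & forall d, path_end (c1 d) = B (d, ui1 R)]) ->
  exists c0 : D -> path_space R f, [/\ continuous c0,
     forall d, A d -> c0 d = C (d, ui0 R) & forall d, path_end (c0 d) = B (d, ui0 R)].
Proof.
move=> cC cB BA [c1 [cc1 c1A c1B]].
have crev : continuous (fun w : D * I => (w.1, irev w.2)).
  apply: pair_continuous; first exact: fst_continuous.
  exact: comp_continuous (@snd_continuous _ _) (@irev_continuous R).
have [||w|C' [cC' C'J C'B]] := path_end_lifts_cylinder cf clA eA eP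
  (c := fun w => if `[< w.2 = ui0 R >] then c1 w.1 else C (w.1, irev w.2))
  (b := fun w => B (w.1, irev w.2)).
- apply: within_cylinder_glue => //.
    apply: within_precomp cC _ _; first exact: continuous_within.
    by [].
  by move=> d Ad /=; rewrite irev0 c1A.
- exact: comp_continuous crev cB.
- case: asboolP => [-> _|w0]; first by rewrite irev0 c1B.
  by case=> // Aw; rewrite BA.
exists (fun d => C' (d, ui1 R)); split.
- apply: comp_continuous cC'; apply: pair_continuous; last exact: cst_continuous.
  exact: id_continuous.
- move=> d Ad; rewrite C'J /=; last by right.
  by rewrite asboolF ?irev1 //; apply/nesym; exact: ui01.
- by move=> d; rewrite C'B /= irev1.
Qed.

(** Solvability is invariant under homotopies of the partial lift, as the map to the
    base can be made to follow by homotopy extension. *)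
Lemma solvable_move (C : D * I -> path_space R f) :
  {within [set w | A w.1], continuous C} ->
  solvable (fun d => C (d, ui1 R)) -> solvable (fun d => C (d, ui0 R)).
Proof.
move=> cC h b cb bE.
have [B cB BE] := homotopy_extension clA eA
  (within_cylinder_glue cb (comp_within cC (@path_end_continuous R X Y f)) bE).
have BA d t : A d -> path_end (C (d, t)) = B (d, t).
  by move=> Ad; rewrite BE /=; [case: asboolP => // ->; rewrite bE|right].
have B0 d : B (d, ui0 R) = b d by rewrite BE /= ?asboolT //; left.
have [|c0 [cc0 c0A c0B]] := solution_transport cC cB BA.
  apply: h; last by move=> d; exact: BA.
  apply: comp_continuous cB; apply: pair_continuous; last exact: cst_continuous.
  exact: id_continuous.
by exists c0; split => // d; rewrite c0B B0.
Qed.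

Definition const_path (x : X) : path_space R f :=
  @mk_path R X Y f x (fun _ => f x) (@cst_continuous _ _ _) erefl.

Lemma const_path_continuous : continuous const_path.
Proof.
apply: path_space_continuous; first exact: id_continuous.
exact: comp_continuous (@fst_continuous _ _) cf.
Qed.

Definition shorten_time (s t : I) : I := clampI (ival s * (1 - ival t)).

Lemma shorten_time_continuous (T : topologicalType) (u v : T -> I) :
  continuous u -> continuous v -> continuous (fun t => shorten_time (u t) (v t)).
Proof.
move=> cu cv; apply: clampI_continuous; apply: mulR_continuous.
  exact: ival_comp_continuous.
apply: addR_continuous; first exact: cst_continuous.
by apply: oppR_continuous; exact: ival_comp_continuous.
Qed.

Lemma shorten_time0 s : shorten_time s (ui0 R) = s.
Proof. by rewrite /shorten_time ival0 subr0 mulr1 ival_clampIK. Qed.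

Lemma shorten_time1 s : shorten_time s (ui1 R) = ui0 R.
Proof. by rewrite /shorten_time ival1 subrr mulr0 clampI_le0. Qed.

Lemma shorten_0time t : shorten_time (ui0 R) t = ui0 R.
Proof. by rewrite /shorten_time ival0 mul0r clampI_le0. Qed.

Lemma shorten_continuous_at (p : path_space R f) t :
  continuous (fun s => path_fun p (shorten_time s t)).
Proof.
apply: comp_continuous (@path_fun_continuous R X Y f p).
by apply: shorten_time_continuous; [exact: id_continuous|exact: cst_continuous].
Qed.

Lemma shorten_start (p : path_space R f) t :
  path_fun p (shorten_time (ui0 R) t) = f (path_start p).
Proof. by rewrite shorten_0time path_fun0. Qed.

Definition shorten (w : path_space R f * I) : path_space R f :=
  mk_path (@shorten_continuous_at w.1 w.2) (shorten_start w.1 w.2).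

Lemma shorten_continuous : continuous shorten.
Proof.
have d1 : continuous (fun w : (path_space R f * I) * I => w.1).
  exact: fst_continuous.
apply: path_space_continuous.
  exact: comp_continuous (@fst_continuous _ _) (@path_start_continuous R X Y f).
apply: (comp_continuous (f := fun w : (path_space R f * I) * I =>
  (w.1.1, shorten_time w.2 w.1.2)) _ (@path_fun_joint_continuous R X Y f)).
apply: pair_continuous; first exact: comp_continuous d1 (@fst_continuous _ _).
apply: shorten_time_continuous; first exact: snd_continuous.
exact: comp_continuous d1 (@snd_continuous _ _).
Qed.

Lemma shorten0 p : shorten (p, ui0 R) = p.
Proof. by apply: path_space_eq => // s; rewrite /path_fun /= shorten_time0. Qed.

Lemma shorten1 p : shorten (p, ui1 R) = const_path (path_start p).
Proof.
by apply: path_space_eq => // s; rewrite /path_fun /= shorten_time1; exact: path_fun0.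
Qed.

(** Shrinking the paths to their starting points is a homotopy of partial lifts, so it
    suffices to solve problems that commute on the nose with [f]. *)
Lemma solvable_strictify (c : D -> path_space R f) : {within A, continuous c} ->
  solvable (fun d => const_path (path_start (c d))) -> solvable c.
Proof.
move=> cc h.
apply: (solvable_eq (c1 := fun d => shorten (c d, ui0 R))).
  by move=> d _; rewrite shorten0.
apply: (solvable_move (C := fun w => shorten (c w.1, w.2))).
  apply: (comp_within (f := fun w : D * I => (c w.1, w.2)) _ shorten_continuous).
  apply: within_pair; last by apply: continuous_within; exact: snd_continuous.
  apply: (within_precomp cc) => //; apply: continuous_within; exact: fst_continuous.
apply: solvable_eq h => d _; by rewrite /= shorten1.
Qed.

End moving.

Definition scaleC n (w : cube R n * I) : cube R n :=
  clampC (\row_i (cval w.1 0 i * (1 - ival w.2))).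

Lemma scaleC_continuous n : continuous (@scaleC n).
Proof.
apply: clampC_continuous => i; under eq_fun do rewrite mxE.
apply: mulR_continuous; first by apply: ccoord_continuous; exact: fst_continuous.
apply: addR_continuous; first exact: cst_continuous.
by apply: oppR_continuous; apply: ival_comp_continuous; exact: snd_continuous.
Qed.

Lemma cval_scaleC n (w : cube R n * I) i :
  cval (scaleC w) 0 i = cval w.1 0 i * (1 - ival w.2).
Proof.
rewrite cval_clampC mxE //; have := cvalP w.1 i; have := ivalP w.2 => h1 h2.
by apply/andP; split; nra.
Qed.

Lemma scaleC0 n (v : cube R n) : scaleC (v, ui0 R) = v.
Proof. by apply: cube_eq => i; rewrite cval_scaleC ival0 subr0 mulr1. Qed.

Definition corner n : cube R n := clampC 0.

Lemma scaleC1 n (v : cube R n) : scaleC (v, ui1 R) = corner n.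
Proof.
by apply: cube_eq => i; rewrite cval_scaleC ival1 subrr mulr0 cval_clampC mxE // lexx ler01.
Qed.

Definition contract_prism n (w : (cube R n * I) * I) : cube R n * I :=
  (scaleC (w.1.1, w.2), shorten_time w.1.2 w.2).

Lemma contract_prism_continuous n : continuous (@contract_prism n).
Proof.
have d1 : continuous (fun w : (cube R n * I) * I => w.1) by exact: fst_continuous.
apply: pair_continuous.
  apply: (comp_continuous (f := fun w : (cube R n * I) * I => (w.1.1, w.2)) _
    (@scaleC_continuous n)).
  apply: pair_continuous; last exact: snd_continuous.
  exact: comp_continuous d1 (@fst_continuous _ _).
apply: shorten_time_continuous; last exact: snd_continuous.
exact: comp_continuous d1 (@snd_continuous _ _).
Qed.

Lemma contract_prism0 n (d : cube R n * I) : contract_prism (d, ui0 R) = d.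
Proof. by rewrite /contract_prism scaleC0 shorten_time0 -surjective_pairing. Qed.

Lemma contract_prism1 n (d : cube R n * I) :
  contract_prism (d, ui1 R) = (corner n, ui0 R).
Proof. by rewrite /contract_prism scaleC1 shorten_time1. Qed.

Section weak_equivalence.
Variables (X Y : topologicalType) (f : X -> Y).
Hypothesis wf : weak_homotopy_equivalence R f.

Let cf : continuous f. Proof. by case: wf. Qed.

Local Notation dprism n := (@prism R (cube R n) (@dcube R n)).

Let closed_dprism n : closed (dprism n).
Proof. exact: closed_prism (@closed_dcube R n). Qed.

Let dprism_extends n : extends_homotopies R (dprism n).
Proof. exact: prism_extends_homotopies. Qed.

Let dprism_prism_extends n : extends_homotopies R (@prism R _ (dprism n)).
Proof.
pose s (w : (cube R n * I) * I) := (prism_to_cube w.1, w.2).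
pose r (w : cube R (n + 1) * I) := (cube_to_prism w.1, w.2).
have cs : continuous s.
  apply: pair_continuous; last exact: snd_continuous.
  exact: comp_continuous (@fst_continuous _ _) (@prism_to_cube_continuous R n).
have cr : continuous r.
  apply: pair_continuous; last exact: snd_continuous.
  exact: comp_continuous (@fst_continuous _ _) (@cube_to_prism_continuous R n).
apply: (extends_homotopies_retract cs cr _ _ _ (prism_extends_homotopies R (n + 1))).
- by move=> [w t]; rewrite /r /s /= prism_to_cubeK.
- by move=> [w t] [h|h]; [left; apply/dcube_prism_to_cube|right].
- by move=> [v t] [h|h]; [left; exact: prism_cube_to_prism|right].
Qed.

(** With a constant partial lift the map to the base is an element of a homotopy group of
    [Y], and a preimage of it up to homotopy is exactly a solution. *)
Lemma solvable_const n (x : X) : solvable (dprism n) (fun=> const_path f x).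
Proof.
move=> b cb bE.
have n1 : (0 < n + 1)%N by rewrite addn1.
have [_ _ /(_ (n + 1)%N x n1) [_ /(_ (b \o @cube_to_prism R n))[]]] := wf.
  split; first exact: comp_continuous (@cube_to_prism_continuous R n) cb.
  by move=> v /prism_cube_to_prism/bE /= <-.
move=> a [[ca ax] [h [ch h0 h1 hb]]].
have cg d : continuous (fun s => h (prism_to_cube d, s)).
  apply: comp_continuous ch; apply: pair_continuous; last exact: id_continuous.
  exact: cst_continuous.
have g0 d : h (prism_to_cube d, ui0 R) = f (a (prism_to_cube d)) by rewrite h0.
exists (fun d => mk_path (cg d) (g0 d)); split.
- apply: path_space_continuous => /=.
    exact: comp_continuous (@prism_to_cube_continuous R n) ca.
  apply: comp_continuous ch; apply: pair_continuous; last exact: snd_continuous.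
  exact: comp_continuous (@fst_continuous _ _) (@prism_to_cube_continuous R n).
- move=> d /dcube_prism_to_cube hd; apply: path_space_eq => [|s]; first exact: ax.
  by rewrite /path_fun /= hb //= ax.
- by move=> d; rewrite /path_end /path_fun /= h1 /= prism_to_cubeK.
Qed.

(** A partial lift that extends over the prism is homotopic to a constant one. *)
Lemma solvable_extended n (e : cube R n * I -> X) : continuous e ->
  solvable (dprism n) (fun d => const_path f (e d)).
Proof.
move=> ce; apply: (solvable_eq
  (c1 := fun d => const_path f (e (contract_prism (d, ui0 R))))).
  by move=> d _; rewrite contract_prism0.
apply: (solvable_move cf (@closed_dprism n) (@dprism_extends n)
  (@dprism_prism_extends n)
  (C := fun w => const_path f (e (contract_prism w)))).
  apply: continuous_within; apply: comp_continuous (const_path_continuous cf).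
  exact: comp_continuous (@contract_prism_continuous n) ce.
refine (solvable_eq _ (@solvable_const n (e (corner n, ui0 R)))) => d _.
by rewrite contract_prism1.
Qed.

Lemma cube0_eq (v w : cube R 0) : v = w.
Proof. by apply: cube_eq => -[]. Qed.

(** Prisms of positive dimension: the walls and the bottom form a contractible part of
    the boundary, so the partial lift can be made constant there.  It then is an
    element of a homotopy group of [X] on the lid, and the map to the base shows that
    its image is trivial; injectivity extends the partial lift over the prism. *)
Lemma solvable_strict_pos n (c : cube R n * I -> X) : (0 < n)%N ->
  {within dprism n, continuous c} -> solvable (dprism n) (fun d => const_path f (c d)).
Proof.
move=> n0 cc.
have [r [cr rJ rid]] := cube_extends_homotopies R n.
have Jd w : cylinder (@dcube R n) w -> dprism n w.
  by case=> h; [right; left|left].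
(* the contraction of the part of [c] on the walls and the bottom; composing with [r]
   keeps it inside that part, where [c] is continuous *)
pose CJ w := c (r (contract_prism w)).
have cCJ : continuous CJ.
  apply: (within_comp cc); last by move=> w; exact: Jd.
  exact: comp_continuous (@contract_prism_continuous n) cr.
have CJ0 d : cylinder (@dcube R n) d -> CJ (d, ui0 R) = c d.
  by move=> h; rewrite /CJ contract_prism0 rid.
pose x := c (corner n, ui0 R).
have CJ1 d : CJ (d, ui1 R) = x.
  by rewrite /CJ contract_prism1 rid //; left.
have ctop : continuous (fun v => c (v, ui1 R)).
  apply: (within_comp cc); last by move=> v; right; right.
  by apply: pair_continuous; [exact: id_continuous|exact: cst_continuous].
have [|v dv|K cK KE] := homotopy_extension (@closed_dcube R n)
  (cube_extends_homotopies R n)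
  (within_cylinder_glue (@closed_dcube R n) ctop
    (k := fun w => CJ ((w.1, ui1 R), w.2)) _ _).
- apply: continuous_within; apply: comp_continuous cCJ.
  apply: pair_continuous; last exact: snd_continuous.
  by apply: pair_continuous; [exact: fst_continuous|exact: cst_continuous].
- by rewrite /= CJ0 //; right.
have K0 v : K (v, ui0 R) = c (v, ui1 R) by rewrite KE /= ?asboolT //; left.
have KJ v t : dcube v -> K (v, t) = CJ ((v, ui1 R), t).
  move=> dv; rewrite KE /=; last by right.
  by case: asboolP => // ->; rewrite CJ0 //; right.
(* on the lid the contraction is continued by homotopy extension *)
pose C w := if `[< w.1.2 = ui1 R >] then K (w.1.1, w.2) else CJ w.
have cC : {within [set w : (cube R n * I) * I | dprism n w.1], continuous C}.
  have c1 : continuous (fun w : (cube R n * I) * I => w.1) by exact: fst_continuous.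
  have c12 : continuous (fun w : (cube R n * I) * I => w.1.2).
    exact: comp_continuous c1 (@snd_continuous _ _).
  apply: (within_sub (A := [set w : (cube R n * I) * I | w.1.2 = ui1 R] `|`
    [set w | cylinder (@dcube R n) w.1])).
    by move=> w [h|[h|h]]; [right; right|right; left|left].
  apply: withinU_continuous.
  - exact: closed_preimage c12 (@closed_ui1 R).
  - exact: closed_preimage c1 (closed_cylinder (@closed_dcube R n)).
  - apply: (within_eq (f := fun w => K (w.1.1, w.2))).
      by move=> w h; rewrite /C asboolT.
    apply: continuous_within; apply: comp_continuous cK.
    apply: pair_continuous; last exact: snd_continuous.
    exact: comp_continuous c1 (@fst_continuous _ _).
  - apply: (within_eq (f := CJ)); last exact: continuous_within.
    move=> [[v s] t] h; rewrite /C /=; case: asboolP => // s1.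
    move: h; rewrite s1 => -[/= /esym/ui01 //|/= dv].
    by rewrite KJ.
apply: (solvable_eq (c1 := fun d => const_path f (C (d, ui0 R)))).
  move=> [v s] h; congr const_path; rewrite /C /=; case: asboolP => [-> //|s1].
  by rewrite CJ0 //; case: h => [h|[h|h]] //; [right|left].
apply: (solvable_move cf (@closed_dprism n) (@dprism_extends n)
  (@dprism_prism_extends n) (C := fun w => const_path f (C w))).
  exact: comp_within cC (const_path_continuous cf).
pose a v := K (v, ui1 R).
have ca : continuous a.
  apply: comp_continuous cK.
  by apply: pair_continuous; [exact: id_continuous|exact: cst_continuous].
have adx v : dcube v -> a v = x by move=> dv; rewrite /a KJ // CJ1.
have C1 v s : s <> ui1 R -> C ((v, s), ui1 R) = x.
  by move=> s1; rewrite /C /= asboolF // CJ1.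
have C1' v : C ((v, ui1 R), ui1 R) = a v by rewrite /C /= asboolT.
have C1d v s : dcube v -> C ((v, s), ui1 R) = x.
  by move=> dv; have [->|s1] := pselect (s = ui1 R); [rewrite C1' adx|exact: C1].
move=> b cb bE.
have [_ _ /(_ n x n0) [inj _]] := wf.
have [|||e [ce e0 e1 ed]] := inj (fun=> x) a.
- by split; first exact: cst_continuous.
- by split.
- exists b; split => //.
  + by move=> v; rewrite -bE; [rewrite C1 //; exact: ui01|right; left].
  + by move=> v; rewrite -bE; [rewrite C1'|right; right].
  + by move=> v t dv; rewrite -bE; [rewrite C1d|left].
have : solvable (dprism n) (fun d => const_path f (C (d, ui1 R))).
  apply: solvable_eq (solvable_extended ce) => -[v s] h; congr const_path.
  have [->|s1] := pselect (s = ui1 R); first by rewrite e1 C1'.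
  rewrite C1 //; case: h => [h|[/= ->|//]]; first by rewrite ed.
  by rewrite e0.
exact.
Qed.

(** Over the prism on a point the same argument uses path components in place of homotopy
    groups. *)
Lemma solvable_strict0 (c : cube R 0 * I -> X) :
  solvable (dprism 0) (fun d => const_path f (c d)).
Proof.
move=> b cb bE; have [_ [inj _] _] := wf.
pose v0 := corner 0.
have [|e [ce e0 e1]] := inj (c (v0, ui0 R)) (c (v0, ui1 R)).
  exists (fun t => b (v0, t)); split.
  - apply: comp_continuous cb.
    by apply: pair_continuous; [exact: cst_continuous|exact: id_continuous].
  - by rewrite -bE //; right; left.
  - by rewrite -bE //; right; right.
have ce' : continuous (fun w : cube R 0 * I => e w.2).
  exact: comp_continuous (@snd_continuous _ _) ce.
have : solvable (dprism 0) (fun d => const_path f (c d)).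
  apply: solvable_eq (solvable_extended ce') => -[v s] h; congr const_path.
  rewrite (cube0_eq v v0); case: h => [[[]//]|[] /= ->]; [exact: e0|exact: e1].
exact.
Qed.

(** The bijections on homotopy groups, which are stated for maps constant on the boundary
    of a cube, amount to lifting arbitrary cells up to homotopy. *)
Theorem weak_equivalence_lifts n : lifts (@dcube R n) (@path_end R X Y f).
Proof.
case: n => [|n].
  move=> c b cc cb cbE; have [_ [_ surj] _] := wf.
  have [x [p [cp p0 p1]]] := surj (b (corner 0)).
  exists (fun=> mk_path cp p0); split; first exact: cst_continuous.
  - by move=> d [[]].
  - by move=> d; rewrite (cube0_eq d (corner 0)).
rewrite -[n.+1]addn1.
apply: (lifts_retract (@cube_to_prism_continuous R n) (@prism_to_cube_continuous R n)
  (@cube_to_prismK R n) (@prism_cube_to_prism R n) (A' := dprism n)).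
  by move=> w h; apply/dcube_prism_to_cube.
move=> c b cc; apply: (@solvable_strictify _ _ _ cf) => //.
have [n0|] := posnP n; last first.
  by move=> n0; apply: solvable_strict_pos => //; exact: path_start_within.
by clear cc; subst n; exact: solvable_strict0.
Qed.

End weak_equivalence.

End cell_lifting.

(** * From lifting properties back to weak equivalences and fibrations *)

Section compression.
Variables (R : realType).
Local Notation I := (unit_interval R).
Variables (X Y : topologicalType) (f : X -> Y).

Definition compresses (D : topologicalType) (A : set D) : Prop :=
  forall (c : D -> X) (b : D -> Y), {within A, continuous c} -> continuous b ->
    (forall d, A d -> f (c d) = b d) ->
    exists c' : D -> X, [/\ continuous c', forall d, A d -> c' d = c d
      & homotopic_rel R A (f \o c') b].

Lemma lifts_compresses (D : topologicalType) (A : set D) : continuous f ->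
  lifts A f -> compresses A.
Proof.
move=> cf h c b cc cb cbE; have [c' [cc' c'A c'b]] := h c b cc cb cbE.
exists c'; split => //; exists (fun w => b w.1); split=> [|d|//|d t _] /=.
- exact: comp_continuous (@fst_continuous _ _) cb.
- by rewrite c'b.
- by rewrite c'b.
Qed.

Lemma path_end_lifts_compresses (D : topologicalType) (A : set D) : continuous f ->
  lifts A (@path_end R X Y f) -> compresses A.
Proof.
move=> cf h c b cc cb cbE.
have [|d Ad|p [cp pA pb]] := h (fun d => const_path R f (c d)) b _ cb.
- exact: comp_within cc (const_path_continuous cf).
- exact: cbE.
exists (fun d => path_start (p d)); split.
- exact: comp_continuous cp (@path_start_continuous R X Y f).
- by move=> d /pA ->.
exists (fun w => path_fun (p w.1) w.2); split=> [|d|d|d t /pA pd].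
- apply: (comp_continuous (f := fun w => (p w.1, w.2)) _
    (@path_fun_joint_continuous R X Y f)).
  apply: pair_continuous; last exact: snd_continuous.
  exact: comp_continuous (@fst_continuous _ _) cp.
- exact: path_fun0.
- exact: pb.
- by rewrite /= pd.
Qed.

(** Compressing cells of dimension [n] gives surjectivity on homotopy groups of dimension
    [n], and on the prism over a cell, whose boundary carries two maps and whose interior
    a homotopy of their images, it gives injectivity. *)
Theorem compression_weak_equivalence (x0 : X) : continuous f ->
  (forall n, compresses (@dcube R n)) -> weak_homotopy_equivalence R f.
Proof.
move=> cf h.
have hp n (c : cube R n * I -> X) (b : cube R n * I -> Y) :
    {within @prism R _ (@dcube R n), continuous c} -> continuous b ->
    (forall d, prism (@dcube R n) d -> f (c d) = b d) ->
    exists c' : cube R n * I -> X, continuous c' /\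
      forall d, prism (@dcube R n) d -> c' d = c d.
  move=> cc cb cbE.
  have [||v|c' [cc' c'A _]] := h (n + 1)%N (fun v => c (cube_to_prism v))
      (fun v => b (cube_to_prism v)).
  - apply: within_precomp cc _ (@prism_cube_to_prism R n).
    apply: continuous_within; exact: cube_to_prism_continuous.
  - exact: comp_continuous (@cube_to_prism_continuous R n) cb.
  - by move=> /prism_cube_to_prism; exact: cbE.
  exists (fun w => c' (prism_to_cube w)); split.
    exact: comp_continuous (@prism_to_cube_continuous R n) cc'.
  by move=> d /dcube_prism_to_cube hd; rewrite c'A // prism_to_cubeK.
split => //; first split.
- move=> x x' [p [cp p0 p1]].
  pose c (w : cube R 0 * I) := if `[< w.2 = ui0 R >] then x else x'.
  have d0 (v : cube R 0) : ~ dcube v by case=> -[].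
  have c1 v : c (v, ui1 R) = x' by rewrite /c asboolF //; apply/nesym; exact: ui01.
  have [|||e [ce eE]] := hp 0%N c (fun w => p w.2).
  + apply: (within_sub (A := [set w | w.2 = ui0 R] `|` [set w | w.2 = ui1 R])).
      by move=> w [/d0|].
    apply: withinU_continuous.
    * exact: closed_preimage (@snd_continuous _ I) (@closed_ui0 R).
    * exact: closed_preimage (@snd_continuous _ I) (@closed_ui1 R).
    * apply: (within_eq (f := fun=> x)); first by move=> w h0; rewrite /c asboolT.
      by apply: continuous_within; exact: cst_continuous.
    * apply: (within_eq (f := fun=> x')).
        by move=> [v s] /= ->; rewrite c1.
      by apply: continuous_within; exact: cst_continuous.
  + exact: comp_continuous (@snd_continuous _ _) cp.
  + move=> [v s] [/d0//|/= [->|->]]; first by rewrite /c asboolT // p0.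
    by rewrite c1 p1.
  exists (fun t => e (corner R 0, t)); split.
  + apply: comp_continuous ce.
    by apply: pair_continuous; [exact: cst_continuous|exact: id_continuous].
  + by rewrite eE; [rewrite /c asboolT|right; left].
  + by rewrite eE; [rewrite c1|right; right].
- move=> y.
  have [|||c [cc _ [k [ck k0 k1 _]]]] := h 0%N (fun=> x0) (fun=> y).
  + by apply: continuous_within; exact: cst_continuous.
  + exact: cst_continuous.
  + by move=> d [[]].
  exists (c (corner R 0)), (fun t => k (corner R 0, t)); split.
  + apply: comp_continuous ck.
    by apply: pair_continuous; [exact: cst_continuous|exact: id_continuous].
  + by rewrite k0.
  + by rewrite k1.
move=> n x n0; split; last first.
  move=> b [cb bx].
  have [|//||a [ca ax ab]] := h n (fun=> x) b.
  - by apply: continuous_within; exact: cst_continuous.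
  - by move=> d /bx.
  by exists a; split.
move=> a b [ca ax] [cb bx] [k [ck k0 k1 kd]].
pose c (w : cube R n * I) := if `[< w.2 = ui0 R >] then a w.1 else
  if `[< w.2 = ui1 R >] then b w.1 else x.
have c0 v : c (v, ui0 R) = a v by rewrite /c asboolT.
have c1 v : c (v, ui1 R) = b v.
  by rewrite /c asboolF ?asboolT //; apply/nesym; exact: ui01.
have cd v t : dcube v -> c (v, t) = x.
  by move=> dv; rewrite /c /= ax // bx //; case: ifP => // _; case: ifP.
have [|d|e [ce eE]] := hp n c k _ ck.
- apply: (withinU_continuous (A := [set w | dcube w.1])
    (B := [set w | w.2 = ui0 R \/ w.2 = ui1 R])).
  + exact: closed_preimage (@fst_continuous _ I) (@closed_dcube R n).
  + apply: (@closedU _ [set w : cube R n * I | w.2 = ui0 R] [set w | w.2 = ui1 R]).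
      exact: closed_preimage (@snd_continuous _ I) (@closed_ui0 R).
    exact: closed_preimage (@snd_continuous _ I) (@closed_ui1 R).
  + apply: (within_eq (f := fun=> x)); first by move=> [v t] /cd ->.
    by apply: continuous_within; exact: cst_continuous.
  + apply: (withinU_continuous (A := [set w : cube R n * I | w.2 = ui0 R])
      (B := [set w | w.2 = ui1 R])).
    * exact: closed_preimage (@snd_continuous _ I) (@closed_ui0 R).
    * exact: closed_preimage (@snd_continuous _ I) (@closed_ui1 R).
    * apply: (within_eq (f := fun w => a w.1)).
        by move=> [v t] /= ->; rewrite c0.
      by apply: continuous_within; exact: comp_continuous (@fst_continuous _ _) ca.
    * apply: (within_eq (f := fun w => b w.1)).
        by move=> [v t] /= ->; rewrite c1.
      by apply: continuous_within; exact: comp_continuous (@fst_continuous _ _) cb.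
- move: d => [v t] [/= dv|/= [->|->]].
  + by rewrite cd // kd //= ax.
  + by rewrite c0 k0.
  + by rewrite c1 k1.
exists e; split=> [//|v|v|v t dv].
- by rewrite eE; [rewrite c0|right; left].
- by rewrite eE; [rewrite c1|right; right].
- by rewrite eE; [rewrite cd // ax|left].
Qed.

End compression.

Section trivial_fibration.
Variables (R : realType) (E F : topologicalType) (p : E -> F).
Local Notation I := (unit_interval R).
Hypotheses (cp : continuous p) (pl : forall n, lifts (@dcube R n) p).

Lemma lifts_prism n : lifts (@prism R _ (@dcube R n)) p.
Proof.
refine (lifts_retract (@prism_to_cube_continuous R n) (@cube_to_prism_continuous R n)
  (@prism_to_cubeK R n) _ (@prism_cube_to_prism R n) (@pl (n + 1))).
by move=> w h; apply/dcube_prism_to_cube.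
Qed.

(** The lid is attached along its boundary, then the interior. *)
Lemma lifts_cylinder n : lifts (@cylinder R _ (@dcube R n)) p.
Proof.
pose lid (v : cube R n) := (v, ui1 R).
have clid : continuous lid.
  by apply: pair_continuous; [exact: id_continuous|exact: cst_continuous].
have rlid : range lid = [set w | w.2 = ui1 R].
  by apply/seteqP; split=> [_ [v _ <-] //|[v t] /= ->]; exists v.
apply: (@lifts_attach _ (cube R n) _ lid fst).
- exact: closed_cylinder (@closed_dcube R n).
- rewrite rlid; exact: closed_preimage (@snd_continuous _ _) (@closed_ui1 R).
- exact: clid.
- exact: fst_continuous.
- by [].
- rewrite (_ : _ @^-1` _ = @dcube R n); first exact: pl.
  by apply/seteqP; split=> v; [case=> [/esym/ui01|]|right].
- rewrite rlid (_ : _ `|` _ = prism (@dcube R n)); first exact: lifts_prism.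
  apply/seteqP; split=> w.
    by case=> [[]|]; [right; left|left|right; right].
  by case=> [|[]]; [left; right|left; left|right].
Qed.

Let enorm n (u : 'rV[R]_n) : R := Num.sqrt (\sum_i u 0 i ^+ 2).

Let enorm_continuous n : continuous (@enorm n).
Proof. exact: comp_continuous (@sum_sqr_continuous R n) (@sqrt_continuous R). Qed.

(** The disk is placed inside the cube at a distance from its boundary, which leaves room
    for pressing down the walls. *)
Let inner n (v : disk R n) : cube R n :=
  clampC (\row_i (((set_val v : 'rV[R]_n) 0 i + 2) / 4)).

Let outer n (v : cube R n) : 'rV[R]_n := \row_i (4 * cval v 0 i - 2).

Let disk_coord n (v : disk R n) i : -1 <= (set_val v : 'rV[R]_n) 0 i <= 1.
Proof.
rewrite -ler_norml -(@expr_le1 _ 2) // real_normK ?num_real //.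
apply: le_trans (set_valP v); rewrite /disk (bigD1 i) //= lerDl.
by apply: sumr_ge0 => j _; exact: sqr_ge0.
Qed.

Let outer_inner n (v : disk R n) : outer (inner v) = set_val v.
Proof.
apply/rowP => i; rewrite mxE cval_clampC mxE; last by have := disk_coord v i; lra.
by field.
Qed.

Let sum_sqr_ge0 n (u : 'rV[R]_n) : 0 <= \sum_i u 0 i ^+ 2.
Proof. by apply: sumr_ge0 => j _; exact: sqr_ge0. Qed.

Let to_disk_subproof n (u : 'rV[R]_n) :
  disk R n (\row_i (u 0 i / Num.max 1 (enorm u))).
Proof.
rewrite /disk /=.
under eq_bigr do rewrite mxE expr_div_n.
rewrite -mulr_suml ler_pdivrMr; last by rewrite exprn_gt0 // lt_max ltr01.
rewrite mul1r -[X in X <= _](sqr_sqrtr (sum_sqr_ge0 u)).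
rewrite ler_sqr ?nnegrE ?sqrtr_ge0 ?le_max ?ler01 //.
by rewrite lexx orbT.
Qed.

Let to_disk n (u : 'rV[R]_n) : disk R n :=
  exist _ (\row_i (u 0 i / Num.max 1 (enorm u))) (mem_set (to_disk_subproof u)).

Let to_diskK n (v : disk R n) : to_disk (set_val v) = v.
Proof.
apply: val_inj; apply/rowP => i; rewrite /= mxE.
rewrite (max_idPl _) ?divr1 // -[X in _ <= X]sqrtr1 ler_sqrt ?ltr01 //.
exact: (set_valP v).
Qed.

Let inner_continuous n : continuous (@inner n).
Proof.
apply: clampC_continuous => i; under eq_fun do rewrite mxE.
apply: mulR_continuous; last exact: cst_continuous.
apply: addR_continuous; last exact: cst_continuous.
exact: comp_continuous (@set_val_continuous _ _) (@coord_continuous R 1 n 0 i).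
Qed.

Let outer_continuous n : continuous (@outer n).
Proof.
apply: rV_continuous => i; under eq_fun do rewrite mxE.
apply: addR_continuous; last exact: cst_continuous.
apply: mulR_continuous; first exact: cst_continuous.
by apply: ccoord_continuous; exact: id_continuous.
Qed.

Let to_disk_continuous n : continuous (@to_disk n).
Proof.
apply: continuous_into_set; apply: rV_continuous => i /=.
under eq_fun do rewrite mxE.
apply: mulR_continuous; first exact: coord_continuous.
apply: invR_continuous => [|u]; last by rewrite gt_eqF // lt_max ltr01.
apply: maxR_continuous; first exact: cst_continuous.
exact: enorm_continuous.
Qed.

Let outer_boundary n (v : cube R n) : dcube v -> 2 <= enorm (outer v).
Proof.
move=> [i h]; have -> : 2 = Num.sqrt (2 ^+ 2) :> R.
  by rewrite sqrtr_sqr ger0_norm // ler0n.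
apply: ler_wsqrtr; rewrite (bigD1 i) //= mxE /cval.
apply: (@le_trans _ _ ((4 * (set_val v : 'rV[R]_n) 0 i - 2) ^+ 2)).
  by case: h => ->; lra.
by rewrite lerDl; apply: sumr_ge0 => j _; exact: sqr_ge0.
Qed.

(** The bottom of the cylinder over the disk is a retract of the bottom and the walls of
    the cylinder over the cube: the walls are pressed down to the bottom. *)
Lemma lifts_disk_bottom n : lifts [set w : disk R n * I | w.2 = ui0 R] p.
Proof.
pose h (w : cube R n * I) := ival w.2 * Num.min 1 (2 - enorm (outer w.1)).
pose s (w : disk R n * I) := (inner w.1, w.2).
pose r (w : cube R n * I) := (to_disk (outer w.1), clampI (h w)).
have co : continuous (fun w : cube R n * I => outer w.1).
  exact: comp_continuous (@fst_continuous _ _) (@outer_continuous n).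
apply: (lifts_retract (s := s) (r := r) _ _ _ _ _ (@lifts_cylinder n)).
- apply: pair_continuous; last exact: snd_continuous.
  exact: comp_continuous (@fst_continuous _ _) (@inner_continuous n).
- apply: pair_continuous; first exact: comp_continuous co (@to_disk_continuous n).
  apply: clampI_continuous; apply: mulR_continuous.
    by apply: ival_comp_continuous; exact: snd_continuous.
  apply: minR_continuous; first exact: cst_continuous.
  apply: addR_continuous; first exact: cst_continuous.
  by apply: oppR_continuous; exact: comp_continuous co (@enorm_continuous n).
- move=> [v t]; rewrite /r /s /h /= outer_inner to_diskK (min_idPl _).
    by rewrite mulr1 ival_clampIK.
  have : enorm (set_val v) <= 1; last by lra.
  by rewrite -[X in _ <= X]sqrtr1 ler_sqrt ?ltr01 //; exact: (set_valP v).
- by move=> w h0; left.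
- move=> [v t] [/= ->|/= dv]; rewrite clampI_le0 // /h /= ?ival0 ?mul0r //.
  rewrite mulr_ge0_le0 ?ival_ge0 // ge_min; apply/orP; right.
  by have := outer_boundary dv; lra.
Qed.

Theorem lifts_serre_fibration : serre_fibration R p.
Proof.
split => // n a b ca cb ab.
have [|w|l [cl la lb]] := @lifts_disk_bottom n (fun w => a w.1) b _ cb.
- by apply: continuous_within; exact: comp_continuous (@fst_continuous _ _) ca.
- by case: w => v t /= ->; exact: ab.
by exists l; split => // v; rewrite la.
Qed.

End trivial_fibration.

(** * Families of cells *)

Section cell_families.
Variables (R : realType) (X Y : topologicalType) (f : X -> Y).
Local Notation I := (unit_interval R).
Hypothesis (wf : weak_homotopy_equivalence R f).

Let cf : continuous f. Proof. by case: wf. Qed.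

(** The lifting property for families of cells indexed by [Z], that is, for cells of the
    space of maps from [Z]. *)
Definition family_lifts (Z : topologicalType) : Prop :=
  forall n, lifts ([set: Z] `*` @dcube R n) (@path_end R X Y f).

Definition contracts_to (Z : topologicalType) (z0 : Z) (k : Z * I -> Z) : Prop :=
  [/\ continuous k, forall z, k (z, ui0 R) = z & forall z, k (z, ui1 R) = z0].

(** A family of lifting problems over a contractible space deforms to a constant one. *)
Lemma contractible_family_lifts (Z : topologicalType) (z0 : Z) (k : Z * I -> Z) :
  contracts_to z0 k -> family_lifts Z.
Proof.
move=> [ck k0 k1] n c b cc cb cbE.
pose g (w : (Z * cube R n) * I) := (k (w.1.1, w.2), w.1.2).
have c1 : continuous (fun w : (Z * cube R n) * I => w.1) by exact: fst_continuous.
have cg : continuous g.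
  apply: pair_continuous; last exact: comp_continuous c1 (@snd_continuous _ _).
  apply: comp_continuous ck; apply: pair_continuous; last exact: snd_continuous.
  exact: comp_continuous c1 (@fst_continuous _ _).
have [||||e [ce eA eb]] := solution_transport cf (closed_setX (@closed_dcube R n))
  (extends_homotopies_setX _ (@cube_extends_homotopies R n))
  (@setX_prism_extends_homotopies R Z n) (C := fun w => c (g w)) (B := fun w => b (g w)).
- apply: within_precomp cc (continuous_within cg) _.
  by move=> [[z v] t] [_ h]; split.
- exact: comp_continuous cg cb.
- by move=> [z v] t [_ h]; apply: cbE.
- have [|||e [ce eA eb]] := weak_equivalence_lifts wf (n := n)
    (c := fun v => c (z0, v)) (b := fun v => b (z0, v)).
  + apply: within_precomp cc _ _ => //; apply: continuous_within.
    by apply: pair_continuous; [exact: cst_continuous|exact: id_continuous].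
  + apply: comp_continuous cb.
    by apply: pair_continuous; [exact: cst_continuous|exact: id_continuous].
  + by move=> v dv; apply: cbE.
  exists (fun w => e w.2); split.
  + exact: comp_continuous (@snd_continuous _ _) ce.
  + by move=> [z v] [_ /= h]; rewrite /g /= k1 eA.
  + by move=> [z v]; rewrite /g /= k1 eb.
by exists e; split=> // [[z v] h|[z v]]; [rewrite eA|rewrite eb]; rewrite // /g /= k0.
Qed.

Lemma cube_contraction n : contracts_to (corner R n) (@scaleC R n).
Proof.
split; [exact: scaleC_continuous|exact: scaleC0|exact: scaleC1].
Qed.

Lemma disk0_subproof n : disk R n 0.
Proof. by rewrite /disk /=; under eq_bigr do rewrite mxE expr0n; rewrite sumr_const mul0rn. Qed.

Definition disk0 n : disk R n := exist _ 0 (mem_set (disk0_subproof n)).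

Lemma scale_disk_subproof n (w : disk R n * I) :
  disk R n ((1 - ival w.2) *: (set_val w.1 : 'rV[R]_n)).
Proof.
rewrite /disk /=; under eq_bigr do rewrite mxE exprMn.
rewrite -mulr_sumr; have := set_valP w.1; rewrite /disk /= => h.
have := ivalP w.2 => t; apply: le_trans (h).
rewrite -[X in _ <= X]mul1r ler_wpM2r //.
  by apply: sumr_ge0 => j _; exact: sqr_ge0.
by rewrite expr_le1 //; lra.
Qed.

Definition scale_disk n (w : disk R n * I) : disk R n :=
  exist _ ((1 - ival w.2) *: (set_val w.1 : 'rV[R]_n)) (mem_set (scale_disk_subproof w)).

Lemma disk_contraction n : contracts_to (disk0 n) (@scale_disk n).
Proof.
split.
- apply: continuous_into_set; apply: rV_continuous => i /=.
  under eq_fun do rewrite mxE.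
  apply: mulR_continuous.
    apply: addR_continuous; first exact: cst_continuous.
    by apply: oppR_continuous; apply: ival_comp_continuous; exact: snd_continuous.
  apply: comp_continuous (@coord_continuous R 1 n 0 i).
  exact: comp_continuous (@fst_continuous _ _) (@set_val_continuous _ _).
- by move=> v; apply: val_inj; rewrite /= ival0 subr0 scale1r.
- by move=> v; apply: val_inj; rewrite /= ival1 subrr scale0r.
Qed.

Lemma cylinder_contraction (Z : topologicalType) (z0 : Z) (k : Z * I -> Z) :
  contracts_to z0 k -> contracts_to (z0, ui0 R)
    (fun w : (Z * I) * I => (k (w.1.1, w.2), shorten_time w.1.2 w.2)).
Proof.
move=> [ck k0 k1]; split.
- have c1 : continuous (fun w : (Z * I) * I => w.1) by exact: fst_continuous.
  apply: pair_continuous.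
    apply: comp_continuous ck; apply: pair_continuous; last exact: snd_continuous.
    exact: comp_continuous c1 (@fst_continuous _ _).
  apply: shorten_time_continuous; last exact: snd_continuous.
  exact: comp_continuous c1 (@snd_continuous _ _).
- by move=> [z t]; rewrite /= k0 shorten_time0.
- by move=> [z t]; rewrite /= k1 shorten_time1.
Qed.

Lemma disk_family_lifts n : family_lifts (disk R n).
Proof. exact: contractible_family_lifts (disk_contraction n). Qed.

Lemma disk_cylinder_family_lifts n : family_lifts (disk R n * I)%type.
Proof. exact: contractible_family_lifts (cylinder_contraction (disk_contraction n)). Qed.

(** The sphere is the union of two cubes along their boundaries: it is the radial image of
    the sphere of the norm [|y| + |z|_oo], whose two halves are graphs over a cube. *)
Section sphere.
Variable k : nat.

Definition ray (e : R) (v : cube R k) : 'rV[R]_(1 + k) :=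
  row_mx (\row_(i < 1) (e * (1 - `|centred v|))) (centred v).

Definition sqsum (x : 'rV[R]_(1 + k)) : R := \sum_i x 0 i ^+ 2.

Lemma sqsum_split x : sqsum x = x 0 (lshift k 0) ^+ 2 + \sum_(i < k) x 0 (rshift 1 i) ^+ 2.
Proof. by rewrite /sqsum big_split_ord /= big_ord1. Qed.

Lemma sqsum_gt0 (e : R) v : e ^+ 2 = 1 -> 0 < sqsum (ray e v).
Proof.
move=> e1; rewrite sqsum_split row_mxEl mxE exprMn e1 mul1r.
under eq_bigr do rewrite row_mxEr.
have s0 : 0 <= \sum_(i < k) centred v 0 i ^+ 2.
  by apply: sumr_ge0 => i _; exact: sqr_ge0.
have [h|h] := eqVneq `|centred v| 0.
  by rewrite h subr0 expr1n; apply: ltr_wpDr.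
have [i hi] := norm_attained h; apply: ltr_wpDl; first exact: sqr_ge0.
apply: (@lt_le_trans _ _ (centred v 0 i ^+ 2)).
  by rewrite -real_normK ?num_real // -hi exprn_gt0 // lt_neqAle eq_sym h normr_ge0.
by rewrite (bigD1 i) //= lerDl; apply: sumr_ge0 => j _; exact: sqr_ge0.
Qed.

Lemma hemisphere_subproof (e : R) (e1 : e ^+ 2 = 1) (v : cube R k) :
  sphere R (1 + k) ((Num.sqrt (sqsum (ray e v)))^-1 *: ray e v).
Proof.
rewrite /sphere /=; under eq_bigr do rewrite mxE exprMn exprVn.
have h := sqsum_gt0 v e1; rewrite sqr_sqrtr ?ltW //.
by rewrite -mulr_sumr mulVf // gt_eqF.
Qed.

Definition hemisphere (e : R) (e1 : e ^+ 2 = 1) (v : cube R k) : sphere R (1 + k) :=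
  exist _ ((Num.sqrt (sqsum (ray e v)))^-1 *: ray e v)
    (mem_set (hemisphere_subproof e1 v)).

Definition height (x : sphere R (1 + k)) : R := (set_val x : 'rV[R]_(1 + k)) 0 (lshift k 0).
Definition base (x : sphere R (1 + k)) : 'rV[R]_k :=
  rsubmx (set_val x : 'rV[R]_(1 + k)).
(** The norm whose unit sphere is the union of the two graphs. *)
Definition girth (x : sphere R (1 + k)) : R := `|base x| + `|height x|.

Lemma girth_gt0 x : 0 < girth x.
Proof.
rewrite lt_neqAle eq_sym addr_ge0 // andbT; apply/negP => /eqP.
move/eqP; rewrite paddr_eq0 // => /andP[/eqP b0 /eqP h0].
have : sqsum (set_val x : 'rV[R]_(1 + k)) = 1 by exact: (set_valP x).
rewrite sqsum_split big1 => [|i _].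
  have hx : height x = 0 by apply/eqP; rewrite -normr_eq0 h0.
  by move/eqP; rewrite -/(height x) hx expr0n addr0 eq_sym oner_eq0.
by have := coord_le_norm (base x) i; rewrite b0 normr_le0 mxE => /eqP ->; rewrite expr0n.
Qed.

Definition flatten_sphere (x : sphere R (1 + k)) : cube R k :=
  clampC (\row_i ((base x 0 i / girth x + 1) / 2)).

Lemma centred_flatten x i : centred (flatten_sphere x) 0 i = base x 0 i / girth x.
Proof.
have h : -1 <= base x 0 i / girth x <= 1.
  rewrite -ler_norml normrM normfV (gtr0_norm (girth_gt0 x)) ler_pdivrMr ?girth_gt0 //.
  rewrite mul1r; apply: le_trans (coord_le_norm _ i) _.
  by rewrite /girth lerDl.
rewrite mxE cval_clampC mxE; last by move: h; set q := _ / girth x; lra.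
by set q := _ / girth x; field.
Qed.

Lemma centred_flattenE x : centred (flatten_sphere x) = (girth x)^-1 *: base x.
Proof. by apply/rowP => i; rewrite centred_flatten [RHS]mxE mulrC. Qed.

Lemma norm_centred_flatten x : `|centred (flatten_sphere x)| = `|base x| / girth x.
Proof.
by rewrite centred_flattenE normrZ normfV (gtr0_norm (girth_gt0 x)) mulrC.
Qed.

Lemma centred_inj n : injective (@centred R n).
Proof.
move=> v w h; apply: cube_eq => i.
by have := congr1 (fun u : 'rV[R]_n => u 0 i) h; rewrite !mxE; lra.
Qed.

Section hemi.
Variables (e : R) (e1 : e ^+ 2 = 1).

Let e_norm : `|e| = 1.
Proof. by apply/eqP; rewrite -(@pexpr_eq1 _ _ 2) // real_normK ?num_real ?e1. Qed.

Let rho v := Num.sqrt (sqsum (ray e v)).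

Let rho_gt0 v : 0 < rho v.
Proof. by rewrite sqrtr_gt0 sqsum_gt0. Qed.

Lemma height_hemisphere v : height (hemisphere e1 v) = (rho v)^-1 * (e * (1 - `|centred v|)).
Proof. by rewrite /height set_valE /= mxE row_mxEl mxE. Qed.

Lemma base_hemisphere v : base (hemisphere e1 v) = (rho v)^-1 *: centred v.
Proof.
by apply/rowP => i; rewrite [RHS]mxE /base mxE set_valE /= mxE row_mxEr.
Qed.

Lemma hemisphereK : cancel (hemisphere e1) flatten_sphere.
Proof.
move=> v; apply: centred_inj; rewrite centred_flattenE.
have -> : girth (hemisphere e1 v) = (rho v)^-1.
  rewrite /girth base_hemisphere height_hemisphere normrZ !normrM e_norm mul1r.
  have v1 := norm_centred_le1 v.
  rewrite (ger0_norm (x := 1 - _)) ?subr_ge0 // (gtr0_norm (x := _^-1)) ?invr_gt0 //.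
  by ring.
by rewrite base_hemisphere scalerA invrK divff ?scale1r // gt_eqF.
Qed.

Lemma range_hemisphere x : 0 <= e * height x -> hemisphere e1 (flatten_sphere x) = x.
Proof.
move=> ex; set v := flatten_sphere x.
have rE : ray e v = (girth x)^-1 *: (set_val x : 'rV[R]_(1 + k)).
  apply/rowP => i; case: (split_ordP i) => j ->.
    rewrite row_mxEl !mxE (ord1 j) norm_centred_flatten -/(height x).
    have g0 := girth_gt0 x; have gN : girth x != 0 by rewrite gt_eqF.
    have -> : 1 - `|base x| / girth x = `|height x| / girth x.
      by rewrite -[X in X - _](divff gN) -mulrBl {1}/girth; congr (_ / _); ring.
    rewrite mulrA mulrC; congr (_ * _).
    rewrite -[RHS]mul1r -e1 expr2 -mulrA -[e * height x]ger0_norm // normrM e_norm.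
    by rewrite mul1r.
  by rewrite row_mxEr centred_flatten !mxE mulrC.
apply: val_inj; rewrite /= rE.
have -> : sqsum ((girth x)^-1 *: (set_val x : 'rV[R]_(1 + k))) = (girth x)^-1 ^+ 2.
  rewrite /sqsum; under eq_bigr do rewrite mxE exprMn.
  by rewrite -mulr_sumr; have := set_valP x; rewrite /sphere /= => ->; rewrite mulr1.
rewrite sqrtr_sqr ger0_norm ?invr_ge0 ?ltW ?girth_gt0 //.
by rewrite scalerA invrK divff ?scale1r // gt_eqF // girth_gt0.
Qed.

Lemma hemisphere_height v : 0 <= e * height (hemisphere e1 v).
Proof.
rewrite height_hemisphere mulrCA mulr_ge0 ?invr_ge0 ?sqrtr_ge0 //.
by rewrite mulrA -expr2 e1 mul1r subr_ge0 norm_centred_le1.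
Qed.

Lemma dcube_hemisphere v : dcube v <-> height (hemisphere e1 v) = 0.
Proof.
rewrite dcubeE height_hemisphere; split=> [->|/eqP]; first by rewrite subrr !mulr0.
rewrite !mulf_eq0 invr_eq0 (gt_eqF (rho_gt0 v)) /= -normr_eq0 e_norm oner_eq0 /=.
by rewrite subr_eq0 => /eqP.
Qed.

Lemma hemisphere_continuous : continuous (hemisphere e1).
Proof.
have cr i : continuous (fun v => ray e v 0 i).
  case: (split_ordP i) => j ->.
    under eq_fun do rewrite row_mxEl mxE.
    apply: mulR_continuous; first exact: cst_continuous.
    apply: addR_continuous; first exact: cst_continuous.
    apply: oppR_continuous.
    exact: comp_continuous (@centred_continuous R k) (@norm_continuous _ _).
  under eq_fun do rewrite row_mxEr.
  exact: comp_continuous (@centred_continuous R k) (@coord_continuous R 1 k 0 j).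
apply: continuous_into_set; apply: rV_continuous => i /=.
under eq_fun do rewrite mxE.
apply: mulR_continuous => //; apply: invR_continuous; last first.
  by move=> v; rewrite gt_eqF // rho_gt0.
apply: comp_continuous (@sqrt_continuous R).
apply: (comp_continuous (rV_continuous cr)).
exact: (@sum_sqr_continuous R (1 + k)).
Qed.

End hemi.

Lemma flatten_sphere_continuous : continuous flatten_sphere.
Proof.
have cc i : continuous (fun x : sphere R (1 + k) => (set_val x : 'rV[R]_(1 + k)) 0 i).
  exact: comp_continuous (@set_val_continuous _ _) (@coord_continuous R 1 _ 0 i).
have cb i : continuous (fun x => base x 0 i).
  by under eq_fun do rewrite mxE; exact: cc.
apply: clampC_continuous => i; under eq_fun do rewrite mxE.
apply: mulR_continuous; last exact: cst_continuous.
apply: addR_continuous; last exact: cst_continuous.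
apply: mulR_continuous => //; apply: invR_continuous; last first.
  by move=> x; rewrite gt_eqF // girth_gt0.
apply: addR_continuous.
  have cbase : continuous base by exact: rV_continuous.
  exact: comp_continuous cbase (@norm_continuous _ _).
by apply: absR_continuous; exact: cc.
Qed.

(** The lower half is contractible, and the upper half is then a family of cells. *)
Lemma sphere_pos_family_lifts : family_lifts (sphere R (1 + k)).
Proof.
move=> n.
pose lift_map e (e1 : e ^+ 2 = 1) (w : cube R k * cube R n) := (hemisphere e1 w.1, w.2).
pose drop (w : sphere R (1 + k) * cube R n) := (flatten_sphere w.1, w.2).
have clm e (e1 : e ^+ 2 = 1) : continuous (lift_map e e1).
  apply: pair_continuous; last exact: snd_continuous.
  exact: comp_continuous (@fst_continuous _ _) (@hemisphere_continuous e e1).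
have cd : continuous drop.
  apply: pair_continuous; last exact: snd_continuous.
  exact: comp_continuous (@fst_continuous _ _) flatten_sphere_continuous.
have lmK e (e1 : e ^+ 2 = 1) : cancel (lift_map e e1) drop.
  by move=> [v w]; rewrite /drop /= hemisphereK.
have clr e (e1 : e ^+ 2 = 1) : closed (range (lift_map e e1)).
  have [_ hD] := compact_hausdorff_prod (sphere_compact_hausdorff R (1 + k))
    (cube_compact_hausdorff R n).
  have [cC _] := compact_hausdorff_prod (cube_compact_hausdorff R k)
    (cube_compact_hausdorff R n).
  apply: compact_closed => //; apply: continuous_compact cC.
  by apply: continuous_subspaceT; exact: clm.
have p1 : (1 : R) ^+ 2 = 1 by rewrite expr1n.
have m1 : (-1 : R) ^+ 2 = 1 by rewrite sqrrN expr1n.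
have clA : closed ([set: sphere R (1 + k)] `*` @dcube R n).
  exact: closed_setX (@closed_dcube R n).
have rangeE e (e1 : e ^+ 2 = 1) x w : range (lift_map e e1) (x, w) <-> 0 <= e * height x.
  split=> [[[v w'] _ [<- _]]|h]; first exact: hemisphere_height.
  by exists (flatten_sphere x, w) => //=; rewrite /lift_map /= range_hemisphere.
apply: (@lifts_attach _ _ _ (lift_map _ m1) drop) => //.
  rewrite (_ : _ @^-1` _ = [set: cube R k] `*` @dcube R n).
    exact: contractible_family_lifts (cube_contraction k) n.
  by apply/seteqP; split.
apply: (@lifts_attach _ _ _ (lift_map _ p1) drop) => //.
- exact: closedU.
- apply: (lifts_retract (@cube_cat_continuous R k n)
    (pair_continuous (@cube_left_continuous R k n) (@cube_right_continuous R k n))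
    _ _ _ (weak_equivalence_lifts wf (n := k + n))).
  + by move=> w; rewrite cube_left_cat cube_right_cat -surjective_pairing.
  + move=> [v w] [[_ h]|/rangeE h]; apply/dcube_cat; first by right.
    left; apply/(dcube_hemisphere p1); apply/eqP; rewrite eq_le.
    have := hemisphere_height p1 v; rewrite mul1r => ->; rewrite andbT.
    by move: h; rewrite mulN1r oppr_ge0.
  + move=> v; rewrite -{1}(cube_splitK v) => /dcube_cat[/= h|/= h]; last by left.
    by right; apply/rangeE; move/(dcube_hemisphere p1) : h => ->; rewrite mulr0.
- rewrite (_ : _ `|` _ = setT); first exact: lifts_total.
  apply/seteqP; split=> // -[x w] _.
  have [h|h] := leP 0 (height x).
    by right; apply/rangeE; rewrite mul1r.
  by left; right; apply/rangeE; rewrite mulN1r oppr_ge0 ltW.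
Qed.

End sphere.

Lemma sphere_family_lifts n : family_lifts (sphere R n).
Proof.
case: n => [|k]; last exact: (@sphere_pos_family_lifts k).
have no (v : sphere R 0) : False.
  by have := set_valP v; rewrite /sphere /= big_ord0 => /eqP; rewrite eq_sym oner_eq0.
move=> n c b cc cb cbE; exists c; split=> // [] [v w]; have [] := no v.
Qed.

End cell_families.

(** * Points of mapping spaces *)

Section map_points.
Variables (G : compactGroupType).
Implicit Types (A B X Y : gspace G).

Definition mev A X (u : Map A X) (a : A) : X := (u : Defs.pmap A X) a.

Lemma mev_eq A X (u v : Map A X) : mev u =1 mev v -> u = v.
Proof. by move=> h; apply: pmap_eq. Qed.

(** The exponential law on compact Hausdorff parameter spaces.  All mapping spaces below
    are handled through their points with such parameters, which suffices because cubes,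
    their boundaries and homotopies on them are of this kind. *)
Lemma map_points A X (T : topologicalType) (u : T -> Map A X) :
  compact_hausdorff T ->
  continuous u <-> continuous (fun w : T * A => mev (u w.1) w.2).
Proof.
move=> hT; split=> cu.
  apply: k_space_continuous; first exact: k_space_prod_compact hT (gs_cg A).1.
  move=> C w hC cw.
  have c1 : continuous (fun c => (w c).1) by exact: comp_continuous cw (@fst_continuous _ _).
  have c2 : continuous (fun c => (w c).2) by exact: comp_continuous cw (@snd_continuous _ _).
  apply: (comp_continuous (f := fun c => (c, c)) _
    (map_car_eval_continuous hC hC (comp_continuous c1 cu) c2)).
  by apply: pair_continuous; exact: id_continuous.
apply: map_car_test_continuous => // C w hC cw.
apply: (comp_continuous (f := fun tc : T * C => (tc.1, w tc.2)) _ cu).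
apply: pair_continuous; first exact: fst_continuous.
exact: comp_continuous (@snd_continuous _ _) cw.
Qed.

Lemma map_points_diag A X (T : topologicalType) (u : T -> Map A X) (a : T -> A) :
  compact_hausdorff T -> continuous u -> continuous a ->
  continuous (fun t => mev (u t) (a t)).
Proof.
move=> hT /(map_points _ hT) cu ca.
by apply: (comp_continuous (f := fun t => (t, a t)) _ cu);
  apply: pair_continuous => //; exact: id_continuous.
Qed.

Lemma map_k_points A X (T : topologicalType) (u : T -> Map A X) :
  k_space T ->
  (forall (C : topologicalType) (t : C -> T) (a : C -> A), compact_hausdorff C ->
     continuous t -> continuous a -> continuous (fun c => mev (u (t c)) (a c))) ->
  continuous u.
Proof.
move=> kT h; apply: k_space_continuous => // C t hC ct.
apply: map_car_test_continuous => // D a hD ca.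
apply: (h _ (fun cd : C * D => t cd.1) (fun cd : C * D => a cd.2)).
- exact: compact_hausdorff_prod.
- exact: comp_continuous (@fst_continuous _ _) ct.
- exact: comp_continuous (@snd_continuous _ _) ca.
Qed.

Section fixed.
Variable H : set G.

Definition fev A X (u : fixed_points H (Map A X)) (a : A) : X := mev (set_val u) a.

Lemma fev_eq A X (u v : fixed_points H (Map A X)) : fev u =1 fev v -> u = v.
Proof. by move=> h; apply: val_inj; exact: mev_eq. Qed.

Lemma fev_continuous A X (u : fixed_points H (Map A X)) : continuous (fev u).
Proof. exact: pm_continuous. Qed.

Lemma fev_pt A X (u : fixed_points H (Map A X)) : fev u (gs_pt A) = gs_pt X.
Proof. exact: pm_pt. Qed.

Lemma fev_act A X (u : fixed_points H (Map A X)) h a : H h ->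
  fev u (gs_act h a) = gs_act h (fev u a).
Proof.
move=> Hh.
have E : gs_act h (fev u (gs_act h^-1%g (gs_act h a))) = fev u (gs_act h a).
  have e : gs_act h (set_val u) = set_val u := set_valP u h Hh.
  exact: (congr1 (fun v : Map A X => mev v (gs_act h a)) e).
by rewrite -E -gs_actM mulVg gs_act1.
Qed.

Section construct.
Variables (A X : gspace G) (k : A -> X) (ck : continuous k)
  (kpt : k (gs_pt A) = gs_pt X)
  (kact : forall h a, H h -> k (gs_act h a) = gs_act h (k a)).

Lemma mk_fixed_subproof : fixed_points H (Map A X) (PMap ck kpt).
Proof.
by move=> h Hh; apply: pmap_eq => a /=; rewrite -kact // -gs_actM mulgV gs_act1.
Qed.

Definition mk_fixed : fixed_points H (Map A X) :=
  exist _ (PMap ck kpt : Map A X) (mem_set mk_fixed_subproof).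

End construct.

Lemma fixed_map_points A X (T : topologicalType) (u : T -> fixed_points H (Map A X)) :
  compact_hausdorff T ->
  continuous u <-> continuous (fun w : T * A => fev (u w.1) w.2).
Proof.
move=> hT; split=> [cu|cu].
  apply/(map_points (fun t => set_val (u t)) hT).
  exact: comp_continuous cu (@set_val_continuous _ _).
by apply: continuous_into_set; apply/(map_points _ hT).
Qed.

End fixed.

Lemma fixed_map_continuous (H : set G) X Y (f : gmap X Y) :
  continuous (@fixed_map G H X Y f).
Proof.
apply: continuous_into_set.
exact: comp_continuous (@set_val_continuous _ _) (@gm_continuous _ _ _ f).
Qed.

Lemma fixed_pt (H : set G) X : fixed_points H X (gs_pt X).
Proof. by move=> h _; rewrite gs_act_pt. Qed.

Definition fpt (H : set G) X : fixed_points H X := exist _ (gs_pt X) (mem_set (@fixed_pt H X)).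

End map_points.

(** * Maps out of spaces with trivial action and a disjoint base point *)

Section free_points.
Variables (G : compactGroupType) (Z : topologicalType) (hZ : compact_hausdorff Z).
Local Notation Zp := (add_base (triv G hZ)).
Implicit Types (X : gspace G).

Definition zev X (u : Map Zp X) (z : Z) : X := mev u (Some z : Zp).

Lemma zev_eq X (u v : Map Zp X) : zev u =1 zev v -> u = v.
Proof.
move=> h; apply: mev_eq => -[z|]; first exact: h.
by rewrite /mev [LHS]pm_pt [RHS]pm_pt.
Qed.

Definition zext X (k : Z -> X) (a : Zp) : X :=
  if (a : option Z) is Some z then k z else gs_pt X.

Lemma zext_continuous X (k : Z -> X) : continuous k -> continuous (zext k).
Proof. by move=> ck; apply: add_pt_continuous. Qed.

Definition mk_zmap X (k : Z -> X) (ck : continuous k) : Map Zp X :=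
  @PMap G Zp X (zext k) (zext_continuous ck) erefl.

Lemma zev_act X g (u : Map Zp X) z : zev (gs_act g u) z = gs_act g (zev u z).
Proof. by []. Qed.

Lemma add_pt_prod_continuous (T W : topologicalType) (k : T * add_pt Z -> W) :
  continuous (fun w : T * Z => k (w.1, Some w.2)) ->
  continuous (fun t : T => k (t, None)) -> continuous k.
Proof.
move=> /continuousP cS /continuousP cN; apply/continuousP => U oU.
rewrite openE => -[t [z|]] /= Utz.
- have [[P Q] /= [Pt Qz] PQ] := open_nbhs_nbhs (conj (cS U oU) Utz : open_nbhs (t, z) _).
  move: Qz; rewrite nbhsE => -[Q' [oQ' Q'z] Q'Q].
  exists (P, Some @` Q'); first split => //=.
    by apply: open_nbhs_nbhs; split; [exact: add_pt_open_Some|exists z].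
  by move=> [t' _] /= [Pt' [z' Qz' <-]]; exact: (PQ (t', z') (conj Pt' (Q'Q _ Qz'))).
- have nU := open_nbhs_nbhs (conj (cN U oU) Utz : open_nbhs t _).
  exists ((fun t : T => k (t, None)) @^-1` U, [set None]); first split => //=.
    by apply: open_nbhs_nbhs; split => //; exact: add_pt_open_None.
  by move=> [t' _] /= [Ut' ->].
Qed.

Lemma zmap_points X (T : topologicalType) (u : T -> Map Zp X) : compact_hausdorff T ->
  continuous u <-> continuous (fun w : T * Z => zev (u w.1) w.2).
Proof.
move=> hT; split=> [/(map_points _ hT) cu|cu].
  apply: (comp_continuous (f := fun w : T * Z => (w.1, Some w.2 : Zp)) _ cu).
  apply: pair_continuous; first exact: fst_continuous.
  exact: comp_continuous (@snd_continuous _ _) (@add_pt_Some_continuous Z).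
apply/(map_points _ hT).
apply: (@add_pt_prod_continuous T X (fun w => mev (u w.1) w.2)) => //=.
rewrite (_ : (fun t => _) = fun=> gs_pt X); first exact: cst_continuous.
by apply/funext => t; exact: (@pm_pt _ _ _ (u t : Defs.pmap _ _)).
Qed.

Lemma zmap_k_points X (T : topologicalType) (u : T -> Map Zp X) : k_space T ->
  (forall (C : topologicalType) (t : C -> T), compact_hausdorff C -> continuous t ->
     continuous (fun w : C * Z => zev (u (t w.1)) w.2)) ->
  continuous u.
Proof.
move=> kT h; apply: k_space_continuous => // C t hC ct.
by apply/(zmap_points _ hC); exact: h.
Qed.

End free_points.

(** * Subspaces of products *)

Section subproduct.
Variables (G : compactGroupType) (X Y : gspace G) (S : set (X * Y)).
Hypotheses (Spt : S (gs_pt X, gs_pt Y))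
  (Sact : forall g w, S w -> S (gs_act g w.1, gs_act g w.2)).

(** The k-ification makes the subset compactly generated, even when it is not closed. *)
Definition sub_car : Type := kify (set_type S).
HB.instance Definition _ := Topological.on sub_car.

Definition sub_val (w : sub_car) : X * Y := set_val (w : set_type S).

Lemma sub_valP (w : sub_car) : S (sub_val w).
Proof. exact: set_valP. Qed.

Definition mk_sub (w : X * Y) (Sw : S w) : sub_car := exist _ w (mem_set Sw).

Lemma sub_mk (w : X * Y) (Sw : S w) : sub_val (mk_sub Sw) = w.
Proof. by []. Qed.

Lemma sub_val_inj : injective sub_val.
Proof. exact: val_inj. Qed.

Lemma sub_val_continuous : continuous sub_val.
Proof. exact: comp_continuous (@kify_id_continuous _) (@set_val_continuous _ S). Qed.

Lemma sub_fst_continuous : continuous (fun w => (sub_val w).1).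
Proof. exact: comp_continuous sub_val_continuous (@fst_continuous _ _). Qed.

Lemma sub_snd_continuous : continuous (fun w => (sub_val w).2).
Proof. exact: comp_continuous sub_val_continuous (@snd_continuous _ _). Qed.

Lemma subspace_continuous (T : topologicalType) (u : T -> sub_car) : k_space T ->
  continuous (fun t => (sub_val (u t)).1) -> continuous (fun t => (sub_val (u t)).2) ->
  continuous u.
Proof.
move=> kT c1 c2; apply: k_space_continuous => // C t hC ct.
apply: (@kify_test_continuous (set_type S)) => //; apply: continuous_into_set.
rewrite (_ : (fun c => _) = fun c => ((sub_val (u (t c))).1, (sub_val (u (t c))).2)).
  by apply: pair_continuous; [exact: comp_continuous ct c1|exact: comp_continuous ct c2].
by apply/funext => c; exact: surjective_pairing.
Qed.

Lemma sub_compactly_generated : compactly_generated sub_car.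
Proof.
apply: compactly_generated_kify => C u v hC cu cv.
have dXY : k_diagonal (X * Y)%type by apply: k_diagonal_prod; exact: gs_k_diagonal.
rewrite (_ : [set c | _] = [set c | set_val (u c) = set_val (v c)]).
  apply: dXY => //.
  - exact: comp_continuous cu (@set_val_continuous _ S).
  - exact: comp_continuous cv (@set_val_continuous _ S).
by apply/seteqP; split=> c /= => [->//|]; exact: val_inj.
Qed.

Definition sub_act (g : G) (w : sub_car) : sub_car := mk_sub (Sact g (sub_valP w)).

Lemma sub_act_continuous : continuous (fun gw : G * sub_car => sub_act gw.1 gw.2).
Proof.
apply: act_continuous; first exact: sub_compactly_generated.1.
move=> C g u hC cg cu; apply: subspace_continuous.
- exact: (compact_hausdorff_compactly_generated hC).1.
- exact: act_test_continuous cg (comp_continuous cu sub_fst_continuous).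
- exact: act_test_continuous cg (comp_continuous cu sub_snd_continuous).
Qed.

Lemma sub_act1 w : sub_act 1%g w = w.
Proof. by apply: sub_val_inj; rewrite /sub_act sub_mk !gs_act1 -surjective_pairing. Qed.

Lemma sub_actM g h w : sub_act (g * h)%g w = sub_act g (sub_act h w).
Proof. by apply: sub_val_inj; rewrite /sub_act !sub_mk !gs_actM. Qed.

Lemma sub_act_pt g : sub_act g (mk_sub Spt) = mk_sub Spt.
Proof. by apply: sub_val_inj; rewrite /sub_act !sub_mk !gs_act_pt. Qed.

Definition subproduct : gspace G :=
  GSpace sub_compactly_generated sub_act_continuous sub_act1 sub_actM sub_act_pt.

End subproduct.

(** * Equivariant maps out of a cofibrant space *)

Section compression_fibration.
Variables (R : realType) (G : compactGroupType) (X Y : gspace G) (g : gmap X Y).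
Variable n : nat.
Local Notation I := (unit_interval R).
Local Notation D := (cube R n).

Let hD : compact_hausdorff D := cube_compact_hausdorff R n.

Let hA : compact_hausdorff (set_type (@dcube R n)).
Proof. exact: compact_hausdorff_set_type hD (@closed_dcube R n). Qed.

Let hC : compact_hausdorff (D * I)%type.
Proof. exact: compact_hausdorff_prod hD (unit_interval_compact_hausdorff R). Qed.

Local Notation DX := (Map (add_base (triv G hD)) X).
Local Notation DY := (Map (add_base (triv G hD)) Y).
Local Notation CY := (Map (add_base (triv G hC)) Y).
Local Notation AX := (Map (add_base (triv G hA)) X).

(** Compressions of cells; as required of them, the homotopy in [Y] is stationary on the
    boundary. *)
Definition compressed : set (DX * CY) :=
  [set w | (forall v, zev w.2 (v, ui0 R) = g (zev w.1 v)) /\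
           (forall v t, dcube v -> zev w.2 (v, t) = zev w.2 (v, ui0 R))].

Definition bordered : set (AX * DY) :=
  [set w | forall a : set_type (@dcube R n), zev w.2 (set_val a) = g (zev w.1 a)].

Let compressed_pt : compressed (gs_pt DX, gs_pt CY).
Proof. by split => [v|v t _] //; rewrite /zev /mev /= gm_pt. Qed.

Let compressed_act h w : compressed w -> compressed (gs_act h w.1, gs_act h w.2).
Proof.
case: w => u k [w0 wd]; split=> [v|v t dv].
  change (gs_act h (zev k (v, ui0 R)) = g (gs_act h (zev u v))).
  by rewrite gm_act -w0.
change (gs_act h (zev k (v, t)) = gs_act h (zev k (v, ui0 R))).
by rewrite [zev k (v, t)]wd.
Qed.

Let bordered_pt : bordered (gs_pt AX, gs_pt DY).
Proof. by move=> a; rewrite /zev /mev /= gm_pt. Qed.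

Let bordered_act h w : bordered w -> bordered (gs_act h w.1, gs_act h w.2).
Proof.
case: w => u k wb a.
change (gs_act h (zev k (set_val a)) = g (gs_act h (zev u a))).
by rewrite gm_act -[g (zev u a)]wb.
Qed.

Definition compressed_space : gspace G := subproduct compressed_pt compressed_act.
Definition bordered_space : gspace G := subproduct bordered_pt bordered_act.

Lemma zev_continuous (Z : topologicalType) (hZ : compact_hausdorff Z) (W : gspace G)
    (u : Map (add_base (triv G hZ)) W) : continuous (zev u).
Proof.
exact: comp_continuous (@add_pt_Some_continuous Z) (@pm_continuous _ _ _ (u : Defs.pmap _ _)).
Qed.

Lemma border_continuous (w : compressed_space) :
  continuous (fun a : set_type (@dcube R n) => zev (sub_val w).1 (set_val a)).
Proof. exact: comp_continuous (@set_val_continuous _ _) (@zev_continuous _ _ _ _). Qed.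

Lemma lid_continuous (w : compressed_space) :
  continuous (fun v : D => zev (sub_val w).2 (v, ui1 R)).
Proof.
apply: (comp_continuous _ (@zev_continuous _ hC Y (sub_val w).2)).
by apply: pair_continuous; [exact: id_continuous|exact: cst_continuous].
Qed.

Lemma bordered_lid (w : compressed_space) :
  bordered (mk_zmap hA (@border_continuous w), mk_zmap hD (@lid_continuous w)).
Proof.
move=> a; have [w0 wd] := sub_valP w.
exact: etrans (wd _ (ui1 R) (set_valP a)) (w0 _).
Qed.

Definition border_lid_fun (w : compressed_space) : bordered_space :=
  mk_sub (bordered_lid w).

Lemma border_lid_continuous : continuous border_lid_fun.
Proof.
have kE := (gs_cg compressed_space).1.
apply: subspace_continuous => //; apply: zmap_k_points => // C t hC' ct.
- have ct1 : continuous (fun c => (sub_val (t c)).1).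
    exact: comp_continuous ct (@sub_fst_continuous _ _ _ _).
  have /(zmap_points _ hC') h := ct1.
  apply: (comp_continuous (f := fun w : C * set_type (@dcube R n) =>
    (w.1, set_val w.2)) _ h).
  apply: pair_continuous; first exact: fst_continuous.
  exact: comp_continuous (@snd_continuous _ _) (@set_val_continuous _ _).
- have ct2 : continuous (fun c => (sub_val (t c)).2).
    exact: comp_continuous ct (@sub_snd_continuous _ _ _ _).
  have /(zmap_points _ hC') h := ct2.
  apply: (comp_continuous (f := fun w : C * D => (w.1, (w.2, ui1 R))) _ h).
  apply: pair_continuous; first exact: fst_continuous.
  by apply: pair_continuous; [exact: snd_continuous|exact: cst_continuous].
Qed.

Lemma border_lid_pt : border_lid_fun (gs_pt compressed_space) = gs_pt bordered_space.
Proof. by apply: sub_val_inj; congr pair; apply: zev_eq. Qed.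

Lemma border_lid_act h w : border_lid_fun (gs_act h w) = gs_act h (border_lid_fun w).
Proof. by apply: sub_val_inj; congr pair; apply: zev_eq. Qed.

Definition border_lid : gmap compressed_space bordered_space :=
  GMap border_lid_continuous border_lid_pt border_lid_act.

Section fixed.
Variable H : closed_subgroup G.
Local Notation gH := (fixed_map (csg_set H) g).
Local Notation fixE := (fixed_points (csg_set H) compressed_space).
Local Notation fixF := (fixed_points (csg_set H) bordered_space).
Local Notation XH := (fixed_points (csg_set H) X).
Local Notation YH := (fixed_points (csg_set H) Y).

Lemma fixed_cell (w : fixE) v : XH (zev (sub_val (set_val w)).1 v).
Proof.
move=> h Hh; have := set_valP w h Hh => /(congr1 (fun w => zev (sub_val w).1 v)).
exact.
Qed.

Lemma fixed_homotopy (w : fixE) v : YH (zev (sub_val (set_val w)).2 v).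
Proof.
move=> h Hh; have := set_valP w h Hh => /(congr1 (fun w => zev (sub_val w).2 v)).
exact.
Qed.

Lemma fixed_border (w : fixF) v : XH (zev (sub_val (set_val w)).1 v).
Proof.
move=> h Hh; have := set_valP w h Hh => /(congr1 (fun w => zev (sub_val w).1 v)).
exact.
Qed.

Lemma fixed_lid (w : fixF) v : YH (zev (sub_val (set_val w)).2 v).
Proof.
move=> h Hh; have := set_valP w h Hh => /(congr1 (fun w => zev (sub_val w).2 v)).
exact.
Qed.

Definition cell_at (w : fixE) v : XH := set_point (fixed_cell w v).
Definition homotopy_at (w : fixE) v : YH := set_point (fixed_homotopy w v).
Definition border_at (w : fixF) v : XH := set_point (fixed_border w v).
Definition lid_at (w : fixF) v : YH := set_point (fixed_lid w v).

Lemma homotopy_at_continuous w v : continuous (fun t => homotopy_at w (v, t)).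
Proof.
apply: continuous_into_set => /=.
apply: (comp_continuous _ (@zev_continuous _ hC Y (sub_val (set_val w)).2)).
by apply: pair_continuous; [exact: cst_continuous|exact: id_continuous].
Qed.

Lemma homotopy_at0 w v : homotopy_at w (v, ui0 R) = gH (cell_at w v).
Proof. by apply: val_inj => /=; have [-> _] := sub_valP (set_val w). Qed.

Definition path_at (w : fixE) (v : D) : path_space R gH :=
  mk_path (@homotopy_at_continuous w v) (homotopy_at0 w v).

Lemma path_at_continuous (T : topologicalType) (u : T -> fixE) :
  compact_hausdorff T -> continuous u ->
  continuous (fun z : T * D => path_at (u z.1) z.2).
Proof.
move=> hT cu; have cu' := comp_continuous cu (@set_val_continuous _ _).
apply: path_space_continuous => /=; apply: continuous_into_set => /=.
- apply/(zmap_points (fun t => (sub_val (set_val (u t))).1) hT).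
  exact: comp_continuous cu' (@sub_fst_continuous _ _ _ _).
- have /(zmap_points (fun t => (sub_val (set_val (u t))).2) hT) h :
      continuous (fun t => (sub_val (set_val (u t))).2).
    exact: comp_continuous cu' (@sub_snd_continuous _ _ _ _).
  apply: (comp_continuous (f := fun z : (T * D) * I => (z.1.1, (z.1.2, z.2))) _ h).
  have c1 : continuous (fun z : (T * D) * I => z.1) by exact: fst_continuous.
  apply: pair_continuous; first exact: comp_continuous c1 (@fst_continuous _ _).
  apply: pair_continuous; last exact: snd_continuous.
  exact: comp_continuous c1 (@snd_continuous _ _).
Qed.

(** A cell of [compressed_space] with its boundary is a map on the product of two cubes.  A
    lifting problem prescribes it over the whole boundary of the product: on one part by
    the partial lift, on the other, where homotopies are stationary, by the base.  Hence
    it is a problem for the mapping path fibration of [gH] over the product cube. *)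
Lemma border_lid_lifts m : weak_homotopy_equivalence R gH ->
  lifts (@dcube R m) (fixed_map (csg_set H) border_lid).
Proof.
move=> wg c b cc cb cbE.
pose bdry (w : cube R m) (v : D) : XH :=
  if pselect (dcube v) is left dv then border_at (b w) (exist _ v (mem_set dv))
  else fpt (csg_set H) X.
have bdryE w (a : set_type (@dcube R n)) : bdry w (set_val a) = border_at (b w) a.
  rewrite /bdry; case: pselect => [dv|]; last by have := set_valP a.
  by congr border_at; exact: val_inj.
pose c0 (z : cube R m * D) : path_space R gH :=
  if `[< dcube z.1 >] then path_at (c z.1) z.2 else const_path R gH (bdry z.1 z.2).
have c0l z : dcube z.1 -> c0 z = path_at (c z.1) z.2 by move=> h; rewrite /c0 asboolT.
have c0r z : dcube z.2 -> c0 z = const_path R gH (bdry z.1 z.2).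
  move=> dv; have [h|h] := pselect (dcube z.1); last by rewrite /c0 asboolF.
  pose a : set_type (@dcube R n) := exist _ z.2 (mem_set dv).
  have -> : bdry z.1 z.2 = border_at (b z.1) a by exact: bdryE z.1 a.
  have bE := cbE _ h; rewrite c0l //.
  have sE : cell_at (c z.1) z.2 = border_at (b z.1) a.
    by apply: val_inj => /=; rewrite -bE.
  apply: path_space_eq => [|s]; first exact: sE.
  rewrite /path_fun /= -sE -homotopy_at0; apply: val_inj => /=.
  by have [_ ->] := sub_valP (set_val (c z.1)).
have [e [ce eA eb]] : exists e : cube R m * D -> path_space R gH,
    [/\ continuous e, forall z, dcube z.1 \/ dcube z.2 -> e z = c0 z
      & forall z, path_end (e z) = lid_at (b z.1) z.2].
- have L := lifts_retract (@cube_cat_continuous R m n)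
    (pair_continuous (@cube_left_continuous R m n) (@cube_right_continuous R m n))
    _ _ _ (weak_equivalence_lifts wg (n := m + n))
    (A := [set z : cube R m * D | dcube z.1 \/ dcube z.2]).
  apply: L.
  + by move=> w; rewrite cube_left_cat cube_right_cat -surjective_pairing.
  + by move=> w h; apply/dcube_cat.
  + by move=> v; rewrite -{1}(cube_splitK v) => /dcube_cat.
  + apply: (withinU_continuous (A := [set z : cube R m * D | dcube z.1])
      (B := [set z | dcube z.2])).
    * exact: closed_preimage (@fst_continuous _ _) (@closed_dcube R m).
    * exact: closed_preimage (@snd_continuous _ _) (@closed_dcube R n).
    * apply: (within_eq (f := fun z => path_at (c z.1) z.2)).
        by move=> z /c0l ->.
      have hm : compact_hausdorff (set_type (@dcube R m)).
        exact: compact_hausdorff_set_type (cube_compact_hausdorff R m) (@closed_dcube R m).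
      have cc' : continuous (fun a : set_type (@dcube R m) => c (set_val a)).
        exact: within_comp cc (@set_val_continuous _ _) set_valP.
      apply: within_setval.
      apply: (comp_continuous (f := fun z : set_type [set z : cube R m * D | dcube z.1] =>
        (exist _ (set_val z).1 (mem_set (set_valP z)) : set_type (@dcube R m),
         (set_val z).2)) _ (path_at_continuous hm cc')).
      have cz : continuous (fun z : set_type [set z : cube R m * D | dcube z.1] =>
          set_val z) by exact: set_val_continuous.
      apply: pair_continuous; last exact: comp_continuous cz (@snd_continuous _ _).
      apply: continuous_into_set; exact: comp_continuous cz (@fst_continuous _ _).
    * apply: (within_eq (f := fun z => const_path R gH (bdry z.1 z.2))).
        by move=> z /c0r ->.
      apply: (comp_within _ (const_path_continuous (@fixed_map_continuous _ _ _ _ g))).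
      apply: within_setval; apply: continuous_into_set.
      have cb' := comp_continuous cb (@set_val_continuous _ _).
      have /(zmap_points (fun w => (sub_val (set_val (b w))).1)
          (cube_compact_hausdorff R m)) h :
          continuous (fun w => (sub_val (set_val (b w))).1).
        exact: comp_continuous cb' (@sub_fst_continuous _ _ _ _).
      pose S := [set z : cube R m * D | dcube z.2].
      pose pr (z : set_type S) : cube R m * set_type (@dcube R n) :=
        ((set_val z).1, exist _ (set_val z).2 (mem_set (set_valP z))).
      rewrite (_ : (fun z => _) =
          fun z : set_type S => zev (sub_val (set_val (b (pr z).1))).1 (pr z).2).
        apply: (comp_continuous _ h).
        have cz : continuous (fun z : set_type S => set_val z).
          exact: set_val_continuous.
        apply: pair_continuous; first exact: comp_continuous cz (@fst_continuous _ _).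
        apply: continuous_into_set; exact: comp_continuous cz (@snd_continuous _ _).
      apply/funext => z; have := bdryE (set_val z).1 (pr z).2 => /(congr1 set_val).
      exact.
  + apply: continuous_into_set.
    have cb' := comp_continuous cb (@set_val_continuous _ _).
    apply/(zmap_points (fun w => (sub_val (set_val (b w))).2)
          (cube_compact_hausdorff R m)).
    exact: comp_continuous cb' (@sub_snd_continuous _ _ _ _).
  + move=> z [h|h].
      by rewrite c0l // /path_end /path_fun /=; apply: val_inj; rewrite /= -(cbE _ h).
    rewrite c0r //; apply: val_inj.
    pose a : set_type (@dcube R n) := exist _ z.2 (mem_set h).
    rewrite /path_end /path_fun /=.
    have -> : bdry z.1 z.2 = border_at (b z.1) a by exact: bdryE z.1 a.
    by have -> := sub_valP (set_val (b z.1)) a.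
have ces : continuous (fun z => set_val (path_start (e z))).
  exact: comp_continuous (comp_continuous ce (@path_start_continuous _ _ _ _))
    (@set_val_continuous _ _).
have cep : continuous (fun z : (cube R m * D) * I => set_val (path_fun (e z.1) z.2)).
  apply: comp_continuous (@set_val_continuous _ _).
  apply: (comp_continuous (f := fun z : (cube R m * D) * I => (e z.1, z.2)) _
    (@path_fun_joint_continuous _ _ _ _)).
  apply: pair_continuous; last exact: snd_continuous.
  exact: comp_continuous (@fst_continuous _ _) ce.
have cs w : continuous (fun v => set_val (path_start (e (w, v)))).
  apply: comp_continuous ces.
  by apply: pair_continuous; [exact: cst_continuous|exact: id_continuous].
have cp w : continuous (fun z : D * I => set_val (path_fun (e (w, z.1)) z.2)).
  apply: (comp_continuous (f := fun z : D * I => ((w, z.1), z.2)) _ cep).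
  apply: pair_continuous; last exact: snd_continuous.
  by apply: pair_continuous; [exact: cst_continuous|exact: fst_continuous].
have Se w : compressed (mk_zmap hD (cs w), mk_zmap hC (cp w)).
  split=> [v|v t dv]; rewrite /zev /mev /=.
    by rewrite path_fun0.
  by rewrite eA ?c0r //; right.
have Fe w : fixE (mk_sub (Se w)).
  move=> h Hh; apply: sub_val_inj; congr pair; apply: zev_eq => z; rewrite zev_act.
    exact: (set_valP (path_start (e (w, z))) h Hh).
  exact: (set_valP (path_fun (e (w, z.1)) z.2) h Hh).
exists (fun w => set_point (Fe w)); split.
- apply: continuous_into_set; apply: subspace_continuous.
  + exact: (compact_hausdorff_compactly_generated (cube_compact_hausdorff R m)).1.
  + apply/(zmap_points _ (cube_compact_hausdorff R m)).
    apply: (comp_continuous _ ces (f := fun z : cube R m * D => (z.1, z.2))).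
    by apply: pair_continuous; [exact: fst_continuous|exact: snd_continuous].
  + apply/(zmap_points _ (cube_compact_hausdorff R m)).
    apply: (comp_continuous
      (f := fun z : cube R m * (D * I) => ((z.1, z.2.1), z.2.2)) _ cep).
    have c2 : continuous (fun z : cube R m * (D * I) => z.2) by exact: snd_continuous.
    apply: pair_continuous; last exact: comp_continuous c2 (@snd_continuous _ _).
    apply: pair_continuous; first exact: fst_continuous.
    exact: comp_continuous c2 (@fst_continuous _ _).
- move=> w dw; apply: val_inj; apply: sub_val_inj.
  rewrite [RHS]surjective_pairing; congr pair; apply: zev_eq => z.
    by rewrite /zev /mev /= eA ?c0l //; left.
  by rewrite /zev /mev /= eA ?c0l //; [case: z|left].
- move=> w; apply: val_inj; apply: sub_val_inj.
  rewrite [RHS]surjective_pairing; congr pair; apply: zev_eq => z.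
    rewrite /zev /mev /= eA; last by right; exact: set_valP.
    rewrite c0r /=; last exact: set_valP.
    by rewrite bdryE.
  by have /(congr1 set_val) := eb (w, z).
Qed.

End fixed.

(** Fixed points commute with the construction, so it is enough that cells lift on the fixed
    points of every closed subgroup. *)
Lemma border_lid_trivial_fibration : weak_equivalence R g ->
  fibration R border_lid /\ weak_equivalence R border_lid.
Proof.
move=> wg.
have L (H : closed_subgroup G) m :
    lifts (@dcube R m) (fixed_map (csg_set H) border_lid).
  exact: border_lid_lifts (wg H).
split=> H; first exact: lifts_serre_fibration (@fixed_map_continuous _ _ _ _ _) (L H).
apply: compression_weak_equivalence (fpt _ _) (@fixed_map_continuous _ _ _ _ _) _ => m.
exact: lifts_compresses (@fixed_map_continuous _ _ _ _ _) (L H m).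
Qed.

(** A cell of [Map_G B Y] with a lift of its boundary to [Map_G B X] is a map from [B] to
    [bordered_space], and a lift of this map to [compressed_space] compresses the cell. *)
Lemma cofibrant_compresses (B : gspace G) : cofibrant R B -> weak_equivalence R g ->
  compresses R (@Map_G_map G B X Y g) (@dcube R n).
Proof.
move=> cofB /border_lid_trivial_fibration[fp wp] c b cc cb cbE.
have cc' : continuous (fun a : set_type (@dcube R n) => c (set_val a)).
  exact: within_comp cc (@set_val_continuous _ _) set_valP.
have /(fixed_map_points _ hA) jc := cc'.
have /(fixed_map_points _ hD) jb := cb.
have c1 x : continuous (fun a : set_type (@dcube R n) => fev (c (set_val a)) x).
  apply: (comp_continuous (f := fun a => (a, x)) _ jc).
  by apply: pair_continuous; [exact: id_continuous|exact: cst_continuous].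
have b1 x : continuous (fun v => fev (b v) x).
  apply: (comp_continuous (f := fun a => (a, x)) _ jb).
  by apply: pair_continuous; [exact: id_continuous|exact: cst_continuous].
have S x : bordered (mk_zmap hA (c1 x), mk_zmap hD (b1 x)).
  by move=> a; rewrite /zev /mev /= -cbE //; exact: set_valP.
pose q x : bordered_space := mk_sub (S x).
have cq : continuous q.
  apply: subspace_continuous; first exact: (gs_cg B).1.
  - apply: zmap_k_points; first exact: (gs_cg B).1.
    move=> C t hC' ct.
    apply: (comp_continuous (f := fun w : C * set_type (@dcube R n) =>
      (w.2, t w.1)) _ jc).
    apply: pair_continuous; first exact: snd_continuous.
    exact: comp_continuous (@fst_continuous _ _) ct.
  - apply: zmap_k_points; first exact: (gs_cg B).1.
    move=> C t hC' ct.
    apply: (comp_continuous (f := fun w : C * D => (w.2, t w.1)) _ jb).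
    apply: pair_continuous; first exact: snd_continuous.
    exact: comp_continuous (@fst_continuous _ _) ct.
have qpt : q (gs_pt B) = gs_pt bordered_space.
  by apply: sub_val_inj; congr pair; apply: zev_eq => z; exact: fev_pt.
have qact h x : q (gs_act h x) = gs_act h (q x).
  by apply: sub_val_inj; congr pair; apply: zev_eq => z; exact: fev_act.
have [|l [_ lE]] := cofB _ _ border_lid fp wp (from_point compressed_space)
  (GMap cq qpt qact).
  by move=> x; rewrite /= border_lid_pt -qpt.
pose s v x := zev (sub_val (l x)).1 v.
pose k z x := zev (sub_val (l x)).2 z.
have lact h x : l (gs_act h x) = gs_act h (l x) by exact: gm_act.
have js : continuous (fun w : D * B => s w.1 w.2).
  apply: k_space_continuous => [|C w hC' cw].
    exact: k_space_prod_compact hD (gs_cg B).1.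
  have cl : continuous (fun c => (sub_val (l (w c).2)).1).
    apply: comp_continuous (@sub_fst_continuous _ _ _ _).
    apply: comp_continuous (@gm_continuous _ _ _ l).
    exact: comp_continuous cw (@snd_continuous _ _).
  have /(zmap_points _ hC') jl := cl.
  apply: (comp_continuous (f := fun c => (c, (w c).1)) _ jl).
  apply: pair_continuous; first exact: id_continuous.
  exact: comp_continuous cw (@fst_continuous _ _).
have jk : continuous (fun w : (D * I) * B => k w.1 w.2).
  apply: k_space_continuous => [|C w hC' cw].
    exact: k_space_prod_compact hC (gs_cg B).1.
  have cl : continuous (fun c => (sub_val (l (w c).2)).2).
    apply: comp_continuous (@sub_snd_continuous _ _ _ _).
    apply: comp_continuous (@gm_continuous _ _ _ l).
    exact: comp_continuous cw (@snd_continuous _ _).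
  have /(zmap_points _ hC') jl := cl.
  apply: (comp_continuous (f := fun c => (c, (w c).1)) _ jl).
  apply: pair_continuous; first exact: id_continuous.
  exact: comp_continuous cw (@fst_continuous _ _).
have cs v : continuous (s v).
  apply: (comp_continuous (f := fun x => (v, x)) _ js).
  by apply: pair_continuous; [exact: cst_continuous|exact: id_continuous].
have ck v : continuous (k v).
  apply: (comp_continuous (f := fun x => (v, x)) _ jk).
  by apply: pair_continuous; [exact: cst_continuous|exact: id_continuous].
have lpt : l (gs_pt B) = gs_pt compressed_space by exact: gm_pt.
have spt v : s v (gs_pt B) = gs_pt X by rewrite /s lpt.
have kpt v : k v (gs_pt B) = gs_pt Y by rewrite /k lpt.
have sact v h x : [set: G] h -> s v (gs_act h x) = gs_act h (s v x).
  by move=> _; rewrite /s lact.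
have kact v h x : [set: G] h -> k v (gs_act h x) = gs_act h (k v x).
  by move=> _; rewrite /k lact.
have lidE v x : k (v, ui1 R) x = fev (b v) x.
  by have /(congr1 (fun w => zev (sub_val w).2 v)) := lE x.
have sE (a : set_type (@dcube R n)) x : s (set_val a) x = fev (c (set_val a)) x.
  by have /(congr1 (fun w => zev (sub_val w).1 a)) := lE x.
exists (fun v => mk_fixed (cs v) (spt v) (sact v)); split.
- by apply/(fixed_map_points _ hD).
- move=> v dv; apply: fev_eq => x.
  exact: sE (exist _ v (mem_set dv)) x.
exists (fun z => mk_fixed (ck z) (kpt z) (kact z)); split.
- by apply/(fixed_map_points _ hC).
- by move=> v; apply: fev_eq => x; have [h _] := sub_valP (l x); exact: h.
- by move=> v; apply: fev_eq => x; exact: lidE.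
- move=> v t dv; apply: fev_eq => x; have [h0 h] := sub_valP (l x).
  by rewrite /fev /mev /= /k h // h0.
Qed.

End compression_fibration.

Theorem cofibrant_weak_equivalence (R : realType) (G : compactGroupType)
    (X Y B : gspace G) (g : gmap X Y) : cofibrant R B -> weak_equivalence R g ->
  weak_homotopy_equivalence R (@Map_G_map G B X Y g).
Proof.
move=> cofB wg.
apply: compression_weak_equivalence (fpt _ _) (@fixed_map_continuous _ _ _ _ _) _ => n.
exact: cofibrant_compresses.
Qed.

(** * Exponential laws *)

Section exponential.
Variable R : realType.

(** [W2] has the same points, parametrized by compact Hausdorff spaces, as the space of
    maps from [Z] to [W1]. *)
Definition exponential (Z W1 W2 : topologicalType) (e : W2 -> Z -> W1) : Prop :=
  [/\ forall (T : topologicalType) (u : T -> W2), compact_hausdorff T ->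
        (continuous u <-> continuous (fun w : T * Z => e (u w.1) w.2)),
      forall w w', e w =1 e w' -> w = w'
    & forall k : Z -> W1, continuous k -> exists w, e w =1 k].

Lemma exponential_family (Z W1 W2 : topologicalType) (e : W2 -> Z -> W1)
    (T : topologicalType) (k : Z * T -> W1) :
  exponential e -> compact_hausdorff T -> continuous k ->
  exists u : T -> W2, continuous u /\ forall t z, e (u t) z = k (z, t).
Proof.
move=> [ec _ es] hT ck.
have /choice[u uE] : forall t, exists w, e w =1 (fun z => k (z, t)).
  move=> t; apply: es; apply: comp_continuous ck.
  by apply: pair_continuous; [exact: id_continuous|exact: cst_continuous].
exists u; split; last by move=> t z; exact: uE.
apply/(ec T u hT); rewrite (_ : (fun w => _) = fun w => k (w.2, w.1)).
  apply: comp_continuous ck.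
  by apply: pair_continuous; [exact: snd_continuous|exact: fst_continuous].
by apply/funext => w; exact: uE.
Qed.

(** A cell of [W2] is a family of cells of [W1] indexed by [Z]. *)
Lemma exponential_weak_equivalence (Z W1 W2 V1 V2 : topologicalType)
    (e : W2 -> Z -> W1) (e' : V2 -> Z -> V1) (f1 : W1 -> V1) (f2 : W2 -> V2) (w0 : W2) :
  exponential e -> exponential e' -> continuous f1 -> continuous f2 ->
  (forall w z, e' (f2 w) z = f1 (e w z)) -> @family_lifts R W1 V1 f1 Z ->
  weak_homotopy_equivalence R f2.
Proof.
move=> ee ee' cf1 cf2 ef L.
apply: (compression_weak_equivalence w0 cf2) => n c b cc cb cbE.
have [ec einj es] := ee; have [ec' einj' es'] := ee'.
have hA : compact_hausdorff (set_type (@dcube R n)).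
  exact: compact_hausdorff_set_type (cube_compact_hausdorff R n) (@closed_dcube R n).
have [|||c' [cc' c'A [k [ck k0 k1 kA]]]] := path_end_lifts_compresses cf1 (L n)
  (c := fun w => e (c w.2) w.1) (b := fun w => e' (b w.2) w.1).
- have cc0 : continuous (fun a : set_type (@dcube R n) => c (set_val a)).
    exact: within_comp cc (@set_val_continuous _ _) set_valP.
  have /(ec _ _ hA) jc := cc0.
  apply: within_setval.
  pose S : set (Z * cube R n) := [set: Z] `*` @dcube R n.
  have cv : continuous (fun x : set_type S => set_val x) by exact: set_val_continuous.
  apply: (comp_continuous (f := fun x : set_type S =>
    (set_point (set_valP x).2, (set_val x).1)) _ jc).
  apply: pair_continuous; last exact: comp_continuous cv (@fst_continuous _ _).
  apply: continuous_into_set; exact: comp_continuous cv (@snd_continuous _ _).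
- have /(ec' _ _ (cube_compact_hausdorff R n)) jb := cb.
  apply: (comp_continuous (f := fun w : Z * cube R n => (w.2, w.1)) _ jb).
  by apply: pair_continuous; [exact: snd_continuous|exact: fst_continuous].
- by move=> [z v] [_ /= dv]; rewrite -ef cbE.
have [u [cu uE]] := exponential_family ee (cube_compact_hausdorff R n) cc'.
pose kk (w : Z * (cube R n * unit_interval R)) := k ((w.1, w.2.1), w.2.2).
have ckk : continuous kk.
  apply: comp_continuous ck.
  have c2 : continuous (fun w : Z * (cube R n * unit_interval R) => w.2).
    exact: snd_continuous.
  apply: pair_continuous; last exact: comp_continuous c2 (@snd_continuous _ _).
  apply: pair_continuous; first exact: fst_continuous.
  exact: comp_continuous c2 (@fst_continuous _ _).
have [h [ch hE]] := exponential_family ee' (compact_hausdorff_prod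
  (cube_compact_hausdorff R n) (unit_interval_compact_hausdorff R)) ckk.
exists u; split => //.
  by move=> v dv; apply: einj => z; rewrite uE c'A.
exists h; split => // [v|v|v t dv]; apply: einj' => z; rewrite hE /kk /=.
- by rewrite k0 /= ef uE.
- by rewrite k1.
- by rewrite kA /= ?ef ?uE.
Qed.

Lemma point_family_lifts (W V : topologicalType) (f : W -> V) :
  weak_homotopy_equivalence R f -> @family_lifts R W V f (discrete_topology unit).
Proof.
move=> wf.
have h : @contracts_to R (discrete_topology unit) tt (fun=> tt).
  by split=> [|[]|] //; exact: cst_continuous.
exact: (@contractible_family_lifts R W V f wf _ _ _ h).
Qed.

End exponential.

(** * Maps out of smash products *)

(** Quotient maps remain quotient maps after multiplication with a compact Hausdorff
    space, by the tube lemma applied to a compact neighbourhood. *)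
Lemma quotient_prod_continuous (T P S W : topologicalType) (q : P -> S) (F : T * S -> W) :
  compact_hausdorff T -> (forall U : set S, open (q @^-1` U) -> open U) ->
  (forall s, exists p, q p = s) ->
  continuous (fun w : T * P => F (w.1, q w.2)) -> continuous F.
Proof.
move=> hT qo qs cF; apply/continuousP => O oO; rewrite openE => -[t0 s0] /= O0.
have oA : open [set w : T * P | O (F (w.1, q w.2))].
  by move/continuousP : cF => /(_ _ oO).
have [p0 ps0] := qs s0.
have oS : open [set t | O (F (t, s0))].
  have c : continuous (fun t : T => (t, p0)).
    by apply: pair_continuous; [exact: id_continuous|exact: cst_continuous].
  move/continuousP : c => /(_ _ oA); congr open.
  by apply/seteqP; split=> t /=; rewrite ps0.
have [N [clN cN NO]] := compact_hausdorff_regular hT (open_nbhs_nbhs (conj oS O0)).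
have hN := compact_hausdorff_set_type hT clN.
pose V := [set s | forall t : set_type N, O (F (set_val t, s))].
have oV : open V.
  apply: qo.
  have c : continuous (fun w : set_type N * P => (set_val w.1, w.2)).
    apply: pair_continuous; last exact: snd_continuous.
    exact: comp_continuous (@fst_continuous _ _) (@set_val_continuous _ N).
  by move/continuousP : c => /(_ _ oA) /(open_tube hN.1).
exists (N, V); first split => //=.
- by apply: open_nbhs_nbhs; split => // t; exact: (NO _ (set_valP t)).
- by move=> [t s] /= [Nt Vs]; exact: (Vs (set_point Nt)).
Qed.

Section smash_points.
Variables (G : compactGroupType) (X Y : gspace G).

Lemma smash_joint_continuous (T W : topologicalType) (F : T * smash X Y -> W) :
  compact_hausdorff T ->
  (forall (C : topologicalType) (t : C -> T) (x : C -> X) (y : C -> Y),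
     compact_hausdorff C -> continuous t -> continuous x -> continuous y ->
     continuous (fun c => F (t c, smash_pi (x c, y c)))) ->
  continuous F.
Proof.
move=> hT h.
apply: (@quotient_prod_continuous T (kprod X Y) (smash X Y) W (@smash_pi G X Y)) => //.
  by move=> s; exists (repr s); exact: smash_reprK.
apply: k_space_continuous.
  exact: k_space_prod_compact hT (kprod_compactly_generated X Y).1.
move=> C u hC cu.
have c1 : continuous (fun c => (u c).1) by exact: comp_continuous cu (@fst_continuous _ _).
have c2 : continuous (fun c => (u c).2) by exact: comp_continuous cu (@snd_continuous _ _).
rewrite (_ : _ \o u = fun c => F ((u c).1, smash_pi ((u c).2.1, (u c).2.2))).
  apply: h => //.
  - exact: comp_continuous c2 (@kprod_fst_continuous _ _ _).
  - exact: comp_continuous c2 (@kprod_snd_continuous _ _ _).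
by apply/funext => c; rewrite /= -surjective_pairing.
Qed.

Lemma smash_pair_continuous (T : topologicalType) (x : T -> X) (y : T -> Y) :
  k_space T -> continuous x -> continuous y ->
  continuous (fun t => smash_pi (x t, y t) : smash X Y).
Proof.
move=> kT cx cy; apply: (comp_continuous _ (@smash_pi_continuous G X Y)).
apply: k_space_continuous => // C u hC cu; apply: kprod_pair_continuous => //.
- exact: comp_continuous cu cx.
- exact: comp_continuous cu cy.
Qed.

Lemma smash_surj (s : smash X Y) : exists x y, s = smash_pi (x, y).
Proof.
by exists (repr s).1, (repr s).2; rewrite -surjective_pairing; exact/esym/smash_reprK.
Qed.

Lemma smash_pi_ptl y : smash_pi (gs_pt X, y) = gs_pt (smash X Y).
Proof. by apply/smash_pi_pt; left. Qed.

Lemma smash_pi_ptr x : smash_pi (x, gs_pt Y) = gs_pt (smash X Y).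
Proof. by apply/smash_pi_pt; right. Qed.

Lemma smash_pi_act g x y :
  gs_act g (smash_pi (x, y) : smash X Y) = smash_pi (gs_act g x, gs_act g y).
Proof. exact: smash_act_pi. Qed.

(** Evaluation at a representative; well defined when [k] is trivial on the wedge. *)
Definition smash_lift (W : Type) (k : X -> Y -> W) (s : smash X Y) : W :=
  k (repr s).1 (repr s).2.

Lemma smash_lift_pi (W : Type) (w0 : W) (k : X -> Y -> W) x y :
  (forall y, k (gs_pt X) y = w0) -> (forall x, k x (gs_pt Y) = w0) ->
  smash_lift k (smash_pi (x, y)) = k x y.
Proof.
move=> kl kr; rewrite /smash_lift.
have h p : in_wedge p -> k p.1 p.2 = w0 by move=> [] ->.
have /smash_piP[->//|[w1 w2]] := smash_reprK (smash_pi (x, y)).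
by rewrite (h _ w1) (h _ w2).
Qed.

End smash_points.

(** * Exponential laws for smash products *)

Section disjoint_base_point.
Variables (G : compactGroupType) (H : set G) (A X : gspace G).
Variables (Z : topologicalType) (hZ : compact_hausdorff Z).
Local Notation Zp := (add_base (triv G hZ)).

Definition slice_fun (w : fixed_points H (Map (smash A Zp) X)) (z : Z) (a : A) : X :=
  fev w (smash_pi (a, Some z : Zp)).

Lemma slice_continuous w z : continuous (slice_fun w z).
Proof.
apply: comp_continuous (@fev_continuous _ _ _ _ w).
apply: smash_pair_continuous; first exact: (gs_cg A).1.
- exact: id_continuous.
- exact: cst_continuous.
Qed.

Lemma slice_pt w z : slice_fun w z (gs_pt A) = gs_pt X.
Proof. by rewrite /slice_fun smash_pi_ptl fev_pt. Qed.

Lemma slice_act w z h a : H h -> slice_fun w z (gs_act h a) = gs_act h (slice_fun w z a).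
Proof. by move=> Hh; rewrite /slice_fun -fev_act // smash_pi_act. Qed.

Definition slice w z : fixed_points H (Map A X) :=
  mk_fixed (@slice_continuous w z) (slice_pt w z) (@slice_act w z).

Lemma fev_None (w : fixed_points H (Map (smash A Zp) X)) (a : A) :
  fev w (smash_pi (a, None : Zp)) = gs_pt X.
Proof. by rewrite (smash_pi_ptr Zp a) fev_pt. Qed.

Lemma slice_exponential : exponential slice.
Proof.
split.
- move=> T u hT; have hTZ := compact_hausdorff_prod hT hZ.
  split=> [/(fixed_map_points _ hT) cu|/(fixed_map_points _ hTZ) cu].
    apply/(fixed_map_points _ hTZ).
    apply: (comp_continuous (f := fun w : (T * Z) * A =>
      (w.1.1, smash_pi (w.2, Some w.1.2 : Zp) : smash A Zp)) _ cu).
    have c1 : continuous (fun w : (T * Z) * A => w.1) by exact: fst_continuous.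
    apply: pair_continuous; first exact: comp_continuous c1 (@fst_continuous _ _).
    apply: smash_pair_continuous; [|exact: snd_continuous|].
      exact: k_space_prod_compact hTZ (gs_cg A).1.
    exact: comp_continuous (comp_continuous c1 (@snd_continuous _ _))
      (@add_pt_Some_continuous Z).
  apply/(fixed_map_points _ hT); apply: smash_joint_continuous => //.
  move=> C t a y hC ct ca cy.
  apply: (comp_continuous (f := fun c => (c, y c)) (g := fun w : C * Zp =>
    fev (u (t w.1)) (smash_pi (a w.1, w.2)))).
    by apply: pair_continuous; [exact: id_continuous|].
  apply: add_pt_prod_continuous => /=.
    apply: (comp_continuous (f := fun w : C * Z => ((t w.1, w.2), a w.1)) _ cu).
    have c1 : continuous (fun w : C * Z => w.1) by exact: fst_continuous.
    apply: pair_continuous; last exact: comp_continuous c1 ca.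
    by apply: pair_continuous; [exact: comp_continuous c1 ct|exact: snd_continuous].
  under eq_fun do rewrite fev_None.
  exact: cst_continuous.
- move=> w w' ww'; apply: fev_eq => s; have [a [[z|] ->]] := smash_surj s.
    by have /(congr1 (fun v => fev v a)) := ww' z.
  by rewrite !fev_None.
- move=> k ck; have /(fixed_map_points _ hZ) jk := ck.
  pose f (a : A) (y : Zp) : X := if (y : option Z) is Some z then fev (k z) a else gs_pt X.
  have f1 y : f (gs_pt A) y = gs_pt X by case: y => //= z; exact: fev_pt.
  have f2 a : f a (gs_pt Zp) = gs_pt X by [].
  have fE a y : smash_lift f (smash_pi (a, y)) = f a y by exact: (smash_lift_pi _ _ f1 f2).
  have cf : continuous (smash_lift f).
    apply: (comp_continuous (f := fun s => (tt : discrete_topology unit, s))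
      (g := fun w => smash_lift f w.2)).
      by apply: pair_continuous; [exact: cst_continuous|exact: id_continuous].
    apply: smash_joint_continuous; first exact: point_compact_hausdorff.
    move=> C t a y hC ct ca cy /=; under eq_fun do rewrite fE.
    apply: (comp_continuous (f := fun c => (c, y c)) (g := fun w : C * Zp =>
      f (a w.1) w.2)).
      by apply: pair_continuous; [exact: id_continuous|].
    apply: add_pt_prod_continuous => /=; last exact: cst_continuous.
    apply: (comp_continuous (f := fun w : C * Z => (w.2, a w.1)) _ jk).
    apply: pair_continuous; first exact: snd_continuous.
    exact: comp_continuous (@fst_continuous _ _) ca.
  have fpt' : smash_lift f (gs_pt (smash A Zp)) = gs_pt X.
    by rewrite -(smash_pi_ptr Zp (gs_pt A)) fE.
  have fact h s : H h -> smash_lift f (gs_act h s) = gs_act h (smash_lift f s).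
    move=> Hh; have [a [y ->]] := smash_surj s.
    rewrite smash_pi_act !fE; case: y => [z|] /=; first exact: fev_act.
    by rewrite gs_act_pt.
  exists (mk_fixed cf fpt' fact) => z; apply: fev_eq => a.
  by rewrite /fev /mev /= /slice_fun /fev /mev /= fE.
Qed.

End disjoint_base_point.

Section orbits.
Variables (G : compactGroupType) (H : closed_subgroup G) (A B X : gspace G).
Local Notation Q := (orbit_plus H).
Variables (i : gmap B (smash A Q)) (j : gmap (smash A Q) B).
Hypotheses (ij : cancel i j) (ji : cancel j i).

Local Notation HMap := (fixed_points (csg_set H) (Map A X)).

(** The equivariant extension of an [H]-map over the orbit; the choice of a representative
    of a coset is immaterial because [w] is an [H]-map. *)
Definition spread (w : HMap) (a : A) (y : Q) : X :=
  if (y : option (coset_car H)) is Some q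
  then gs_act (repr q) (fev w (gs_act (repr q)^-1%g a)) else gs_pt X.

Lemma spreadE w a g :
  spread w a (Some (coset_pi H g)) = gs_act g (fev w (gs_act g^-1%g a)).
Proof.
rewrite /spread; set r := repr _.
have /coset_piP Hr : coset_pi H r = coset_pi H g by exact: coset_reprK.
have -> : gs_act r^-1%g a = gs_act (r^-1 * g)%g (gs_act g^-1%g a).
  by rewrite -gs_actM -mulgA mulgV mulg1.
by rewrite fev_act // -gs_actM mulgA mulgV mul1g.
Qed.

Lemma spread_ptl w y : spread w (gs_pt A) y = gs_pt X.
Proof. by case: y => //= q; rewrite gs_act_pt fev_pt gs_act_pt. Qed.

Lemma spread_ptr w a : spread w a (gs_pt Q) = gs_pt X.
Proof. by []. Qed.

Lemma smash_spreadE w a y : smash_lift (spread w) (smash_pi (a, y)) = spread w a y.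
Proof. exact: (smash_lift_pi _ _ (spread_ptl w) (spread_ptr w)). Qed.

Lemma coset_surj (q : coset_car H) : exists g, q = coset_pi H g.
Proof. by exists (repr q); rewrite coset_reprK. Qed.

Lemma spread_act w g a y : spread w (gs_act g a) (gs_act g y) = gs_act g (spread w a y).
Proof.
case: y => [q|]; last by rewrite /spread /= gs_act_pt.
have [x ->] := coset_surj q.
have -> : gs_act g (Some (coset_pi H x) : Q) = Some (coset_pi H (g * x)%g).
  by rewrite /= coset_act_pi.
by rewrite !spreadE !gs_actM invgM gs_actM -[gs_act g^-1%g _]gs_actM mulVg gs_act1.
Qed.

Lemma spread_joint_continuous (T : topologicalType) (u : T -> HMap) :
  compact_hausdorff T -> continuous u ->
  continuous (fun w : T * smash A Q => smash_lift (spread (u w.1)) w.2).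
Proof.
move=> hT cu; apply: smash_joint_continuous => // C t a y hC ct ca cy /=.
under eq_fun do rewrite smash_spreadE.
apply: (comp_continuous (f := fun c => (c, y c)) (g := fun w : C * Q =>
  spread (u (t w.1)) (a w.1) w.2)).
  by apply: pair_continuous; [exact: id_continuous|].
apply: add_pt_prod_continuous; last exact: cst_continuous.
apply: (@quotient_prod_continuous C G (coset_car H) X (coset_pi H)
  (fun w => spread (u (t w.1)) (a w.1) (Some w.2))) => //.
  by move=> q; have [g ->] := coset_surj q; exists g.
rewrite (_ : (fun w => _) = fun w : C * G =>
  gs_act w.2 (fev (u (t w.1)) (gs_act w.2^-1%g (a w.1)))); last first.
  by apply/funext => w; exact: spreadE.
have c1 : continuous (fun w : C * G => w.1) by exact: fst_continuous.
have c2 : continuous (fun w : C * G => w.2) by exact: snd_continuous.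
apply: act_test_continuous => //.
have /(fixed_map_points _ hT) ju := cu.
apply: (comp_continuous (f := fun w : C * G => (t w.1, gs_act w.2^-1%g (a w.1))) _ ju).
apply: pair_continuous; first exact: comp_continuous c1 ct.
apply: act_test_continuous; last exact: comp_continuous c1 ca.
exact: comp_continuous c2 (@invg_continuous G).
Qed.

Lemma induce_continuous (w : HMap) : continuous (fun x => smash_lift (spread w) (i x)).
Proof.
have := @spread_joint_continuous (discrete_topology unit) (fun=> w)
  point_compact_hausdorff (@cst_continuous _ _ _).
move=> c; apply: (comp_continuous (f := fun x => (tt : discrete_topology unit, i x)) _ c).
by apply: pair_continuous; [exact: cst_continuous|exact: gm_continuous].
Qed.

Lemma induce_pt w : smash_lift (spread w) (i (gs_pt B)) = gs_pt X.
Proof. by rewrite gm_pt -(smash_pi_ptl _ (gs_pt Q)) smash_spreadE spread_ptl. Qed.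

Lemma smash_spread_act w g s :
  smash_lift (spread w) (gs_act g s) = gs_act g (smash_lift (spread w) s).
Proof.
by have [a [y ->]] := smash_surj s; rewrite smash_pi_act !smash_spreadE spread_act.
Qed.

Lemma induce_act w g x : [set: G] g ->
  smash_lift (spread w) (i (gs_act g x)) = gs_act g (smash_lift (spread w) (i x)).
Proof. by move=> _; rewrite gm_act smash_spread_act. Qed.

(** The isomorphism between [H]-maps out of [A] and [G]-maps out of [A] smashed with the
    orbit [G/H].  It is transported along an isomorphism of the source, as the members of
    [K] are only isomorphic to such smash products. *)
Definition induce (w : HMap) (_ : discrete_topology unit) : Map_G B X :=
  mk_fixed (@induce_continuous w) (induce_pt w) (@induce_act w).

(* [A] sits in the smash product over the coset of the identity *)
Let at1 (a : A) : B := j (smash_pi (a, Some (coset_pi H 1%g) : Q)).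

Let at1_continuous : continuous at1.
Proof.
apply: comp_continuous (@gm_continuous _ _ _ j); apply: smash_pair_continuous.
- exact: (gs_cg A).1.
- exact: id_continuous.
- exact: cst_continuous.
Qed.

Let at1_pt : at1 (gs_pt A) = gs_pt B.
Proof. by rewrite /at1 smash_pi_ptl gm_pt. Qed.

Let coset_pi_sub h : csg_set H h -> coset_pi H h = coset_pi H 1%g.
Proof. by move=> Hh; apply/coset_piP; rewrite mulg1; exact: csgV. Qed.

Let at1_act h a : csg_set H h -> at1 (gs_act h a) = gs_act h (at1 a).
Proof.
move=> Hh; rewrite /at1 -gm_act smash_pi_act.
have -> : gs_act h (Some (coset_pi H 1%g) : Q) = Some (coset_pi H 1%g).
  by rewrite /= coset_act_pi mulg1 coset_pi_sub.
by [].
Qed.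

Let induce_at1 w t a : fev (induce w t) (at1 a) = fev w a.
Proof.
by rewrite /fev /mev /= /at1 ji smash_spreadE spreadE invg1 !gs_act1.
Qed.

Lemma induce_exponential : exponential induce.
Proof.
split.
- move=> T u hT.
  have hT1 := compact_hausdorff_prod hT point_compact_hausdorff.
  split=> [cu|/(fixed_map_points _ hT1) cu].
    apply/(fixed_map_points _ hT1).
    apply: (comp_continuous (f := fun w : (T * discrete_topology unit) * B =>
      (w.1.1, i w.2)) _ (spread_joint_continuous hT cu)).
    apply: pair_continuous.
      exact: comp_continuous (@fst_continuous _ _) (@fst_continuous _ _).
    exact: comp_continuous (@snd_continuous _ _) (@gm_continuous _ _ _ i).
  apply/(fixed_map_points _ hT).
  rewrite (_ : (fun w => _) = fun w : T * A =>
      fev (induce (u w.1) (tt : discrete_topology unit)) (at1 w.2)).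
    apply: (comp_continuous (f := fun w : T * A =>
      ((w.1, tt : discrete_topology unit), at1 w.2)) _ cu).
    apply: pair_continuous.
      by apply: pair_continuous; [exact: fst_continuous|exact: cst_continuous].
    exact: comp_continuous (@snd_continuous _ _) at1_continuous.
  by apply/funext => w; rewrite induce_at1.
- move=> w w' ww'; apply: fev_eq => a.
  by rewrite -(induce_at1 w tt) -(induce_at1 w' tt) ww'.
- move=> k _; pose f a := fev (k tt) (at1 a).
  have cf : continuous f by exact: comp_continuous at1_continuous (@fev_continuous _ _ _ _ _).
  have fp : f (gs_pt A) = gs_pt X by rewrite /f at1_pt fev_pt.
  have fa h a : csg_set H h -> f (gs_act h a) = gs_act h (f a).
    by move=> Hh; rewrite /f at1_act // fev_act.
  exists (mk_fixed cf fp fa) => -[]; apply: fev_eq => x.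
  rewrite {1}/fev /mev /= -{2}(ij x); have [a [y ->]] := smash_surj (i x).
  rewrite smash_spreadE; case: y => [q|]; last first.
    by rewrite (smash_pi_ptr Q a) gm_pt fev_pt.
  have [g ->] := coset_surj q; rewrite spreadE /fev /mev /= /f -fev_act //.
  congr fev; rewrite /at1 -gm_act smash_pi_act -gs_actM mulgV gs_act1.
  by rewrite /= coset_act_pi mulg1.
Qed.

End orbits.

Section adjunction.
Variables (G : compactGroupType) (Z : topologicalType) (hZ : compact_hausdorff Z).
Variables (B B' Q X : gspace G) (i : gmap B' (smash B Q)) (j : gmap (smash B Q) B').
Hypotheses (ij : cancel i j) (ji : cancel j i).
Local Notation Zp := (add_base (triv G hZ)).
Local Notation W2 := (Map_G B (Map (smash Zp Q) X)).

Definition untwist_fun (w : W2) (z : Z) (b : B) (q : Q) : X :=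
  mev (fev w b) (smash_pi (Some z : Zp, q)).

Lemma untwist_ptl w z q : untwist_fun w z (gs_pt B) q = gs_pt X.
Proof. by rewrite /untwist_fun fev_pt. Qed.

Lemma untwist_ptr w z b : untwist_fun w z b (gs_pt Q) = gs_pt X.
Proof. by rewrite /untwist_fun (smash_pi_ptr Q (Some z : Zp)) /mev pm_pt. Qed.

Lemma smash_untwistE w z b q :
  smash_lift (untwist_fun w z) (smash_pi (b, q)) = untwist_fun w z b q.
Proof. exact: (smash_lift_pi _ _ (untwist_ptl w z) (untwist_ptr w z)). Qed.

Lemma mev_conj (A Y : gspace G) g (u : Map A Y) (a : A) :
  mev (gs_act g u) (gs_act g a) = gs_act g (mev u a).
Proof. by rewrite {1}/mev /= -gs_actM mulVg gs_act1. Qed.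

Lemma untwist_fun_act w z g b q :
  untwist_fun w z (gs_act g b) (gs_act g q) = gs_act g (untwist_fun w z b q).
Proof.
rewrite /untwist_fun fev_act // -mev_conj; congr (mev _ _).
by rewrite smash_pi_act.
Qed.

Lemma untwist_joint_continuous (T : topologicalType) (u : T -> W2) (z : T -> Z) :
  compact_hausdorff T -> continuous u -> continuous z ->
  continuous (fun w : T * smash B Q => smash_lift (untwist_fun (u w.1) (z w.1)) w.2).
Proof.
move=> hT /(fixed_map_points _ hT) cu cz.
apply: smash_joint_continuous => // C t b q hC ct cb cq /=.
under eq_fun do rewrite smash_untwistE.
apply: map_points_diag => //.
  apply: (comp_continuous (f := fun c => (t c, b c)) _ cu).
  by apply: pair_continuous.
apply: smash_pair_continuous => //.
  exact: (compact_hausdorff_compactly_generated hC).1.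
exact: comp_continuous (comp_continuous ct cz) (@add_pt_Some_continuous Z).
Qed.

Lemma untwist_continuous w z : continuous (fun x => smash_lift (untwist_fun w z) (i x)).
Proof.
have := @untwist_joint_continuous (discrete_topology unit) (fun=> w) (fun=> z)
  point_compact_hausdorff (@cst_continuous _ _ _) (@cst_continuous _ _ _).
move=> c; apply: (comp_continuous (f := fun x => (tt : discrete_topology unit, i x)) _ c).
by apply: pair_continuous; [exact: cst_continuous|exact: gm_continuous].
Qed.

Lemma untwist_pt w z : smash_lift (untwist_fun w z) (i (gs_pt B')) = gs_pt X.
Proof. by rewrite gm_pt -(smash_pi_ptl _ (gs_pt Q)) smash_untwistE untwist_ptl. Qed.

Lemma untwist_act w z g x : [set: G] g -> smash_lift (untwist_fun w z) (i (gs_act g x)) =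
  gs_act g (smash_lift (untwist_fun w z) (i x)).
Proof.
move=> _; rewrite gm_act; have [b [q ->]] := smash_surj (i x).
by rewrite smash_pi_act !smash_untwistE untwist_fun_act.
Qed.

(** The adjunction between smash product and mapping space, the disjoint base point being
    absorbed into the parameters. *)
Definition untwist (w : W2) (z : Z) : Map_G B' X :=
  mk_fixed (@untwist_continuous w z) (untwist_pt w z) (@untwist_act w z).

Lemma fev_untwist w z b q :
  fev (untwist w z) (j (smash_pi (b, q))) = mev (fev w b) (smash_pi (Some z : Zp, q)).
Proof. by rewrite {1}/fev /mev /= ji smash_untwistE. Qed.

Lemma mev_None (u : Map (smash Zp Q) X) q : mev u (smash_pi (None : Zp, q)) = gs_pt X.
Proof. by rewrite (smash_pi_ptl Zp q) /mev pm_pt. Qed.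

Lemma untwist_exponential : exponential untwist.
Proof.
split.
- move=> T u hT; have hTZ := compact_hausdorff_prod hT hZ.
  split=> [cu|/(fixed_map_points _ hTZ) cu].
    apply/(fixed_map_points _ hTZ).
    have c := untwist_joint_continuous hTZ
      (comp_continuous (@fst_continuous T Z) cu) (@snd_continuous T Z).
    apply: (comp_continuous (f := fun w : (T * Z) * B' => (w.1, i w.2)) _ c).
    apply: pair_continuous; first exact: fst_continuous.
    exact: comp_continuous (@snd_continuous _ _) (@gm_continuous _ _ _ i).
  apply/(fixed_map_points _ hT); apply: map_k_points.
    exact: k_space_prod_compact hT (gs_cg B).1.
  move=> C w s hC cw cs.
  have cw1 : continuous (fun c => (w c).1) by exact: comp_continuous cw (@fst_continuous _ _).
  have cw2 : continuous (fun c => (w c).2) by exact: comp_continuous cw (@snd_continuous _ _).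
  apply: (comp_continuous (f := fun c => (c, s c)) (g := fun v : C * smash Zp Q =>
    mev (fev (u (w v.1).1) (w v.1).2) v.2)).
    by apply: pair_continuous; [exact: id_continuous|].
  apply: smash_joint_continuous => // C' t y q hC' ct cy cq /=.
  apply: (comp_continuous (f := fun c => (c, y c)) (g := fun v : C' * Zp =>
    mev (fev (u (w (t v.1)).1) (w (t v.1)).2) (smash_pi (v.2, q v.1)))).
    by apply: pair_continuous; [exact: id_continuous|].
  apply: add_pt_prod_continuous => /=.
    under eq_fun do rewrite -fev_untwist.
    apply: (comp_continuous (f := fun v : C' * Z =>
      (((w (t v.1)).1, v.2), j (smash_pi ((w (t v.1)).2, q v.1)))) _ cu).
    have c1 : continuous (fun v : C' * Z => v.1) by exact: fst_continuous.
    apply: pair_continuous.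
      apply: pair_continuous; last exact: snd_continuous.
      exact: comp_continuous (comp_continuous c1 ct) cw1.
    apply: comp_continuous (@gm_continuous _ _ _ j); apply: smash_pair_continuous.
    + exact: (compact_hausdorff_compactly_generated (compact_hausdorff_prod hC' hZ)).1.
    + exact: comp_continuous (comp_continuous c1 ct) cw2.
    + exact: comp_continuous c1 cq.
  under eq_fun do rewrite mev_None.
  exact: cst_continuous.
- move=> w w' ww'; apply: fev_eq => b; apply: mev_eq => s.
  have [[z|] [q ->]] := smash_surj s; last by rewrite !mev_None.
  by rewrite -!fev_untwist ww'.
- move=> k ck; have /(fixed_map_points _ hZ) jk := ck.
  pose f (b : B) (y : Zp) (q : Q) : X :=
    if (y : option Z) is Some z then fev (k z) (j (smash_pi (b, q))) else gs_pt X.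
  have f1 b q : f b (gs_pt Zp) q = gs_pt X by [].
  have f2 b y : f b y (gs_pt Q) = gs_pt X.
    by case: y => //= z; rewrite (smash_pi_ptr Q b) gm_pt fev_pt.
  have fE b y q : smash_lift (f b) (smash_pi (y, q)) = f b y q.
    exact: (smash_lift_pi _ _ (f1 b) (f2 b)).
  have jf (C : topologicalType) (b : C -> B) : compact_hausdorff C -> continuous b ->
      continuous (fun w : C * smash Zp Q => smash_lift (f (b w.1)) w.2).
    move=> hC cb; apply: smash_joint_continuous => // C' t y q hC' ct cy cq /=.
    under eq_fun do rewrite fE.
    apply: (comp_continuous (f := fun c => (c, y c)) (g := fun v : C' * Zp =>
      f (b (t v.1)) v.2 (q v.1))).
      by apply: pair_continuous; [exact: id_continuous|].
    apply: add_pt_prod_continuous => /=; last exact: cst_continuous.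
    apply: (comp_continuous (f := fun v : C' * Z =>
      (v.2, j (smash_pi (b (t v.1), q v.1)))) _ jk).
    have c1 : continuous (fun v : C' * Z => v.1) by exact: fst_continuous.
    apply: pair_continuous; first exact: snd_continuous.
    apply: comp_continuous (@gm_continuous _ _ _ j); apply: smash_pair_continuous.
    + exact: (compact_hausdorff_compactly_generated (compact_hausdorff_prod hC' hZ)).1.
    + exact: comp_continuous (comp_continuous c1 ct) cb.
    + exact: comp_continuous c1 cq.
  have cf b : continuous (smash_lift (f b)).
    have c := jf (discrete_topology unit) (fun=> b) point_compact_hausdorff
      (@cst_continuous _ _ _).
    apply: (comp_continuous (f := fun s => (tt : discrete_topology unit, s)) _ c).
    by apply: pair_continuous; [exact: cst_continuous|exact: id_continuous].
  have fpt' b : smash_lift (f b) (gs_pt (smash Zp Q)) = gs_pt X.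
    by rewrite -(smash_pi_ptl Zp (gs_pt Q)) fE.
  pose g b : Map (smash Zp Q) X := PMap (cf b) (fpt' b).
  have cg : continuous g.
    apply: map_k_points; first exact: (gs_cg B).1.
    move=> C b s hC cb cs.
    apply: (comp_continuous (f := fun c => (c, s c)) _ (jf C b hC cb)).
    by apply: pair_continuous; [exact: id_continuous|].
  have gE b y q : mev (g b) (smash_pi (y, q)) = f b y q by exact: fE.
  have gpt : g (gs_pt B) = gs_pt (Map (smash Zp Q) X).
    apply: mev_eq => s; have [y [q ->]] := smash_surj s; rewrite gE.
    by case: y => //= z; rewrite smash_pi_ptl gm_pt fev_pt.
  have gact h b : [set: G] h -> g (gs_act h b) = gs_act h (g b).
    move=> _; apply: mev_eq => s.
    have -> : s = gs_act h (gs_act h^-1%g s) by rewrite -gs_actM mulgV gs_act1.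
    have [y [q ->]] := smash_surj (gs_act h^-1%g s).
    rewrite mev_conj smash_pi_act !gE; case: y => [z|] /=; last by rewrite gs_act_pt.
    by rewrite -fev_act // -gm_act smash_pi_act.
  exists (mk_fixed cg gpt gact) => z; apply: fev_eq => x.
  rewrite -(ij x); have [b [q ->]] := smash_surj (i x).
  by rewrite fev_untwist; exact: gE.
Qed.

End adjunction.

(** * Closure of the colocal equivalences *)

Section closure.
Variables (R : realType) (G : compactGroupType) (J : Type) (K : J -> gspace G).
Hypothesis (closed_orbit : forall (i : J) (H : closed_subgroup G),
  exists j : J, gspace_iso (K j) (smash (K i) (orbit_plus H))).
Variables (X Y : gspace G) (f : gmap X Y).
Hypothesis (wf : colocal_equivalence R K f).

(** The [H]-fixed points of [Map (K l) X] are the equivariant maps out of [K l] smashed with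
    [G/H], which is again a member of [K]. *)
Lemma Map_colocal_weak_equivalence (l : J) : weak_equivalence R (Map_map (K l) f).
Proof.
move=> H; have [k [u [v [uv vu]]]] := closed_orbit l H.
apply: (exponential_weak_equivalence (fpt _ _)
  (@induce_exponential G H (K l) (K k) X u v uv vu)
  (@induce_exponential G H (K l) (K k) Y u v uv vu)
  (@fixed_map_continuous _ _ _ _ (Map_map (K k) f))
  (@fixed_map_continuous _ _ _ _ (Map_map (K l) f)) _ (point_family_lifts (wf k))).
move=> w z; apply: fev_eq => x.
rewrite /fev /mev /= /fev /mev /= /smash_lift /spread /=.
case: (repr (u x)).2 => [q|] /=; last by rewrite gm_pt.
by rewrite gm_act.
Qed.

Variables (Z : topologicalType) (hZ : compact_hausdorff Z).
Hypothesis (L : forall (V W : topologicalType) (p : V -> W),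
  weak_homotopy_equivalence R p -> @family_lifts R V W p Z).

Lemma Map_smash_weak_equivalence (A : gspace G) : weak_equivalence R (Map_map A f) ->
  weak_equivalence R (Map_map (smash A (add_base (triv G hZ))) f).
Proof.
move=> wA H.
apply: (exponential_weak_equivalence (fpt _ _)
  (@slice_exponential G (csg_set H) A X Z hZ) (@slice_exponential G (csg_set H) A Y Z hZ)
  (@fixed_map_continuous _ _ _ _ (Map_map A f)) (@fixed_map_continuous _ _ _ _ _) _
  (L (wA H))).
by move=> w z; apply: fev_eq.
Qed.

(** The orbit is moved across the adjunction to [K i], leaving a family of points of an
    equivariant mapping space out of a member of [K]. *)
Lemma Map_orbit_colocal_equivalence (H : closed_subgroup G) :
  colocal_equivalence R K (Map_map (smash (add_base (triv G hZ)) (orbit_plus H)) f).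
Proof.
move=> i; have [k [u [v [uv vu]]]] := closed_orbit i H.
apply: (exponential_weak_equivalence (fpt _ _)
  (@untwist_exponential G Z hZ (K i) (K k) (orbit_plus H) X u v uv vu)
  (@untwist_exponential G Z hZ (K i) (K k) (orbit_plus H) Y u v uv vu)
  (@fixed_map_continuous _ _ _ _ (Map_map (K k) f)) (@fixed_map_continuous _ _ _ _ _) _
  (L (wf k))).
by move=> w z; apply: fev_eq.
Qed.

End closure.

Theorem proposition10p1 (R : realType) (G : compactGroupType)
    (lieG : is_lie_group R G) (I : Type) (K : I -> gspace G)
    (cofK : forall i : I, cofibrant R (K i))
    (closed_circle : forall i : I,
       exists j : I, gspace_iso (K j) (smash (K i) (circle R G)))
    (closed_orbit : forall (i : I) (H : closed_subgroup G),
       exists j : I, gspace_iso (K j) (smash (K i) (orbit_plus H))) :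
  condition_dollar R K.
Proof.
move=> a [[l [n ->]]|[n [H ->]]] A AE X Y f _ _ wf.
  have wA : weak_equivalence R (Map_map A f).
    have wl := Map_colocal_weak_equivalence closed_orbit wf l.
    case: AE => -> /=; apply: Map_smash_weak_equivalence wl => V W p wp.
      exact: sphere_family_lifts wp n.
    exact: disk_family_lifts wp n.
  by move=> i; exact: cofibrant_weak_equivalence.
case: AE => -> /=; apply: (Map_orbit_colocal_equivalence closed_orbit wf) => V W p wp.
  exact: disk_family_lifts wp n.
exact: disk_cylinder_family_lifts wp n.
Qed.
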